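(* Fix $L>0$ and $$\theta(0)=\theta_0,\qquad\theta'(0)=a_0,\qquad\theta''(0)=b_0,\qquad\rho(0)=\rho_0>0.$$ Define $$k_{1,0}=a_0+\frac{\sin\theta_0}{L},\qquad H_0=\frac{a_0}{2}+\frac{\sin\theta_0}{L},\qquad H_0'=\frac{b_0}{2}+\frac{a_0\cos\theta_0}{L}.$$ Assume $$k_{1,0}\neq0,\qquad H_0\neq0,\qquad H_0'\neq0,\qquad H_0\neq-k_{1,0},$$ and choose $u_0$ so that $u_0/H_0>0$. Consider the scalar third-order equation for $\theta$ $$w'+w^2+\frac{\cos\theta}{L}w-k_1^2-\frac{\sin^2\theta}{L^2}-\frac2{L^2}=0,\qquad w=-\frac{H'}{k_1},\quad k_1=\theta'+\frac{\sin\theta}{L},\quad H=\frac{\theta'}2+\frac{\sin\theta}{L}.$$ Then this equation, with the given initial data $(\theta_0,a_0,b_0)$, has a unique local real-analytic solution, and the quadratures $$\rho(s)=\rho_0\exp\Bigl[\frac1L\int_0^s\cos\theta(\tau)\,d\tau\Bigr],\quad u(s)=u_0\exp\Bigl[-\int_0^s\frac{H'(\tau)}{k_1(\tau)}\,d\tau\Bigr],\quad\lambda(s)^2=\frac{u(s)}{H(s)}$$ determine, for some $\delta>0$ and an interval $J\subset\mathbb R$, a local real-analytic timelike parabolic rotational immersion $X:(-\delta,\delta)\times J\to\mathrm{AdS}_3(L)$ such that $$X:\bigl((-\delta,\delta)\times J,\,\lambda^{-2}(ds^2-\rho^2dt^2)\bigr)\to\mathrm{AdS}_3(L)$$ is proper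 biharmonic. Both $H$ and $\lambda$ are nonconstant. The conditions $k_{1,0}\neq0$, $H_0\neq0$, $H_0'\neq0$, $H_0\neq-k_{1,0}$ define an open subset of the initial-data space.
   Context: $\mathrm{AdS}_3(L)=\{X\in\mathbb R^{2,2}:\langle X,X\rangle=-L^2\}$ with $\langle X,X\rangle=-X_0^2-X_1^2+X_2^2+X_3^2$, carrying the induced Lorentzian metric of constant curvature $-1/L^2$. The immersion $X$ determined by $\theta$ is the one (real-principal, spacelike profile, timelike orbit) with induced Lorentzian metric $g=ds^2-\rho(s)^2dt^2$, spacelike unit normal $\xi$ ($\langle\xi,\xi\rangle=+1$), and shape operator $A$ ($\nabla^N_Y\xi=-AY$) given by $A\partial_s=k_1\partial_s$, $A\partial_t=k_2\partial_t$, where $k_1=\theta'+\frac{\sin\theta}{L}$, $k_2=\frac{\sin\theta}{L}$ and $q=\rho'/\rho=\frac{\cos\theta}{L}$. Its scalar mean curvature, defined by mean-curvature vector $=H\xi$ (mean-curvature vector $=$ half the $g$-trace of the second fundamental form), is $H=\frac12\operatorname{tr}_gA=\frac{k_1+k_2}2$. Timelike means that $g$ is Lorentzian. Parabolic rotational means that $X_t=\mathcal BX$ for a constant $\mathcal B\in\mathfrak{so}(2,2)$ (skew-adjoint endomorphism of $\mathbb R^{2,2}$) of rank two with $\mathcal B^3=0$, $\mathcal B^2\neq0$. For a smooth map $\phi:(M,g')\to(N,h)$ between pseudo-Riemannian manifolds, $\tau_{g'}(\phi)=\operatorname{tr}_{g'}\nabla d\phi$ and $\tau_{2,g'}(\phi)=\Delta^\phi_{g'}\tau_{g'}(\phi)-\sum_i\epsilon_iR^N(d\phi(e_i),\tau_{g'}(\phi))d\phi(e_i)$,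 where $\{e_i\}$ is a local $g'$-pseudo-orthonormal frame with $g'(e_i,e_j)=\epsilon_i\delta_{ij}$, $\Delta^\phi_{g'}V=\sum_i\epsilon_i(\nabla^\phi_{e_i}\nabla^\phi_{e_i}V-\nabla^\phi_{\nabla_{e_i}e_i}V)$, and $R^N(X,Y)=[\nabla^N_X,\nabla^N_Y]-\nabla^N_{[X,Y]}$. The map is biharmonic if $\tau_{2,g'}(\phi)=0$; proper biharmonic means biharmonic but not harmonic ($\tau_{g'}(\phi)\not\equiv0$). Primes denote $d/ds$. *)

(* Defs.v *)
(* Analysis is done on Stdlib's [R] with Coquelicot (scope [R_scope]); vectors
   and matrices are MathComp's over the same [R] (their operations are written
   with the delimiter [%mc]). *)
From Stdlib Require Import Reals.
From mathcomp Require Import all_boot all_algebra Rstruct.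
From Coquelicot Require Import Coquelicot.

Set Implicit Arguments.
Unset Strict Implicit.
Unset Printing Implicit Defensive.

Delimit Scope ring_scope with mc.
Delimit Scope R_scope with R.
Open Scope ring_scope.
Open Scope R_scope.

(** * The space R^{2,2} and AdS_3(L) *)

Definition ip (x y : 'cV[R]_4) : R :=
  \sum_(i < 4) ((if (i < 2)%N then -1 else 1) * x i ord0 * y i ord0)%mc.

Definition isAdS (L : R) (x : 'cV[R]_4) : Prop := ip x x = - L ^ 2.

(* For p in AdS_3(L), the orthogonal projection of R^{2,2} onto T_p AdS_3(L),
   which is the orthogonal complement of p. *)
Definition tproj (L : R) (p v : 'cV[R]_4) : 'cV[R]_4 :=
  (v + (ip v p / L ^ 2)%R *: p)%mc.

Definition skew_adjoint (B : 'M[R]_4) : Prop :=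
  forall x y : 'cV[R]_4, ip (B *m x) y = - ip x (B *m y).

Definition linear_isometry (Q : 'M[R]_4) : Prop :=
  forall x y : 'cV[R]_4, ip (Q *m x) (Q *m y) = ip x y.

(** * Levi-Civita connection and curvature tensor of AdS_3(L)

   Vector fields are maps on R^{2,2} which are tangent to AdS_3(L) along it;
   the connection is the tangential part of the flat derivative. *)

Definition ddir (F : 'cV[R]_4 -> 'cV[R]_4) (v p : 'cV[R]_4) : 'cV[R]_4 :=
  \col_i Derive (fun h : R => F (p + h *: v)%mc i ord0) 0.

Definition nablaN (L : R) (Y Z : 'cV[R]_4 -> 'cV[R]_4) (p : 'cV[R]_4) :
  'cV[R]_4 := tproj L p (ddir Z (Y p) p).

Definition bracket (Y Z : 'cV[R]_4 -> 'cV[R]_4) (p : 'cV[R]_4) : 'cV[R]_4 :=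
  (ddir Z (Y p) p - ddir Y (Z p) p)%mc.

Definition curvN_field (L : R) (X Y Z : 'cV[R]_4 -> 'cV[R]_4)
    (p : 'cV[R]_4) : 'cV[R]_4 :=
  (nablaN L X (nablaN L Y Z) p - nablaN L Y (nablaN L X Z) p
   - nablaN L (bracket X Y) Z p)%mc.

(* R^N(x,y)z at p. Since the curvature is tensorial, it may be computed with
   any tangent extensions of x, y, z in T_p AdS_3(L); we take the fields
   q |-> tproj L q x, etc. *)
Definition curvN (L : R) (p x y z : 'cV[R]_4) : 'cV[R]_4 :=
  curvN_field L (fun q => tproj L q x) (fun q => tproj L q y)
    (fun q => tproj L q z) p.

(** * Regularity *)

Definition analytic_on (U : R -> Prop) (f : R -> R) : Prop :=
  forall x0, U x0 -> exists (a : nat -> R) (r : R), 0 < r /\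
    forall x, Rabs (x - x0) < r -> is_pseries (K := R_AbsRing) a (x - x0) (f x).

(* Local expansion as an absolutely convergent double power series, the terms
   being grouped by total degree. *)
Definition analytic2_on (U : R -> R -> Prop) (f : R -> R -> R) : Prop :=
  forall s0 t0, U s0 t0 -> exists (a : nat -> nat -> R) (r : R), 0 < r /\
    forall s t, Rabs (s - s0) < r -> Rabs (t - t0) < r ->
      let term k l := a k l * (s - s0) ^ k * (t - t0) ^ l in
      ex_series (fun n => sum_f_R0 (fun k => Rabs (term k (n - k)%N)) n) /\
      is_series (fun n => sum_f_R0 (fun k => term k (n - k)%N) n) (f s t).

Definition smooth2_on (U : R -> R -> Prop) (f : R -> R -> R) : Prop :=
  forall s t, U s t -> forall n : nat, ex_diff_n f n s t.

Definition open2 (U : R -> R -> Prop) : Prop :=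
  forall s t, U s t -> locally_2d U s t.

(** * Surfaces in coordinates

   The source is a domain U of the (s,t)-plane. Indices a, b, c : 'I_2 refer to
   the coordinates: 0 is s and 1 is t. *)

Definition pd (a : 'I_2) (f : R -> R -> R) (s t : R) : R :=
  if a == ord0 then Derive (fun x => f x t) s else Derive (fun y => f s y) t.

Definition vpd n (a : 'I_2) (V : R -> R -> 'cV[R]_n) (s t : R) : 'cV[R]_n :=
  \col_i pd a (fun x y => V x y i ord0) s t.

Definition jacobian (X : R -> R -> 'cV[R]_4) (s t : R) : 'M[R]_(4, 2) :=
  \matrix_(i, a) vpd a X s t i ord0.

Definition pseudo_riemannian (U : R -> R -> Prop) (g : R -> R -> 'M[R]_2) :
  Prop :=
  (forall a b, smooth2_on U (fun s t => g s t a b)) /\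
  (forall s t, U s t -> (g s t)^T%mc = g s t /\ g s t \in unitmx).

Definition lorentzian (h : 'M[R]_2) : Prop :=
  exists P : 'M[R]_2, P \in unitmx /\
    (P^T *m h *m P)%mc = diag_mx (\row_a (if a == ord0 then 1 else - 1)).

Definition christoffel (g : R -> R -> 'M[R]_2) (c a b : 'I_2) (s t : R) : R :=
  / 2 * \sum_(d < 2) (invmx (g s t) c d *
    (pd a (fun x y => g x y b d) s t + pd b (fun x y => g x y a d) s t
     - pd d (fun x y => g x y a b) s t)).

(* Levi-Civita connection of (U, g). *)
Definition nablaM (g : R -> R -> 'M[R]_2) (Y Z : R -> R -> 'cV[R]_2)
    (s t : R) : 'cV[R]_2 :=
  \col_c (\sum_(a < 2) Y s t a ord0 * pd a (fun x y => Z x y c ord0) s t +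
          \sum_(a < 2) \sum_(b < 2)
            christoffel g c a b s t * Y s t a ord0 * Z s t b ord0).

Section Maps.
Variables (L : R) (g : R -> R -> 'M[R]_2) (phi : R -> R -> 'cV[R]_4).

(* Pullback connection along phi : U -> AdS_3(L). *)
Definition nabla_coord (a : 'I_2) (V : R -> R -> 'cV[R]_4) (s t : R) :
  'cV[R]_4 := tproj L (phi s t) (vpd a V s t).

Definition nabla_phi (Y : R -> R -> 'cV[R]_2) (V : R -> R -> 'cV[R]_4)
    (s t : R) : 'cV[R]_4 :=
  (\sum_(a < 2) Y s t a ord0 *: nabla_coord a V s t)%mc.

Definition dphi (Y : R -> R -> 'cV[R]_2) (s t : R) : 'cV[R]_4 :=
  (\sum_(a < 2) Y s t a ord0 *: vpd a phi s t)%mc.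

(* (nabla d phi)(d_a, d_b) *)
Definition hess (a b : 'I_2) (s t : R) : 'cV[R]_4 :=
  (nabla_coord a (vpd b phi) s t
   - \sum_(c < 2) christoffel g c a b s t *: vpd c phi s t)%mc.

Definition tension (s t : R) : 'cV[R]_4 :=
  (\sum_(a < 2) \sum_(b < 2) invmx (g s t) a b *: hess a b s t)%mc.

Definition pseudo_orthonormal_frame (U : R -> R -> Prop)
    (e : 'I_2 -> R -> R -> 'cV[R]_2) (eps : 'I_2 -> R) : Prop :=
  (forall i c, smooth2_on U (fun s t => e i s t c ord0)) /\
  (forall i, eps i = 1 \/ eps i = - 1) /\
  (forall s t, U s t -> forall i j : 'I_2,
     ((e i s t)^T *m g s t *m e j s t)%mc ord0 ord0
     = if i == j then eps i else 0).

Definition laplacian (e : 'I_2 -> R -> R -> 'cV[R]_2) (eps : 'I_2 -> R)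
    (V : R -> R -> 'cV[R]_4) (s t : R) : 'cV[R]_4 :=
  (\sum_(i < 2) eps i *: (nabla_phi (e i) (nabla_phi (e i) V) s t
                          - nabla_phi (nablaM g (e i) (e i)) V s t))%mc.

Definition bitension (e : 'I_2 -> R -> R -> 'cV[R]_2) (eps : 'I_2 -> R)
    (s t : R) : 'cV[R]_4 :=
  (laplacian e eps tension s t
   - \sum_(i < 2) eps i *: curvN L (phi s t) (dphi (e i) s t) (tension s t)
                                 (dphi (e i) s t))%mc.

(* The bitension field does not depend on the local frame (and local frames
   exist around every point), so it is required to vanish for each of them. *)
Definition biharmonic (U : R -> R -> Prop) : Prop :=
  pseudo_riemannian U g /\
  (forall i, smooth2_on U (fun s t => phi s t i ord0)) /\
  (forall s t, U s t -> isAdS L (phi s t)) /\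
  (forall (V : R -> R -> Prop) e eps, open2 V ->
     (forall s t, V s t -> U s t) -> pseudo_orthonormal_frame V e eps ->
     forall s t, V s t -> bitension e eps s t = 0%mc).

Definition harmonic (U : R -> R -> Prop) : Prop :=
  forall s t, U s t -> tension s t = 0%mc.

Definition proper_biharmonic (U : R -> R -> Prop) : Prop :=
  biharmonic U /\ ~ harmonic U.

(* Mean curvature vector, when g is the metric induced by phi: nabla d phi is
   then the second fundamental form. *)
Definition mean_curvature_vector (s t : R) : 'cV[R]_4 :=
  ((/ 2)%R *: tension s t)%mc.

(* A is the matrix of the shape operator with respect to xi in the basis
   (d_s, d_t), with the convention nabla^N_Y xi = - A Y. *)
Definition shape_operator (U : R -> R -> Prop) (xi : R -> R -> 'cV[R]_4)
    (A : R -> R -> 'M[R]_2) : Prop :=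
  forall s t, U s t -> forall a : 'I_2,
    nabla_coord a xi s t = (- \sum_(b < 2) A s t b a *: vpd b phi s t)%mc.

End Maps.

(** * The immersion determined by theta *)

Section Theta.
Variables (L : R) (theta : R -> R).

Definition k1 (s : R) : R := Derive theta s + sin (theta s) / L.
Definition k2 (s : R) : R := sin (theta s) / L.
Definition meanH (s : R) : R := Derive theta s / 2 + sin (theta s) / L.
Definition w (s : R) : R := - Derive meanH s / k1 s.

Definition theta_equation (s : R) : Prop :=
  Derive w s + w s ^ 2 + cos (theta s) / L * w s - k1 s ^ 2
  - sin (theta s) ^ 2 / L ^ 2 - 2 / L ^ 2 = 0.

(* k1 does not vanish on the interval of existence, so that w makes sense. *)
Definition theta_solution (th0 a0 b0 delta : R) : Prop :=
  analytic_on (fun s => Rabs s < delta) theta /\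
  theta 0 = th0 /\ Derive theta 0 = a0 /\ Derive_n theta 2 0 = b0 /\
  (forall s, Rabs s < delta -> k1 s <> 0 /\ theta_equation s).

Definition rho (rho0 : R) (s : R) : R :=
  rho0 * exp (/ L * RInt (fun tau => cos (theta tau)) 0 s).

Definition u (u0 : R) (s : R) : R :=
  u0 * exp (- RInt (fun tau => Derive meanH tau / k1 tau) 0 s).

(* ds^2 - rho(s)^2 dt^2 *)
Definition profile_metric (r : R -> R) (s t : R) : 'M[R]_2 :=
  diag_mx (\row_a (if a == ord0 then 1 else - r s ^ 2)).

Definition conformal_metric (lambda r : R -> R) (s t : R) : 'M[R]_2 :=
  ((/ lambda s ^ 2)%R *: profile_metric r s t)%mc.

Definition induced_metric (X : R -> R -> 'cV[R]_4) (s t : R) : 'M[R]_2 :=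
  \matrix_(a, b) ip (vpd a X s t) (vpd b X s t).

Definition immersion (U : R -> R -> Prop) (X : R -> R -> 'cV[R]_4) : Prop :=
  forall s t, U s t -> \rank (jacobian X s t) = 2%N.

Definition timelike (U : R -> R -> Prop) (X : R -> R -> 'cV[R]_4) : Prop :=
  forall s t, U s t -> lorentzian (induced_metric X s t).

Definition unit_normal (U : R -> R -> Prop) (X xi : R -> R -> 'cV[R]_4) :
  Prop :=
  forall s t, U s t -> ip (xi s t) (xi s t) = 1 /\ ip (xi s t) (X s t) = 0 /\
    forall a, ip (xi s t) (vpd a X s t) = 0.

(* X is an immersion into AdS_3(L) determined by theta, with unit normal xi. *)
Record determined_by (rho0 : R) (U : R -> R -> Prop)
    (X xi : R -> R -> 'cV[R]_4) : Prop := {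
  det_X_analytic : forall i, analytic2_on U (fun s t => X s t i ord0);
  det_xi_analytic : forall i, analytic2_on U (fun s t => xi s t i ord0);
  det_AdS : forall s t, U s t -> isAdS L (X s t);
  det_immersion : immersion U X;
  det_metric : forall s t, U s t ->
    induced_metric X s t = profile_metric (rho rho0) s t;
  det_normal : unit_normal U X xi;
  det_shape : shape_operator L X U xi
    (fun s _ => diag_mx (\row_a (if a == ord0 then k1 s else k2 s)));
  det_mean : forall s t, U s t ->
    mean_curvature_vector L (profile_metric (rho rho0)) X s t
    = (meanH s *: xi s t)%mc }.

End Theta.

Definition parabolic_rotational (U : R -> R -> Prop)
    (X : R -> R -> 'cV[R]_4) : Prop :=
  exists B : 'M[R]_4, skew_adjoint B /\ \rank B = 2%N /\
    (B *m B *m B)%mc = 0%mc /\ (B *m B)%mc <> 0%mc /\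
    forall s t, U s t -> vpd (@Ordinal 2 1 isT) X s t = (B *m X s t)%mc.

Definition box (delta a b : R) (s t : R) : Prop := Rabs s < delta /\ a < t < b.

Definition nonconstant_on (U : R -> Prop) (f : R -> R) : Prop :=
  ~ exists c, forall s, U s -> f s = c.

(** * Initial data *)

Definition k10 (L th0 a0 : R) : R := a0 + sin th0 / L.
Definition H0 (L th0 a0 : R) : R := a0 / 2 + sin th0 / L.
Definition H0' (L th0 a0 b0 : R) : R := b0 / 2 + a0 * cos th0 / L.

Definition admissible (L : R) (d : R * R * R) : Prop :=
  let '(th0, a0, b0) := d in
  k10 L th0 a0 <> 0 /\ H0 L th0 a0 <> 0 /\ H0' L th0 a0 b0 <> 0 /\
  H0 L th0 a0 <> - k10 L th0 a0.

(* Main.v *)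
Require Import Defs.
From Stdlib Require Import Reals Lra Lia.
From mathcomp Require Import all_boot all_algebra Rstruct.
From Coquelicot Require Import Coquelicot.
Set Implicit Arguments.
Unset Strict Implicit.
Unset Printing Implicit Defensive.
Delimit Scope ring_scope with mc.
Delimit Scope R_scope with R.
Open Scope ring_scope.
Open Scope R_scope.

(** Once the angle is known the surface is explicit. In the frame of an
    immersion determined by [theta], the vector
    [n = rho (cos theta X_s - sin theta xi - X / L)] is null, the
    Gauss-Weingarten equations make it constant, and [X_tt = (rho / L) n]. So
    [X] is quadratic in [t]: in a basis [e0, n, m, f] of R^{2,2} whose only
    nonzero products are [<e0, e0> = -1], [<n, m> = 1] and [<f, f> = 1], it is
    [X = rho t e0 + nu n + L rho m + rho x f], where [x' = sin theta / rho] and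
    [nu] is fixed by [<X, X> = - L ^ 2]. The profile [t = 0] is a curve in a
    hyperbolic plane in horocyclic coordinates, and [t] moves it by the
    parabolic group generated by [m |-> e0 / L], [e0 |-> n / L], [n, f |-> 0]
    ([surf_frame], [surf_determined], [surf_parabolic]). Conversely the metric
    and the shape operator determine the Gauss-Weingarten equations of any
    such immersion ([determined_frame]), a linear system with skew matrices,
    so two of them differ by a linear isometry ([frames_congruent]).

    A conformal change [lambda ^ -2] of the metric of a surface multiplies the
    tension field by [lambda ^ 2], which gives [2 lambda ^ 2 H xi = 2 u xi]
    ([frame_tension]), and multiplies the rough Laplacian by the same factor.
    Since AdS_3(L) has constant curvature ([curvN_eq]), the bitension field
    vanishes if and only if [u'' + q u' - (k1 ^ 2 + k2 ^ 2 + 2 / L ^ 2) u = 0]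
    along the normal and [k1 u' + H' u = 0] along the profile
    ([bitension_zero] is the direction used). The second equation says that
    [u' / u = w], and then the first one is the equation for [theta].

    That equation is of third order with denominator [k1]. With
    [sin theta], [cos theta], [k1] and [w] as unknowns it becomes a first-order
    system with quadratic right-hand sides, and [rho], [1 / rho], [x] and
    [1 / u] extend it to a larger system of the same kind. For quadratic systems
    the Taylor coefficients of a solution grow at most geometrically
    ([quad_solution]), Picard's estimate gives uniqueness ([quad_unique]), and
    restarting the solution at other points gives analyticity on the whole
    interval ([quad_analytic]). All functions of the construction are therefore
    analytic at once ([profile_exists]).

    Finally [H'] is [H0'] at 0, so [H] is not constant; and if [lambda] were
    constant then [u' / u = H' / H], hence [- H' / k1 = H' / H], which at 0
    contradicts [H0 <> - k10]. *)

(** * Quadratic systems of ordinary differential equations *)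

(** The quadratic form with monomials [c * y_j * y_k], evaluated on an
    arbitrary table [f j k] so that it also applies to Cauchy products. *)
Fixpoint quad (l : seq (R * nat * nat)) (f : nat -> nat -> R) : R :=
  if l is (c, j, k) :: l' then c * f j k + quad l' f else 0.

Fixpoint qnorm (l : seq (R * nat * nat)) : R :=
  if l is (c, _, _) :: l' then Rabs c + qnorm l' else 0.

Definition qvars (P : pred nat) (l : seq (R * nat * nat)) : bool :=
  all (fun m => P m.1.2 && P m.2) l.

Lemma qnorm_ge0 l : 0 <= qnorm l.
Proof.
elim: l => [|[[c j] k] l IH] /=; first lra.
have := Rabs_pos c; lra.
Qed.

Lemma quad_bound (P : pred nat) l f B :
  qvars P l -> (forall j k, P j -> P k -> Rabs (f j k) <= B) ->
  Rabs (quad l f) <= qnorm l * B.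
Proof.
move=> + Hf; elim: l => [|[[c j] k] l IH] /=; first by rewrite Rabs_R0; lra.
case/andP=> /= /andP [Pj Pk] Pl.
apply: Rle_trans (Rabs_triang _ _) _; rewrite Rabs_mult.
have := Rmult_le_compat_l _ _ _ (Rabs_pos c) (Hf _ _ Pj Pk).
have := IH Pl; lra.
Qed.

Lemma quad_minus l f g :
  quad l f - quad l g = quad l (fun j k => f j k - g j k).
Proof. by elim: l => [|[[c j] k] l IH] /=; [lra | rewrite -IH; ring]. Qed.

Lemma quad_ext l f g : (forall j k, f j k = g j k) -> quad l f = quad l g.
Proof. by move=> E; elim: l => [|[[c j] k] l IH] //=; rewrite E IH. Qed.

(** The Taylor coefficients are found by recursion on the order. [taylor_upto
    n m i] is the coefficient of order [m] of the [i]-th unknown, correct for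
    [m <= n]. *)
Fixpoint taylor_upto (q : nat -> seq (R * nat * nat)) (y0 : nat -> R)
    (n m i : nat) : R :=
  if n is n'.+1 then
    if (m <= n')%N then taylor_upto q y0 n' m i
    else quad (q i) (fun j k =>
           sum_f_R0 (fun p => taylor_upto q y0 n' p j *
                              taylor_upto q y0 n' (n' - p) k) n') / INR n
  else y0 i.

Definition taylor q y0 i n := taylor_upto q y0 n n i.

Lemma taylor_upto_stable q y0 n m i :
  (m <= n)%N -> taylor_upto q y0 n m i = taylor q y0 i m.
Proof.
elim: n => [|n IH]; first by rewrite leqn0 => /eqP ->.
rewrite leq_eqVlt => /orP [/eqP -> //|].
rewrite ltnS => Hm /=; rewrite Hm; exact: IH.
Qed.

Lemma taylorS q y0 i n :
  INR n.+1 * taylor q y0 i n.+1 =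
  quad (q i) (fun j k => PS_mult (taylor q y0 j) (taylor q y0 k) n).
Proof.
rewrite {1}/taylor [taylor_upto _ _ _ _ _]/= ltnn -/(INR n.+1).
have Hn : INR n.+1 <> 0 by apply: not_0_INR.
set A := quad _ _; set B := quad _ _.
suff -> : A = B by field.
apply: quad_ext => j k; rewrite /PS_mult; apply: PartSum.sum_eq => p /leP Hp.
by rewrite !taylor_upto_stable ?leq_subr.
Qed.

(** The factor [n + 1] gained by integrating pays for the [n + 1] terms of the
    Cauchy product, so that a geometric bound propagates. *)
Lemma taylor_bound q y0 Cq M :
  0 < Cq -> 0 < M -> (forall i, qnorm (q i) <= Cq) ->
  (forall i, Rabs (y0 i) <= M) ->
  forall n i, Rabs (taylor q y0 i n) <= M * (Cq * M) ^ n.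
Proof.
move=> HC HM Hq Hy n.
have HK : 0 < Cq * M by nra.
elim/ltn_ind: n => n IH i.
case: n IH => [|n] IH; first by rewrite /= Rmult_1_r; exact: Hy.
have Hn : 0 < INR n.+1 by apply: lt_0_INR; apply/ltP.
apply: (Rmult_le_reg_l (INR n.+1)) => //.
rewrite -{1}(Rabs_pos_eq (INR n.+1)); last lra.
rewrite -Rabs_mult taylorS.
set K := Cq * M in HK IH *.
apply: Rle_trans (_ : qnorm (q i) * (INR n.+1 * (M * M * K ^ n)) <= _).
  apply: (quad_bound (P := xpredT)); first by apply/allP.
  move=> j k _ _; rewrite /PS_mult.
  apply: Rle_trans (sum_f_R0_triangle _ _) _.
  rewrite Rmult_comm -sum_cte.
  apply: sum_Rle => p /leP Hp; rewrite Rabs_mult.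
  have -> : K ^ n = K ^ p * K ^ (n - p).
    by rewrite -pow_add; congr (_ ^ _); rewrite plusE subnKC.
  have H1 : Rabs (taylor q y0 j p) <= M * K ^ p by apply: IH; rewrite ltnS.
  have H2 : Rabs (taylor q y0 k (n - p)) <= M * K ^ (n - p).
    by apply: IH; rewrite ltnS leq_subr.
  apply: Rle_trans (Rmult_le_compat _ _ _ _ (Rabs_pos _) (Rabs_pos _) H1 H2) _.
  lra.
have HKn : 0 < K ^ n by apply: pow_lt.
rewrite [K ^ n.+1]/= -/(K ^ n).
have -> : INR n.+1 * (M * (K * K ^ n)) = Cq * (INR n.+1 * (M * M * K ^ n)).
  by rewrite /K; ring.
apply: Rmult_le_compat_r => //.
apply: Rmult_le_pos; first lra.
apply: Rmult_le_pos; [nra | lra].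
Qed.

Lemma is_series_zeros (a : nat -> R) : (forall n, a n = 0) -> is_series a 0.
Proof.
move=> Ha; apply: (is_lim_seq_ext (fun _ => 0) _ 0); last exact: is_lim_seq_const.
move=> n; rewrite (sum_n_ext _ (fun _ => 0)) ?sum_n_const ?Rmult_0_r //.
Qed.

Lemma is_pseries_quad l (a : nat -> nat -> R) (x : R) :
  (forall i, Rbar_lt (Rabs x) (CV_radius (a i))) ->
  is_pseries (K := R_AbsRing) (fun n => quad l (fun j k => PS_mult (a j) (a k) n)) x
    (quad l (fun j k => PSeries (a j) x * PSeries (a k) x)).
Proof.
move=> Ha; elim: l => [|[[c j] k] l IH] /=.
  by apply: is_series_zeros => n; rewrite /scal /= /mult /= Rmult_0_r.
apply: (is_pseries_plus _ _ x _ _ _ IH).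
apply: (is_pseries_scal c _ x).
  by rewrite /mult /= Rmult_comm.
apply: is_pseries_mult; try exact: Ha.
  by apply/PSeries_correct/CV_radius_inside/Ha.
by apply/PSeries_correct/CV_radius_inside/Ha.
Qed.

Lemma taylor_radius q y0 Cq M :
  0 < Cq -> 0 < M -> (forall i, qnorm (q i) <= Cq) ->
  (forall i, Rabs (y0 i) <= M) ->
  forall i s, Rabs s < / (2 * Cq * M) ->
    Rbar_lt (Rabs s) (CV_radius (taylor q y0 i)) /\
    Rabs (PSeries (taylor q y0 i) s) <= 2 * M.
Proof.
move=> HC HM Hq Hy i s Hs.
have HK : 0 < Cq * M by nra.
have Hb := taylor_bound HC HM Hq Hy.
set K := Cq * M in HK Hb.
have HsK : K * Rabs s < / 2.
  have -> : / 2 = K * / (2 * Cq * M) by rewrite /K; field; lra.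
  exact: Rmult_lt_compat_l.
have Hr : Rbar_lt (Rabs s) (CV_radius (taylor q y0 i)).
  apply: (Rbar_lt_le_trans _ (/ K)).
    change (Rabs s < / K); apply: (Rmult_lt_reg_l K) => //; rewrite Rinv_r; lra.
  apply: (proj1 (CV_radius_bounded _)); exists M => n.
  rewrite Rabs_mult (Rabs_pos_eq ((/ K) ^ n)); last first.
    by apply: pow_le; apply/Rlt_le/Rinv_0_lt_compat.
  apply: Rle_trans (Rmult_le_compat_r _ _ _ _ (Hb n i)) _.
    by apply: pow_le; apply/Rlt_le/Rinv_0_lt_compat.
  rewrite Rmult_assoc -Rpow_mult_distr Rinv_r; last lra.
  rewrite pow1; lra.
split=> //.
have Hg : Rabs (K * Rabs s) < 1.
  rewrite Rabs_pos_eq; [lra | apply: Rmult_le_pos (Rlt_le _ _ HK) (Rabs_pos _)].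
have Hle n : 0 <= Rabs (taylor q y0 i n * s ^ n) <= M * (K * Rabs s) ^ n.
  split; first exact: Rabs_pos.
  rewrite Rabs_mult -RPow_abs Rpow_mult_distr -Rmult_assoc.
  by apply: Rmult_le_compat_r (Hb n i); apply/pow_le/Rabs_pos.
have Hex : ex_series (fun n => M * (K * Rabs s) ^ n).
  by apply: (ex_series_scal (V := R_NormedModule) M); apply: ex_series_geom.
rewrite /PSeries.
apply: Rle_trans (Series_Rabs _ _) _.
  apply: ex_series_le Hex => n.
  by rewrite /norm /= /abs /= Rabs_Rabsolu; case: (Hle n).
apply: Rle_trans (Series_le _ _ Hle Hex) _.
rewrite Series_scal_l Series_geom // Rmult_comm.
apply: Rmult_le_compat_r; first lra.
rewrite -[X in _ <= X]Rinv_inv; apply: Rinv_le_contravar; lra.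
Qed.

(** Short-time solutions. The radius depends only on bounds for the
    coefficients and for the initial values, which makes it possible to
    re-expand a solution at any point of its interval. *)
Lemma quad_solution q y0 Cq M :
  0 < Cq -> 0 < M -> (forall i, qnorm (q i) <= Cq) ->
  (forall i, Rabs (y0 i) <= M) ->
  exists a : nat -> nat -> R, forall i,
    PSeries (a i) 0 = y0 i /\
    forall s, Rabs s < / (2 * Cq * M) ->
      is_pseries (K := R_AbsRing) (a i) s (PSeries (a i) s) /\
      Rabs (PSeries (a i) s) <= 2 * M /\
      is_derive (PSeries (a i)) s
        (quad (q i) (fun j k => PSeries (a j) s * PSeries (a k) s)).
Proof.
move=> HC HM Hq Hy; exists (taylor q y0) => i.
have Hr := taylor_radius HC HM Hq Hy.
split; first exact: PSeries_0.
move=> s Hs; split.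
  by apply/PSeries_correct/CV_radius_inside; case: (Hr i s Hs).
split; first by case: (Hr i s Hs).
have <- : PSeries (PS_derive (taylor q y0 i)) s =
    quad (q i) (fun j k => PSeries (taylor q y0 j) s * PSeries (taylor q y0 k) s).
  apply: is_pseries_unique.
  apply: (is_pseries_ext (fun n => quad (q i) (fun j k =>
            PS_mult (taylor q y0 j) (taylor q y0 k) n))).
    by move=> n; rewrite /PS_derive taylorS.
  by apply: is_pseries_quad => j; case: (Hr j s Hs).
by apply: is_derive_PSeries; case: (Hr i s Hs).
Qed.

(** One integration in Picard's iteration. *)
Lemma derive_pow_bound (f f' : R -> R) r c n :
  f 0 = 0 -> (forall s, Rabs s < r -> is_derive f s (f' s)) ->
  (forall s, Rabs s < r -> Rabs (f' s) <= c * Rabs s ^ n) ->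
  forall s, Rabs s < r -> Rabs (f s) <= c * Rabs s ^ n.+1 / INR n.+1.
Proof.
move=> f0 Hf Hb.
have Hn : 0 < INR n.+1 by apply: lt_0_INR; apply/ltP.
have Hg x : is_derive (fun z => c * z ^ n.+1 / INR n.+1) x (c * x ^ n).
  auto_derive => //; rewrite /=.
  have -> : match n with O => 1 | S _ => INR n + 1 end = INR n.+1 by [].
  by field; lra.
(* It suffices to bound [f] from above to the right of 0. *)
suff Hpos (g g' : R -> R) : g 0 = 0 ->
    (forall s, Rabs s < r -> is_derive g s (g' s)) ->
    (forall s, Rabs s < r -> g' s <= c * Rabs s ^ n) ->
    forall s, 0 <= s < r -> g s <= c * s ^ n.+1 / INR n.+1.
  have both (g g' : R -> R) : g 0 = 0 ->
    (forall s, Rabs s < r -> is_derive g s (g' s)) ->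
    (forall s, Rabs s < r -> Rabs (g' s) <= c * Rabs s ^ n) ->
    forall s, 0 <= s < r -> Rabs (g s) <= c * s ^ n.+1 / INR n.+1.
    move=> g0 dg bg s Hs; apply: Rabs_le; split; last first.
      apply: (Hpos g g') => // x /bg; have := Rle_abs (g' x); lra.
    suff : - g s <= c * s ^ n.+1 / INR n.+1 by lra.
    apply: (Hpos (fun x => - g x) (fun x => - g' x)) => //.
    - by rewrite g0 Ropp_0.
    - by move=> x /dg H; apply: is_derive_opp.
    - by move=> x /bg; have := Rle_abs (- g' x); rewrite Rabs_Ropp; lra.
  move=> s Hs; case: (Rle_lt_dec 0 s) => H0.
    rewrite (Rabs_pos_eq s) // in Hs *; exact: (both f f').
  rewrite (Rabs_left s) // in Hs *.
  rewrite -{1}(Ropp_involutive s).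
  apply: (both (fun x => f (- x)) (fun x => - f' (- x))); last lra.
  - by rewrite Ropp_0.
  - move=> x Hx.
    have H : is_derive f (- x) (f' (- x)) by apply: Hf; rewrite Rabs_Ropp.
    have := is_derive_comp f Ropp x _ _ H (is_derive_opp _ _ _ (is_derive_id x)).
    by rewrite /scal /= /mult /= /opp /= /one /= => H'; move: H'; rewrite Ropp_mult_distr_l_reverse Rmult_1_l.
  - by move=> x Hx; rewrite Rabs_Ropp -(Rabs_Ropp x); apply: Hb; rewrite Rabs_Ropp.
move=> g0 dg bg s Hs.
case: (Req_dec s 0) => [->|Hs0]; first by rewrite g0 /= Rmult_0_l Rmult_0_r; lra.
have Hs1 : 0 < s by lra.
have D x : 0 <= x -> x <= s ->
    derivable_pt_lim (fun z => c * z ^ n.+1 / INR n.+1 - g z) x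
      (c * x ^ n - g' x).
  move=> Hx1 Hx2; apply/is_derive_Reals; apply: is_derive_minus (Hg x) _.
  by apply: dg; rewrite Rabs_pos_eq; lra.
have [x [Hx [Hx2 ]]] := MVT_cor3 _ _ _ _ Hs1 D.
have Hgx : g' x <= c * x ^ n.
  by rewrite -{2}(Rabs_pos_eq x) //; apply: bg; rewrite Rabs_pos_eq; lra.
rewrite g0 [0 ^ _]/= Rmult_0_l Rmult_0_r => E.
have : 0 <= (c * x ^ n - g' x) * (s - 0) by apply: Rmult_le_pos; lra.
lra.
Qed.

(** Picard's estimate [Rabs (y - z) <= C * (K * Rabs s) ^ n / n`!] for every
    [n]; it is global on the interval, so no continuation is needed. The set
    [P] of indices lets the uniqueness be applied to an autonomous subsystem. *)
Lemma quad_unique (P : pred nat) q Cq M r (y z : nat -> R -> R) :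
  0 < Cq -> 0 < M -> (forall i, P i -> qnorm (q i) <= Cq) ->
  (forall i, P i -> qvars P (q i)) ->
  (forall i s, P i -> Rabs s < r -> Rabs (y i s) <= M /\ Rabs (z i s) <= M) ->
  (forall i s, P i -> Rabs s < r ->
     is_derive (y i) s (quad (q i) (fun j k => y j s * y k s)) /\
     is_derive (z i) s (quad (q i) (fun j k => z j s * z k s))) ->
  (forall i, P i -> y i 0 = z i 0) ->
  forall i s, P i -> Rabs s < r -> y i s = z i s.
Proof.
move=> HC HM Hq Hv Hb Hd H0.
pose K := 2 * M * Cq.
have HK : 0 < K by rewrite /K; apply: Rmult_lt_0_compat => //; lra.
have Hn n : forall i s, P i -> Rabs s < r ->
    Rabs (y i s - z i s) <= 2 * M * (K ^ n / INR (Factorial.fact n)) * Rabs s ^ n.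
  elim: n => [|n IH] i s Pi Hs.
    have [H1 H2] := Hb i s Pi Hs.
    rewrite /=; apply: Rle_trans (Rabs_triang _ _) _; rewrite Rabs_Ropp; lra.
  have Hfn := INR_fact_neq_0 n.
  have Hn1 : INR n.+1 <> 0 by apply: not_0_INR.
  have -> : 2 * M * (K ^ n.+1 / INR (Factorial.fact n.+1)) * Rabs s ^ n.+1 =
      (2 * M * K * (K ^ n / INR (Factorial.fact n))) * Rabs s ^ n.+1 / INR n.+1.
    by rewrite fact_simpl mult_INR -!tech_pow_Rmult; field.
  apply: (derive_pow_bound (f := fun x => y i x - z i x)
    (f' := fun x => quad (q i) (fun j k => y j x * y k x) -
                    quad (q i) (fun j k => z j x * z k x))) Hs => /=.
  - by rewrite H0 //; lra.
  - move=> x Hx; have [d1 d2] := Hd i x Pi Hx; exact: is_derive_minus.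
  - move=> x Hx; rewrite quad_minus.
    pose B := 2 * M * (K ^ n / INR (Factorial.fact n)) * Rabs x ^ n.
    have HB : 0 <= B by apply: Rle_trans (IH i x Pi Hx); apply: Rabs_pos.
    apply: Rle_trans (quad_bound (B := M * B + M * B) (Hv i Pi) _) _.
      move=> j k Pj Pk.
      have -> : y j x * y k x - z j x * z k x =
          y j x * (y k x - z k x) + z k x * (y j x - z j x) by ring.
      apply: Rle_trans (Rabs_triang _ _) _; rewrite !Rabs_mult.
      have [b1 _] := Hb j x Pj Hx; have [_ b2] := Hb k x Pk Hx.
      by apply: Rplus_le_compat; apply: Rmult_le_compat => //;
        try exact: Rabs_pos; apply: IH.
    have -> : 2 * M * K * (K ^ n / INR (Factorial.fact n)) * Rabs x ^ n = Cq * (M * B + M * B).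
      by rewrite /B /K; ring.
    apply: Rmult_le_compat_r; [nra | exact: Hq].
move=> i s Pi Hs.
have Hlim : is_lim_seq (fun n => 2 * M * ((K * Rabs s) ^ n / INR (Factorial.fact n))) 0.
  have -> : Finite 0 = Rbar_mult (2 * M) 0 by rewrite /= Rmult_0_r.
  apply: is_lim_seq_scal_l; apply/is_lim_seq_Reals.
  exact: cv_speed_pow_fact.
have : Rbar_le (Rabs (y i s - z i s)) 0.
  apply: (is_lim_seq_le _ _ _ _ _ (is_lim_seq_const _) Hlim) => n.
  apply: Rle_trans (Hn n i s Pi Hs) _; rewrite Rpow_mult_distr; apply: Req_le.
  by rewrite /Rdiv; ring.
rewrite /= => H; suff: y i s - z i s = 0 by lra.
by apply/Rabs_eq_0/Rle_antisym => //; apply: Rabs_pos.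
Qed.

(** The solution of the system restarted at an interior point is a power
    series centred there, and agrees with the given solution by uniqueness. *)
Lemma quad_analytic q Cq M r (y : nat -> R -> R) :
  0 < Cq -> 0 < M -> (forall i, qnorm (q i) <= Cq) ->
  (forall i s, Rabs s < r -> Rabs (y i s) <= M) ->
  (forall i s, Rabs s < r ->
     is_derive (y i) s (quad (q i) (fun j k => y j s * y k s))) ->
  forall i, analytic_on (fun s => Rabs s < r) (y i).
Proof.
move=> HC HM Hq Hb Hd i x0 Hx0.
have [a Ha] := quad_solution HC HM Hq (fun j => Hb j x0 Hx0).
have HR : 0 < / (2 * Cq * M) by apply: Rinv_0_lt_compat; nra.
exists (a i), (Rmin (/ (2 * Cq * M)) (r - Rabs x0)); split.
  by apply: Rmin_glb_lt => //; lra.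
have shift x : Rabs x < r - Rabs x0 -> Rabs (x0 + x) < r.
  by move=> Hx; apply: Rle_lt_trans (Rabs_triang _ _) _; lra.
move=> x Hx.
have Hx1 := Rlt_le_trans _ _ _ Hx (Rmin_l _ _).
have E : y i (x0 + (x - x0)) = PSeries (a i) (x - x0).
  apply: (@quad_unique xpredT q Cq (2 * M) _ (fun j s => y j (x0 + s))
    (fun j => PSeries (a j))) Hx => //; first lra.
  - by move=> j _; apply/allP.
  - move=> j s _ Hs; split.
      have := Hb j (x0 + s) (shift s (Rlt_le_trans _ _ _ Hs (Rmin_r _ _))); lra.
    by have [_ /(_ s (Rlt_le_trans _ _ _ Hs (Rmin_l _ _))) [_ []]] := Ha j.
  - move=> j s _ Hs; split; last first.
      by have [_ /(_ s (Rlt_le_trans _ _ _ Hs (Rmin_l _ _))) [_ []]] := Ha j.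
    have H := Hd j _ (shift s (Rlt_le_trans _ _ _ Hs (Rmin_r _ _))).
    have H' : is_derive (fun s => x0 + s) s 1 by auto_derive.
    have := is_derive_comp (y j) (fun s => x0 + s) s _ _ H H'.
    by rewrite /scal /= /mult /= Rmult_1_l.
  - by move=> j _; rewrite Rplus_0_r; case: (Ha j) => ->.
have -> : y i x = PSeries (a i) (x - x0) by rewrite -E; congr (y i _); ring.
by have [_ /(_ _ Hx1) []] := Ha i.
Qed.

(** * Analytic functions of one and two variables *)

(** Convergence slightly farther out puts [h] strictly inside the disc, where
    Cauchy products and termwise differentiation are available. *)
Lemma expansion_radius (a : nat -> R) (f : R -> R) x0 r :
  (forall x, Rabs (x - x0) < r -> is_pseries (K := R_AbsRing) a (x - x0) (f x)) ->
  forall h, Rabs h < r -> Rbar_lt (Rabs h) (CV_radius a).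
Proof.
move=> Ha h Hh.
pose h' := (Rabs h + r) / 2.
have Hh' : Rabs h < h' < r by rewrite /h'; lra.
have Hp : 0 <= h' by have := Rabs_pos h; lra.
apply: (Rbar_lt_le_trans _ h'); first by case: Hh'.
have Hs : is_pseries (K := R_AbsRing) a h' (f (x0 + h')).
  have {1}-> : h' = x0 + h' - x0 by ring.
  by apply: Ha; rewrite (_ : x0 + h' - x0 = h') ?Rabs_pos_eq; [lra | | ring].
have Hl : is_lim_seq (fun n => a n * h' ^ n) 0.
  by apply: ex_series_lim_0; exists (f (x0 + h')); exact/is_pseries_R.
apply: (proj1 (CV_radius_bounded _)).
have [M HM] := @filterlim_bounded _ R_NormedModule _ (ex_intro _ 0 Hl).
by exists M.
Qed.

Lemma ball_sub (x x0 r y : R) :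
  Rabs (x - x0) < r -> Rabs (y - x) < r - Rabs (x - x0) -> Rabs (y - x0) < r.
Proof.
move=> Hx Hy; have -> : y - x0 = (y - x) + (x - x0) by ring.
by apply: Rle_lt_trans (Rabs_triang _ _) _; lra.
Qed.

Lemma locally_Rabs (P : R -> Prop) x r :
  0 < r -> (forall y, Rabs (y - x) < r -> P y) -> locally x P.
Proof. by move=> Hr HP; exists (mkposreal r Hr) => y Hy; apply: HP. Qed.

Lemma analytic_ext U f g : (forall x, f x = g x) -> analytic_on U f -> analytic_on U g.
Proof.
move=> E Hf x0 Ux0; have [a [r [Hr H]]] := Hf x0 Ux0.
by exists a, r; split=> // x Hx; rewrite -E; apply: H.
Qed.

Lemma analytic_sub (U V : R -> Prop) f :
  (forall x, V x -> U x) -> analytic_on U f -> analytic_on V f.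
Proof. by move=> VU Hf x0 /VU; apply: Hf. Qed.

Lemma analytic_const U c : analytic_on U (fun _ => c).
Proof.
move=> x0 _; exists (fun n => if n is O then c else 0), 1; split; first lra.
move=> x _; apply/is_pseries_R.
have -> : c = c + 0 by lra.
apply: (is_series_decr_1 (V := R_NormedModule)).
rewrite /plus /opp /= Rmult_1_r Rplus_0_r Rplus_opp_r.
by apply: is_series_zeros => n; rewrite Rmult_0_l.
Qed.

Lemma analytic_id U : analytic_on U (fun x => x).
Proof.
move=> x0 _; exists (fun n => match n with O => x0 | 1%nat => 1 | _ => 0 end), 1.
split; first lra.
move=> x _; apply/is_pseries_R.
have {2}-> : x = x0 + ((x - x0) + 0) by lra.
apply: (is_series_decr_1 (V := R_NormedModule)).
apply: (is_series_decr_1 (V := R_NormedModule)).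
rewrite /plus /opp /= !Rmult_1_r Rmult_1_l.
have -> : x0 + (x - x0 + 0) + - x0 + - (x - x0) = 0 by ring.
by apply: is_series_zeros => n; rewrite Rmult_0_l.
Qed.

Lemma analytic_plus U f g :
  analytic_on U f -> analytic_on U g -> analytic_on U (fun x => f x + g x).
Proof.
move=> Hf Hg x0 Ux0.
have [a [r [Hr Ha]]] := Hf x0 Ux0; have [b [r' [Hr' Hb]]] := Hg x0 Ux0.
exists (PS_plus a b), (Rmin r r'); split; first exact: Rmin_glb_lt.
move=> x Hx; apply: is_pseries_plus.
  by apply: Ha; apply: Rlt_le_trans Hx (Rmin_l _ _).
by apply: Hb; apply: Rlt_le_trans Hx (Rmin_r _ _).
Qed.

Lemma analytic_mult U f g :
  analytic_on U f -> analytic_on U g -> analytic_on U (fun x => f x * g x).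
Proof.
move=> Hf Hg x0 Ux0.
have [a [r [Hr Ha]]] := Hf x0 Ux0; have [b [r' [Hr' Hb]]] := Hg x0 Ux0.
exists (PS_mult a b), (Rmin r r'); split; first exact: Rmin_glb_lt.
move=> x Hx.
have Hx1 := Rlt_le_trans _ _ _ Hx (Rmin_l _ _).
have Hx2 := Rlt_le_trans _ _ _ Hx (Rmin_r _ _).
apply: is_pseries_mult; try exact: Ha; try exact: Hb.
  exact: expansion_radius Ha _ Hx1.
exact: expansion_radius Hb _ Hx2.
Qed.

Lemma is_derive_ext_val (f : R -> R) (x l l' : R) :
  l = l' -> is_derive f x l -> is_derive f x l'.
Proof. by move=> ->. Qed.

Lemma is_derive_shift (f : R -> R) x x0 l :
  is_derive f (x - x0) l -> is_derive (fun z => f (z - x0)) x l.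
Proof.
move=> Hf; have H1 : is_derive (fun z => z - x0) x 1 by auto_derive.
have := is_derive_comp f (fun z => z - x0) x _ _ Hf H1.
by rewrite /scal /= /mult /= Rmult_1_l.
Qed.

Lemma analytic_derive U f :
  analytic_on U f ->
  (forall x, U x -> ex_derive f x) /\ analytic_on U (Derive f).
Proof.
move=> Hf.
have local x0 : U x0 -> exists a r, 0 < r /\ forall x, Rabs (x - x0) < r ->
    Rbar_lt (Rabs (x - x0)) (CV_radius a) /\
    is_derive f x (PSeries (PS_derive a) (x - x0)).
  move=> Ux0; have [a [r [Hr Ha]]] := Hf x0 Ux0.
  exists a, r; split=> // x Hx.
  have Hrad := expansion_radius Ha Hx; split=> //.
  apply: (is_derive_ext_loc (fun z => PSeries a (z - x0))).
    apply: (@locally_Rabs _ x (r - Rabs (x - x0))); first lra.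
    move=> y Hy; apply: is_pseries_unique; apply: Ha; exact: ball_sub Hx Hy.
  exact: is_derive_shift (is_derive_PSeries a _ Hrad).
split=> x0 Ux0; have [a [r [Hr Ha]]] := local x0 Ux0.
  exists (PSeries (PS_derive a) (x0 - x0)); apply: (proj2 (Ha x0 _)).
  by rewrite Rminus_diag Rabs_R0.
exists (PS_derive a), r; split=> // x Hx.
have [Hrad /is_derive_unique ->] := Ha x Hx.
apply/PSeries_correct/CV_radius_inside.
by rewrite CV_radius_derive.
Qed.

(** Sums of products [f s * g t]: this class is stable under both partial
    derivatives, and contains all the components met below. *)
Definition sepsum (l : seq ((R -> R) * (R -> R))) (s t : R) : R :=
  foldr (fun p acc => p.1 s * p.2 t + acc) 0 l.

Fixpoint sep_analytic (U V : R -> Prop) (l : seq ((R -> R) * (R -> R))) : Prop :=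
  if l is p :: l' then
    analytic_on U p.1 /\ analytic_on V p.2 /\ sep_analytic U V l'
  else True.

Lemma analytic2_ext U f g :
  (forall s t, f s t = g s t) -> analytic2_on U f -> analytic2_on U g.
Proof.
move=> E Hf s0 t0 U0; have [a [r [Hr H]]] := Hf s0 t0 U0.
by exists a, r; split=> // s t Hs Ht; rewrite -E; apply: H.
Qed.

Lemma analytic2_plus U f g :
  analytic2_on U f -> analytic2_on U g -> analytic2_on U (fun s t => f s t + g s t).
Proof.
move=> Hf Hg s0 t0 U0.
have [a [r [Hr Ha]]] := Hf s0 t0 U0; have [b [r' [Hr' Hb]]] := Hg s0 t0 U0.
exists (fun k l => a k l + b k l), (Rmin r r'); split; first exact: Rmin_glb_lt.
move=> s t Hs Ht.
have [A1 A2] := Ha s t (Rlt_le_trans _ _ _ Hs (Rmin_l _ _)) (Rlt_le_trans _ _ _ Ht (Rmin_l _ _)).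
have [B1 B2] := Hb s t (Rlt_le_trans _ _ _ Hs (Rmin_r _ _)) (Rlt_le_trans _ _ _ Ht (Rmin_r _ _)).
split.
  apply: (@ex_series_le _ R_CompleteNormedModule) (ex_series_plus _ _ A1 B1) => n.
  rewrite /norm /= /abs /= /plus /= -plus_sum Rabs_pos_eq; last first.
    by apply: cond_pos_sum => k; apply: Rabs_pos.
  apply: sum_Rle => k _; rewrite !Rmult_plus_distr_r; exact: Rabs_triang.
apply: is_series_ext (is_series_plus _ _ _ _ A2 B2) => n.
rewrite /plus /= -plus_sum; apply: PartSum.sum_eq => k _; ring.
Qed.

Lemma analytic2_prod U V f g :
  analytic_on U f -> analytic_on V g ->
  analytic2_on (fun s t => U s /\ V t) (fun s t => f s * g t).
Proof.
move=> Hf Hg s0 t0 [Us Vt].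
have [a [r [Hr Ha]]] := Hf s0 Us; have [b [r' [Hr' Hb]]] := Hg t0 Vt.
exists (fun k l => a k * b l), (Rmin r r'); split; first exact: Rmin_glb_lt.
move=> s t Hs Ht term.
have Hs1 := Rlt_le_trans _ _ _ Hs (Rmin_l _ _).
have Ht1 := Rlt_le_trans _ _ _ Ht (Rmin_r _ _).
have A := CV_disk_inside _ _ (expansion_radius Ha Hs1).
have B := CV_disk_inside _ _ (expansion_radius Hb Ht1).
have A' := proj1 (is_pseries_R _ _ _) (Ha s Hs1).
have B' := proj1 (is_pseries_R _ _ _) (Hb t Ht1).
split; last first.
  apply: is_series_ext (is_series_mult _ _ _ _ A' B' A B) => n.
  apply: PartSum.sum_eq => k _; rewrite /term -!minusE; ring.
have [la Hla] := A; have [lb Hlb] := B.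
exists (la * lb).
have AA : ex_series (fun n => Rabs (Rabs (a n * (s - s0) ^ n))).
  by apply: ex_series_ext A => n; rewrite Rabs_Rabsolu.
have BB : ex_series (fun n => Rabs (Rabs (b n * (t - t0) ^ n))).
  by apply: ex_series_ext B => n; rewrite Rabs_Rabsolu.
apply: is_series_ext (is_series_mult _ _ _ _ Hla Hlb AA BB) => n.
apply: PartSum.sum_eq => k _; rewrite /term -Rabs_mult -!minusE; congr (Rabs _); ring.
Qed.

Lemma sepsum_analytic2 U V l :
  sep_analytic U V l -> analytic2_on (fun s t => U s /\ V t) (sepsum l).
Proof.
elim: l => [_|p l IH /= [H1 [H2 H3]]].
  have H := @analytic2_prod U V _ _ (@analytic_const U 0) (@analytic_const V 0).
  by apply: analytic2_ext H => s t; rewrite Rmult_0_l.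
apply: (@analytic2_ext _ (fun s t => p.1 s * p.2 t + sepsum l s t)) => //.
by apply: analytic2_plus; [exact: analytic2_prod | exact: IH].
Qed.

Lemma ex_derive_continuity_pt (f : R -> R) x : ex_derive f x -> continuity_pt f x.
Proof. by move=> Hf; apply/continuity_pt_filterlim; apply: ex_derive_continuous. Qed.

Lemma sepsum_ex_derive U V l s t : sep_analytic U V l -> U s -> V t ->
  is_derive (fun x => sepsum l x t) s (sepsum [seq (Derive p.1, p.2) | p <- l] s t) /\
  is_derive (fun y => sepsum l s y) t (sepsum [seq (p.1, Derive p.2) | p <- l] s t).
Proof.
move=> + Us Vt; elim: l => [_|p l IH /= [/analytic_derive [H1 _] [/analytic_derive [H2 _] /IH [H3 H4]]]].
  by split; apply: is_derive_const.
split; apply: is_derive_plus => //.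
  have := is_derive_scal_l _ _ _ (p.2 t) (Derive_correct _ _ (H1 s Us)).
  by rewrite /scal /= /mult /=.
by apply: is_derive_scal; apply: Derive_correct; apply: H2.
Qed.

Lemma sep_analytic_derive U V l : sep_analytic U V l ->
  sep_analytic U V [seq (Derive p.1, p.2) | p <- l] /\
  sep_analytic U V [seq (p.1, Derive p.2) | p <- l].
Proof.
elim: l => [//|p l IH /= [H1 [H2 /IH [H3 H4]]]].
have [_ D1] := analytic_derive H1; have [_ D2] := analytic_derive H2.
by split.
Qed.

Lemma sepsum_smooth2 U V l :
  (forall s, U s -> locally s U) -> (forall t, V t -> locally t V) ->
  sep_analytic U V l -> smooth2_on (fun s t => U s /\ V t) (sepsum l).
Proof.
move=> HU HV Hl s t [Us Vt] n.
have [[e1 H1] [e2 H2]] := (HU s Us, HV t Vt).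
have Hloc (P : R -> R -> Prop) : (forall x y, U x -> V y -> P x y) -> locally_2d P s t.
  have He : 0 < Rmin e1 e2 by apply: Rmin_glb_lt; apply: cond_pos.
  move=> HP; exists (mkposreal _ He) => x y /= Hx Hy; apply: HP.
    by apply: H1; apply: Rlt_le_trans Hx (Rmin_l _ _).
  by apply: H2; apply: Rlt_le_trans Hy (Rmin_r _ _).
have cont l' : sep_analytic U V l' -> continuity_2d_pt (sepsum l') s t.
  elim: l' => [_|p l' IH /= [K1 [K2 K3]]]; first exact: continuity_2d_pt_const.
  have [D1 _] := analytic_derive K1; have [D2 _] := analytic_derive K2.
  apply: continuity_2d_pt_plus (IH K3).
  apply: continuity_2d_pt_mult.
    apply: (continuity_1d_2d_pt_comp p.1 (fun u _ => u)); last exact: continuity_2d_pt_id1.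
    exact: ex_derive_continuity_pt (D1 s Us).
  apply: (continuity_1d_2d_pt_comp p.2 (fun _ v => v)); last exact: continuity_2d_pt_id2.
  exact: ex_derive_continuity_pt (D2 t Vt).
elim: n l Hl => [|n IH] l Hl /=; split; try exact: cont; first by [].
have [D1 D2] := sepsum_ex_derive Hl Us Vt.
have [A1 A2] := sep_analytic_derive Hl.
split; first by exists (sepsum [seq (Derive p.1, p.2) | p <- l] s t).
split; first by exists (sepsum [seq (p.1, Derive p.2) | p <- l] s t).
split; [apply: ex_diff_n_ext_loc (IH _ A1) | apply: ex_diff_n_ext_loc (IH _ A2)];
  apply: Hloc => x y Ux Vy; symmetry; apply: is_derive_unique;
  by case: (sepsum_ex_derive Hl Ux Vy).
Qed.

(** * Second partial derivatives of an analytic function *)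

Lemma sum_f_R0_rev (g : nat -> R) n :
  sum_f_R0 g n = sum_f_R0 (fun k => g (n - k)%N) n.
Proof.
elim: n g => [|n IH] g; first by [].
rewrite [RHS]decomp_sum; last by apply/ltP.
rewrite /= subn0 IH Rplus_comm; congr (_ + _).
Qed.

Lemma sum_triangle (g : nat -> nat -> R) N :
  sum_f_R0 (fun n => sum_f_R0 (fun k => g k (n - k)%N) n) N =
  sum_f_R0 (fun l => sum_f_R0 (fun k => g k l) (N - l)) N.
Proof.
elim: N => [//|N IH]; rewrite [LHS]/= -/(sum_f_R0 _ N) IH.
rewrite [RHS]/= subnn /=.
have -> : sum_f_R0 (fun l => sum_f_R0 (fun k => g k l) (N.+1 - l)) N =
  sum_f_R0 (fun l => sum_f_R0 (fun k => g k l) (N - l)) N +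
  sum_f_R0 (fun l => g (N.+1 - l)%N l) N.
  rewrite -plus_sum; apply: PartSum.sum_eq => l /leP Hl.
  by rewrite subSn.
rewrite Rplus_assoc; congr (_ + _).
have := sum_f_R0_rev (fun k => g k (N.+1 - k)%N) N.+1.
rewrite /= !subnn subn0 => ->; congr (_ + _).
by apply: PartSum.sum_eq => l /leP Hl; rewrite subKn // ltnW.
Qed.

(** A double power series at a point, in the form of [analytic2_on] with the
    centre moved to the origin. *)
Definition double_series (a : nat -> nat -> R) (r : R) (F : R -> R -> R) : Prop :=
  0 < r /\ forall x y, Rabs x < r -> Rabs y < r ->
    ex_series (fun n => sum_f_R0 (fun k => Rabs (a k (n - k)%N * x ^ k * y ^ (n - k))) n) /\
    is_series (fun n => sum_f_R0 (fun k => a k (n - k)%N * x ^ k * y ^ (n - k)) n) (F x y).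

Lemma double_series_swap a r F :
  double_series a r F -> double_series (fun k l => a l k) r (fun x y => F y x).
Proof.
move=> [Hr H]; split=> // x y Hx Hy; have [H1 H2] := H y x Hy Hx; split.
  apply: ex_series_ext H1 => n; rewrite [RHS]sum_f_R0_rev.
  apply: PartSum.sum_eq => k /leP Hk; rewrite subKn //; congr Rabs; ring.
apply: is_series_ext H2 => n; rewrite [RHS]sum_f_R0_rev.
by apply: PartSum.sum_eq => k /leP Hk; rewrite subKn //; ring.
Qed.

Lemma single_le_sum (g : nat -> R) n k :
  (forall j, 0 <= g j) -> (k <= n)%N -> g k <= sum_f_R0 g n.
Proof.
move=> Hg; elim: n => [|n IH]; first by rewrite leqn0 => /eqP ->; apply: Rle_refl.
rewrite leq_eqVlt => /orP [/eqP ->|].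
  rewrite /=; have := cond_pos_sum g n Hg; lra.
by rewrite ltnS => /IH /=; have := Hg n.+1; lra.
Qed.

Lemma double_series_bound a r F r' :
  double_series a r F -> 0 < r' < r ->
  exists M, 0 < M /\ forall k l, Rabs (a k l) * r' ^ k * r' ^ l <= M.
Proof.
move=> [Hr H] [H0 H1].
have Hr' : Rabs r' < r by rewrite Rabs_pos_eq; lra.
have [E _] := H r' r' Hr' Hr'.
have L := ex_series_lim_0 _ E.
have [M HM] := @filterlim_bounded _ R_NormedModule _ (ex_intro _ 0 L).
exists (Rabs M + 1); split; first by have := Rabs_pos M; lra.
move=> k l.
have := HM (k + l)%N; rewrite /norm /= /abs /= => {}HM.
have S := @single_le_sum (fun i => Rabs (a i (k + l - i)%N * r' ^ i * r' ^ (k + l - i)))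
  (k + l) k (fun j => Rabs_pos _) (leq_addr _ _).
have := Rle_abs (sum_f_R0 (fun i => Rabs (a i (k + l - i)%N * r' ^ i * r' ^ (k + l - i))) (k + l)).
move: S; rewrite addKn !Rabs_mult !(Rabs_pos_eq (r' ^ _)); try by apply: pow_le; lra.
have := Rle_abs M; lra.
Qed.

Lemma geometric_coef_radius (c : nat -> R) M r' x :
  0 < r' -> (forall k, Rabs (c k) * r' ^ k <= M) -> Rabs x < r' ->
  Rbar_lt (Rabs x) (CV_radius c).
Proof.
move=> Hr Hc Hx; apply: (Rbar_lt_le_trans _ r') => //.
apply: (proj1 (CV_radius_bounded _)); exists M => n.
by rewrite Rabs_mult (Rabs_pos_eq (r' ^ n)) //; apply: pow_le; lra.
Qed.

Lemma geometric_tail (c : nat -> R) M r' x q m :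
  0 < r' -> 0 < M -> (forall k, Rabs (c k) * r' ^ k <= M) ->
  Rabs x <= q * r' -> 0 <= q < 1 ->
  Rabs (PSeries c x - sum_f_R0 (fun k => c k * x ^ k) m) <= M * q ^ m.+1 / (1 - q).
Proof.
move=> Hr HM Hc Hx Hq.
have Hterm k : Rabs (c k * x ^ k) <= M * q ^ k.
  rewrite Rabs_mult -RPow_abs.
  apply: Rle_trans (_ : Rabs (c k) * (q * r') ^ k <= _).
    by apply: Rmult_le_compat_l (Rabs_pos _) _; apply: pow_incr; split => //; apply: Rabs_pos.
  rewrite Rpow_mult_distr.
  have -> : Rabs (c k) * (q ^ k * r' ^ k) = (Rabs (c k) * r' ^ k) * q ^ k by ring.
  by apply: Rmult_le_compat_r (Hc k); apply: pow_le; lra.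
have Hq1 : Rabs q < 1 by rewrite Rabs_pos_eq; lra.
have Hg : ex_series (fun k => M * q ^ k).
  by apply: (ex_series_scal (V := R_NormedModule) M); apply: ex_series_geom.
have Ha : ex_series (fun k => Rabs (c k * x ^ k)).
  apply: ex_series_le Hg => k.
  by rewrite /norm /= /abs /= Rabs_Rabsolu; exact: Hterm.
have Hc' := ex_series_Rabs _ Ha.
rewrite /PSeries (Series_incr_n _ m.+1) //=; last by apply/ltP.
rewrite Rplus_comm /Rminus Rplus_assoc Rplus_opp_r Rplus_0_r.
have Ha' : ex_series (fun k => Rabs (c (m.+1 + k)%coq_nat * x ^ (m.+1 + k)%coq_nat)).
  exact: (ex_series_incr_n (fun k => Rabs (c k * x ^ k)) m.+1 ).1 Ha.
apply: Rle_trans (Series_Rabs _ Ha') _.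
have Hg' : ex_series (fun k => M * q ^ m.+1 * q ^ k).
  by apply: (ex_series_scal (V := R_NormedModule) (M * q ^ m.+1)); apply: ex_series_geom.
apply: Rle_trans (Series_le _ _ _ Hg') _.
  move=> k; split; first exact: Rabs_pos.
  by apply: Rle_trans (Hterm _) _; rewrite pow_add /=; lra.
by rewrite Series_scal_l Series_geom //; apply: Rle_refl.
Qed.

(** Summation by columns: the terms of the partial column sums that are missing
    from the triangular sum of order [N] are [O(N q^N)]. *)
Lemma double_series_columns a r F :
  double_series a r F ->
  exists r' M, 0 < r' /\ 0 < M /\
    (forall k l, Rabs (a k l) * r' ^ k * r' ^ l <= M) /\
    forall x y, Rabs x < r' -> Rabs y < r' ->
      is_pseries (K := R_AbsRing) (fun l => PSeries (fun k => a k l) x) y (F x y).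
Proof.
move=> HF; have Hr : 0 < r by case: HF.
pose r' := r / 2.
have Hr' : 0 < r' < r by rewrite /r'; lra.
have [M [HM Ha]] := double_series_bound HF Hr'.
exists r', M; do 3 (split; first by case: Hr' => //).
move=> x y Hx Hy.
have [_ [_ HS]] := (I, proj2 HF x y (Rlt_trans _ _ _ Hx (proj2 Hr'))
                    (Rlt_trans _ _ _ Hy (proj2 Hr'))).
pose q := Rmax (Rabs x) (Rabs y) / r'.
have Hmax : Rmax (Rabs x) (Rabs y) < r' by apply: Rmax_lub_lt.
have Hinv : 0 < / r' by apply: Rinv_0_lt_compat; lra.
have Hq : 0 <= q < 1.
  split; first by apply: Rmult_le_pos; [apply: Rle_trans (Rabs_pos x) (Rmax_l _ _) | lra].
  apply: (Rmult_lt_reg_r r'); first lra.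
  by rewrite /q /Rdiv Rmult_assoc Rinv_l; lra.
have Hqr : q * r' = Rmax (Rabs x) (Rabs y) by rewrite /q; field; lra.
apply/is_pseries_R.
rewrite /is_series.
pose err N := sum_f_R0 (fun l => (PSeries (fun k => a k l) x -
    sum_f_R0 (fun k => a k l * x ^ k) (N - l)) * y ^ l) N.
apply: (is_lim_seq_ext (fun N => sum_n (fun n => sum_f_R0 (fun k =>
     a k (n - k)%N * x ^ k * y ^ (n - k)) n) N + err N) _ (F x y)).
  move=> N; rewrite !sum_n_Reals.
  rewrite (sum_triangle (fun k l => a k l * x ^ k * y ^ l)) /err -plus_sum.
  apply: PartSum.sum_eq => l _.
  have -> : sum_f_R0 (fun k => a k l * x ^ k * y ^ l) (N - l) =
            y ^ l * sum_f_R0 (fun k => a k l * x ^ k) (N - l).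
    by rewrite scal_sum.
  by ring.
have -> : F x y = F x y + 0 by lra.
apply: is_lim_seq_plus'; first exact: HS.
apply/is_lim_seq_abs_0.
have Hlim : is_lim_seq (fun N => (M / (1 - q) * q) * (INR N.+1 * 1 * q ^ N)) 0.
  have -> : Finite 0 = Rbar_mult (M / (1 - q) * q) 0 by rewrite /= Rmult_0_r.
  apply: is_lim_seq_scal_l; apply: ex_series_lim_0.
  have Hrad : Rbar_lt (Rabs q) (CV_radius (PS_derive (fun _ => 1))).
    rewrite CV_radius_derive.
    apply: (@geometric_coef_radius _ 1 1) => [|k|]; first lra.
      by rewrite pow1 Rabs_R1; lra.
    by rewrite Rabs_pos_eq; lra.
  have [l Hl] := CV_radius_inside _ _ Hrad.
  by exists l; exact: (proj1 (is_pseries_R _ _ _) Hl).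
apply: (is_lim_seq_le_le _ _ _ 0 _ (is_lim_seq_const 0) Hlim) => N.
split; first exact: Rabs_pos.
apply: Rle_trans (sum_f_R0_triangle _ _) _.
have -> : M / (1 - q) * q * (INR N.+1 * 1 * q ^ N) =
  sum_f_R0 (fun _ => M * q ^ N.+1 / (1 - q)) N.
  by rewrite sum_cte -tech_pow_Rmult /Rdiv; ring.
apply: sum_Rle => l /leP Hl; rewrite Rabs_mult.
have Hpl : 0 < r' ^ l by apply: pow_lt; lra.
have Hcol k : Rabs (a k l) * r' ^ k <= M / r' ^ l.
  apply: (Rmult_le_reg_r (r' ^ l)) => //.
  by rewrite /Rdiv (Rmult_assoc M) Rinv_l ?Rmult_1_r //; lra.
have HMl : 0 < M / r' ^ l by apply: Rdiv_lt_0_compat.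
have Hxq : Rabs x <= q * r' by rewrite Hqr; apply: Rmax_l.
have Hyq : Rabs (y ^ l) <= q ^ l * r' ^ l.
  rewrite -RPow_abs -Rpow_mult_distr Hqr; apply: pow_incr; split; first exact: Rabs_pos.
  exact: Rmax_r.
have T := geometric_tail (N - l) (proj1 Hr') HMl Hcol Hxq Hq.
apply: Rle_trans (Rmult_le_compat _ _ _ _ (Rabs_pos _) (Rabs_pos _) T Hyq) _.
have -> : q ^ N.+1 = q ^ (N - l).+1 * q ^ l.
  by rewrite -pow_add plusE addSn subnK.
by apply: Req_le; field; split; lra.
Qed.

(** Every point of a horizontal segment is treated at once: the derivative in the
    second variable at [(x, 0)] is the sum of column 1 at [x], hence may be
    differentiated again. *)
Lemma double_series_partials a r F :
  double_series a r F ->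
  exists r', 0 < r' /\
    (forall x, Rabs x < r' -> is_derive (F x) 0 (PSeries (fun k => a k 1%N) x)) /\
    is_derive (PSeries (fun k => a k 1%N)) 0 (a 1%N 1%N) /\
    ex_derive (fun y => Derive (F 0) y) 0.
Proof.
move=> /double_series_columns [r' [M [Hr' [HM [Ha HF]]]]].
exists r'; split=> //.
have exp0 x : Rabs x < r' -> analytic_on (fun y => y = 0) (F x).
  move=> Hx y ->; exists (fun l => PSeries (fun k => a k l) x), r'; split=> // z.
  by rewrite Rminus_0_r => Hz; apply: HF.
have H0 : Rabs 0 < r' by rewrite Rabs_R0.
have HF' x y : Rabs x < r' -> Rabs y < r' ->
  is_derive (F x) y (PSeries (PS_derive (fun l => PSeries (fun k => a k l) x)) y).
  move=> Hx Hy.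
  apply: (is_derive_ext_loc (PSeries (fun l => PSeries (fun k => a k l) x))).
    apply: (@locally_Rabs _ y (r' - Rabs y)); first lra.
    move=> z Hz; apply/is_pseries_unique/HF => //.
    by have := Rabs_triang (z - y) y; rewrite (_ : z - y + y = z); [lra | ring].
  apply: is_derive_PSeries.
  by apply: (@expansion_radius _ (F x) 0 r') => // z; rewrite Rminus_0_r; apply: HF.
split.
  move=> x Hx; have := HF' x 0 Hx H0.
  by rewrite PSeries_0 /PS_derive /= Rmult_1_l.
split.
  have Hrad : Rbar_lt (Rabs 0) (CV_radius (fun k => a k 1%N)).
    apply: (@geometric_coef_radius _ (M / r') r') => // k.
    apply: (Rmult_le_reg_r r') => //.
    rewrite /Rdiv (Rmult_assoc M) Rinv_l ?Rmult_1_r; last lra.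
    by have := Ha k 1%N; rewrite /= Rmult_1_r.
  have := is_derive_PSeries _ _ Hrad.
  by rewrite PSeries_0 /PS_derive /= Rmult_1_l.
have [_ /analytic_derive [H _]] := analytic_derive (exp0 0 H0).
exact: H.
Qed.

(** Symmetry of the second derivatives, at one point and without continuity:
    both mixed derivatives are the coefficient of [x * y]. *)
Lemma analytic2_partials U f s0 t0 :
  analytic2_on U f -> U s0 t0 ->
  ex_derive (fun x => f x t0) s0 /\ ex_derive (fun y => f s0 y) t0 /\
  ex_derive (fun x => Derive (fun x' => f x' t0) x) s0 /\
  ex_derive (fun y => Derive (fun y' => f s0 y') y) t0 /\
  exists m, is_derive (fun x => Derive (fun y => f x y) t0) s0 m /\
            is_derive (fun y => Derive (fun x => f x y) s0) t0 m.
Proof.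
move=> Hf U0; have [a [r [Hr Ha]]] := Hf s0 t0 U0.
pose F x y := f (s0 + x) (t0 + y).
have HF : double_series a r F.
  split=> // x y Hx Hy.
  have := Ha (s0 + x) (t0 + y).
  have -> : s0 + x - s0 = x by ring.
  have -> : t0 + y - t0 = y by ring.
  by move=> /(_ Hx Hy) [].
have key (g : R -> R -> R) (b : nat -> nat -> R) (x0 y0 : R) :
    double_series b r (fun x y => g (x0 + x) (y0 + y)) ->
    ex_derive (fun y => g x0 y) y0 /\
    ex_derive (fun y => Derive (fun y' => g x0 y') y) y0 /\
    is_derive (fun x => Derive (fun y => g x y) y0) x0 (b 1%N 1%N).
  move=> /double_series_partials [r' [Hr' [D1 [D2 D3]]]].
  have shift (h : R -> R) z0 l : is_derive (fun z => h (z0 + z)) 0 l -> is_derive h z0 l.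
    move=> Hh.
    apply: (is_derive_ext (fun z => h (z0 + (z - z0)))).
      by move=> z; congr h; ring.
    apply: (is_derive_shift (f := fun z => h (z0 + z))).
    by rewrite Rminus_diag.
  have D1' x : Rabs x < r' -> is_derive (g (x0 + x)) y0 (PSeries (fun k => b k 1%N) x).
    by move=> Hx; apply: shift; apply: D1.
  split; first by exists (PSeries (fun k => b k 1%N) 0); have := D1' 0; rewrite Rplus_0_r Rabs_R0; apply.
  split.
    have [l Hl] := D3; exists l; apply: shift; apply: is_derive_ext Hl => y.
    rewrite Rplus_0_r /Derive; congr real; apply: Lim_ext => z.
    by rewrite -Rplus_assoc.
  apply: shift; apply: is_derive_ext_loc D2.
  apply: (@locally_Rabs _ 0 r') => // x; rewrite Rminus_0_r => Hx.
  by symmetry; apply: is_derive_unique; apply: D1'.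
have [E1 [E2 E3]] := key f a s0 t0 HF.
have [E4 [E5 E6]] := key (fun y x => f x y) _ t0 s0 (double_series_swap HF).
by do 4 (split=> //); exists (a 1%N 1%N).
Qed.

(** * The equation for the angle *)

Lemma zero_derive_const (f : R -> R) r :
  (forall s, Rabs s < r -> is_derive f s 0) ->
  forall s, Rabs s < r -> f s = f 0.
Proof.
move=> Hf s Hs.
have := @derive_pow_bound (fun x => f x - f 0) (fun _ => 0) r 0 0 _ _ _ s Hs.
rewrite Rmult_0_l /Rdiv Rmult_0_l => H.
suff /Rabs_eq_0 : Rabs (f s - f 0) = 0 by lra.
apply: Rle_antisym (Rabs_pos _); apply: H; first by lra.
- move=> x Hx; have -> : 0 = 0 - 0 by lra.
  by apply: is_derive_minus (Hf x Hx) (is_derive_const _ _).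
- by move=> x _; rewrite Rabs_R0 Rmult_0_l; apply: Rle_refl.
Qed.

Lemma qnorm_nth_bound (sys : seq (seq (R * nat * nat))) :
  exists2 Cq, 0 < Cq & forall i, qnorm (nth [::] sys i) <= Cq.
Proof.
elim: sys => [|l sys [Cq H0 H]].
  by exists 1; [lra | move=> i; rewrite nth_nil /=; lra].
have Hl := qnorm_ge0 l.
by exists (Cq + qnorm l); [lra | case=> [|i] /=; [lra | have := H i; lra]].
Qed.

Lemma init_nth_bound (init : seq R) :
  exists2 M, 0 < M & forall i, Rabs (nth 0 init i) <= M.
Proof.
elim: init => [|y init [M H0 H]].
  by exists 1; [lra | move=> i; rewrite nth_nil Rabs_R0; lra].
have Hy := Rabs_pos y.
by exists (M + Rabs y); [lra | case=> [|i] /=; [lra | have := H i; lra]].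
Qed.

Lemma quad_system (sys : seq (seq (R * nat * nat))) (init : seq R) :
  exists r (y : nat -> R -> R), 0 < r /\
    forall i, y i 0 = nth 0 init i /\
      analytic_on (fun s => Rabs s < r) (y i) /\
      forall s, Rabs s < r ->
        is_derive (y i) s (quad (nth [::] sys i) (fun j k => y j s * y k s)).
Proof.
have [Cq HC Hq] := qnorm_nth_bound sys.
have [M HM Hy] := init_nth_bound init.
have [a Ha] := quad_solution HC HM Hq Hy.
exists (/ (2 * Cq * M)), (fun i => PSeries (a i)).
split; first by apply: Rinv_0_lt_compat; nra.
move=> i; split; first by case: (Ha i).
split; last by move=> s Hs; have [_ /(_ s Hs) [_ []]] := Ha i.
apply: (@quad_analytic (fun i => nth [::] sys i) Cq (2 * M)
          (/ (2 * Cq * M)) (fun i => PSeries (a i))) => //.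
- lra.
- by move=> j s Hs; have [_ /(_ s Hs) [_ []]] := Ha j.
- by move=> j s Hs; have [_ /(_ s Hs) [_ []]] := Ha j.
Qed.

(** With [k] and [w] as unknowns the third-order equation, which divides by
    [k1], becomes a polynomial first-order system. *)
Definition theta_flow (L d : R) (th k w : R -> R) : Prop :=
  forall s, Rabs s < d ->
    is_derive th s (k s - sin (th s) / L) /\
    is_derive k s (- 2 * w s * k s - cos (th s) / L * (k s - sin (th s) / L)) /\
    is_derive w s (k s ^ 2 + sin (th s) ^ 2 / L ^ 2 + 2 / L ^ 2 - w s ^ 2
                   - cos (th s) / L * w s).

(** Unknowns 0 to 9 of the system: [1], [sin theta], [cos theta], [k], [w],
    [theta], [rho], [1 / rho], the horocyclic abscissa [x], and [1 / u]. *)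
Definition profile_monomials (L : R) : seq (seq (R * nat * nat)) :=
  let l := / L in
  [:: [::];
      [:: (1, 2%N, 3%N); (- l, 2%N, 1%N)];
      [:: (- 1, 1%N, 3%N); (l, 1%N, 1%N)];
      [:: (- 2, 4%N, 3%N); (- l, 2%N, 3%N); (l * l, 2%N, 1%N)];
      [:: (1, 3%N, 3%N); (l * l, 1%N, 1%N); (2 * (l * l), 0%N, 0%N); (- 1, 4%N, 4%N); (- l, 2%N, 4%N)];
      [:: (1, 0%N, 3%N); (- l, 0%N, 1%N)];
      [:: (l, 2%N, 6%N)];
      [:: (- l, 2%N, 7%N)];
      [:: (1, 1%N, 7%N)];
      [:: (- 1, 4%N, 9%N)]].

Definition theta_table (th k w : R -> R) (i : nat) (s : R) : R :=
  match i with
  | 0%N => 1 | 1%N => sin (th s) | 2%N => cos (th s)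
  | 3%N => k s | 4%N => w s | 5%N => th s | _ => 0
  end.

Lemma theta_table_derive L d th k w : 0 < L -> theta_flow L d th k w ->
  forall i s, (i < 6)%N -> Rabs s < d ->
    is_derive (theta_table th k w i) s
      (quad (nth [::] (profile_monomials L) i)
         (fun j l => theta_table th k w j s * theta_table th k w l s)).
Proof.
move=> HL Hf i s Hi Hs; have [D1 [D2 D3]] := Hf s Hs.
case: i Hi => [|[|[|[|[|[|i //]]]]]] _; rewrite [quad _ _]/=.
- exact (is_derive_const (1 : R) s).
- have := is_derive_comp sin th s _ _ (is_derive_sin (th s)) D1.
  by rewrite /scal /= /mult /=; apply: is_derive_ext_val; field; lra.
- have := is_derive_comp cos th s _ _ (is_derive_cos (th s)) D1.
  by rewrite /scal /= /mult /=; apply: is_derive_ext_val; field; lra.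
- by apply: is_derive_ext_val D2; field; lra.
- by apply: is_derive_ext_val D3; field; lra.
- by apply: is_derive_ext_val D1; field; lra.
Qed.

Lemma list_bound (f : nat -> R -> R) d n :
  (forall i s, (i < n)%N -> Rabs s <= d -> continuity_pt (f i) s) ->
  exists2 M, 0 < M & forall i s, (i < n)%N -> Rabs s <= d -> Rabs (f i s) <= M.
Proof.
elim: n => [|n IH] Hf; first by exists 1; [lra | by []].
have [M HM Hb] := IH (fun i s Hi => Hf i s (ltnW Hi)).
case: (Rle_lt_dec 0 d) => Hd; last first.
  exists M => // i s _ Hs; have := Rabs_pos s; lra.
have Hab s : - d <= s <= d -> Rabs s <= d by move=> ?; apply: Rabs_le.
have [m Hm] : exists m, forall s, Rabs s <= d -> Rabs (f n s) <= m.
  have [||m [Hm _]] := continuity_ab_maj (fun s => Rabs (f n s)) (- d) d; first lra.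
    move=> s Hs; apply: (continuity_pt_comp (f n) Rabs); last exact: Rcontinuity_abs.
    by apply: Hf => //; apply: Hab.
  by exists (Rabs (f n m)) => s Hs; apply: Hm; apply/Rabs_le_between.
exists (M + Rabs m); first by have := Rabs_pos m; lra.
move=> i s; rewrite ltnS leq_eqVlt => /orP [/eqP ->|Hi] Hs.
  have := Hm s Hs; have := Rle_abs m; lra.
have := Hb i s Hi Hs; have := Rabs_pos m; lra.
Qed.

(** Only the first six unknowns, which form a closed subsystem, are compared. *)
Lemma theta_flow_unique L d th k w th' k' w' : 0 < L ->
  theta_flow L d th k w -> theta_flow L d th' k' w' ->
  th 0 = th' 0 -> k 0 = k' 0 -> w 0 = w' 0 ->
  forall s, Rabs s < d -> th s = th' s.
Proof.
move=> HL F F' E1 E2 E3 s Hs.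
pose d1 := (Rabs s + d) / 2.
have Hd1 : Rabs s < d1 < d by rewrite /d1; lra.
have bnd th1 k1 w1 : theta_flow L d th1 k1 w1 -> exists2 M, 0 < M &
    forall i x, (i < 6)%N -> Rabs x <= d1 -> Rabs (theta_table th1 k1 w1 i x) <= M.
  move=> G; apply: list_bound => i x Hi Hx; apply: ex_derive_continuity_pt.
  by eexists; apply: (theta_table_derive HL G Hi); lra.
have [M HM HbM] := bnd _ _ _ F; have [M' HM' HbM'] := bnd _ _ _ F'.
have [Cq HC Hq] := qnorm_nth_bound (profile_monomials L).
apply: (@quad_unique (fun i => i < 6)%N (fun i => nth [::] (profile_monomials L) i)
   Cq (M + M') d1 (theta_table th k w) (theta_table th' k' w') _ _ _ _ _ _ _ 5%N s) => //.
- lra.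
- by case=> [|[|[|[|[|[|i]]]]]].
- move=> i x Hi Hx; have := HbM i x Hi (Rlt_le _ _ Hx); have := HbM' i x Hi (Rlt_le _ _ Hx).
  by lra.
- move=> i x Hi Hx; have Hx' : Rabs x < d by lra.
  by split; [apply: theta_table_derive F _ _ Hi Hx' | apply: theta_table_derive F' _ _ Hi Hx'].
- by case=> [|[|[|[|[|[|i]]]]]] //= _; rewrite ?E1.
- by case: Hd1.
Qed.

Lemma is_derive_sin_comp (th : R -> R) (s l c : R) :
  is_derive th s l -> is_derive (fun x => sin (th x) / c) s (cos (th s) / c * l).
Proof.
move=> D; have := is_derive_comp sin th s _ _ (is_derive_sin (th s)) D.
move/(is_derive_scal_l _ _ _ (/ c)); rewrite /scal /= /mult /=.
by apply: is_derive_ext_val; rewrite /Rdiv; ring.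
Qed.

Lemma is_derive_cos_comp (th : R -> R) (s l c : R) :
  is_derive th s l -> is_derive (fun x => cos (th x) / c) s (- (sin (th s) / c) * l).
Proof.
move=> D; have := is_derive_comp cos th s _ _ (is_derive_cos (th s)) D.
move/(is_derive_scal_l _ _ _ (/ c)); rewrite /scal /= /mult /=.
by apply: is_derive_ext_val; rewrite /Rdiv; ring.
Qed.

Lemma theta_solution_derivatives L th d :
  analytic_on (fun s => Rabs s < d) th ->
  forall s, Rabs s < d ->
    is_derive th s (Derive th s) /\
    is_derive (k1 L th) s (Derive_n th 2 s + cos (th s) / L * Derive th s) /\
    is_derive (meanH L th) s (Derive_n th 2 s / 2 + cos (th s) / L * Derive th s) /\
    (k1 L th s <> 0 -> ex_derive (w L th) s).
Proof.
move=> Ha.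
have [D0 A1] := analytic_derive Ha.
have [D1 A2] := analytic_derive A1.
have [D2 _] := analytic_derive A2.
have dth s (Hs : Rabs s < d) := Derive_correct _ _ (D0 s Hs).
have dth2 s (Hs : Rabs s < d) := Derive_correct _ _ (D1 s Hs).
have dH s : Rabs s < d -> is_derive (meanH L th) s
    (Derive_n th 2 s / 2 + cos (th s) / L * Derive th s).
  move=> Hs; apply: is_derive_plus; last by apply: is_derive_sin_comp; apply: dth.
  have := is_derive_scal_l _ _ _ (/ 2) (dth2 s Hs); by rewrite /scal /= /mult /=.
have dk s : Rabs s < d -> is_derive (k1 L th) s
    (Derive_n th 2 s + cos (th s) / L * Derive th s).
  by move=> Hs; apply: is_derive_plus; [apply: dth2 | apply: is_derive_sin_comp; apply: dth].
move=> s Hs; do 3 (split; first by auto).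
move=> Hk; rewrite /w.
apply: (ex_derive_ext_loc (fun x => - (Derive_n th 2 x / 2 + cos (th x) / L * Derive th x) / k1 L th x)).
  apply: (@locally_Rabs _ s (d - Rabs s)); first lra.
  move=> x Hx; have Hx' : Rabs x < d.
    by rewrite -(Rminus_0_r x); apply: (@ball_sub s); rewrite Rminus_0_r.
  by rewrite (is_derive_unique _ _ _ (dH x Hx')).
apply: ex_derive_div => //; last by eexists; apply: dk.
apply: ex_derive_opp; apply: ex_derive_plus.
  apply: (ex_derive_scal_l _ s (/ 2)); exact: D2.
apply: ex_derive_mult; last exact: D1.
by eexists; apply: is_derive_cos_comp; apply: dth.
Qed.

Lemma theta_solution_flow L th th0 a0 b0 d : 0 < L ->
  theta_solution L th th0 a0 b0 d -> theta_flow L d th (k1 L th) (w L th).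
Proof.
move=> HL [Ha [_ [_ [_ Heq]]]] s Hs.
have [Hk E] := Heq s Hs.
have [D1 [D2 [D3 /(_ Hk) D4]]] := theta_solution_derivatives L Ha Hs.
have Ep : Derive th s = k1 L th s - sin (th s) / L by rewrite /k1; ring.
split; first by rewrite -Ep.
split; last first.
  apply: is_derive_ext_val (Derive_correct _ _ D4).
  move: E; rewrite /theta_equation => E; rewrite /Rdiv Rpow_mult_distr in E *; nra.
apply: is_derive_ext_val D2.
have -> : - 2 * w L th s * k1 L th s = 2 * Derive (meanH L th) s.
  by rewrite /w; field.
by rewrite (is_derive_unique _ _ _ D3) Ep; field; lra.
Qed.

Lemma theta_solution_initial L th th0 a0 b0 d : 0 < d ->
  theta_solution L th th0 a0 b0 d ->
  th 0 = th0 /\ k1 L th 0 = k10 L th0 a0 /\ meanH L th 0 = H0 L th0 a0 /\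
  Derive (meanH L th) 0 = H0' L th0 a0 b0.
Proof.
move=> Hd [Ha [E0 [E1 [E2 _]]]].
have H0 : Rabs 0 < d by rewrite Rabs_R0.
have [_ [_ [D _]]] := theta_solution_derivatives L Ha H0.
rewrite (is_derive_unique _ _ _ D) /k1 /k10 /meanH /Defs.H0 /H0' E0 E1 E2.
by do 3 split=> //; rewrite /Rdiv; ring.
Qed.

Lemma theta_solution_unique L th th' th0 a0 b0 d d' : 0 < L -> 0 < d -> 0 < d' ->
  theta_solution L th th0 a0 b0 d -> theta_solution L th' th0 a0 b0 d' ->
  forall s, Rabs s < d -> Rabs s < d' -> th' s = th s.
Proof.
move=> HL Hd Hd' S S' s Hs Hs'.
have F := theta_solution_flow HL S; have F' := theta_solution_flow HL S'.
have [A0 [A1 [_ A3]]] := theta_solution_initial Hd S.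
have [B0 [B1 [_ B3]]] := theta_solution_initial Hd' S'.
have sub e th1 : e = d \/ e = d' -> theta_flow L e th1 (k1 L th1) (w L th1) ->
    theta_flow L (Rmin d d') th1 (k1 L th1) (w L th1).
  move=> He G x Hx; apply: G; apply: Rlt_le_trans Hx _.
  by case: He => ->; [exact: Rmin_l | exact: Rmin_r].
apply: (theta_flow_unique HL (sub d' _ _ F') (sub d _ _ F)).
- by right.
- by left.
- by rewrite A0 B0.
- by rewrite A1 B1.
- by rewrite /w A1 B1 A3 B3.
- exact: Rmin_glb_lt.
Qed.

(** The profile data: besides the flow, [r] is the radius [rho], [sg] its
    inverse, [x] the horocyclic abscissa of the profile curve in the upper half-plane
    model, and [v] the inverse of [u]. *)
Record profile (L d : R) (th k w r sg x v : R -> R) : Prop := {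
  pf_flow : theta_flow L d th k w;
  pf_r : forall s, Rabs s < d -> is_derive r s (cos (th s) / L * r s);
  pf_sg : forall s, Rabs s < d -> is_derive sg s (- (cos (th s) / L) * sg s);
  pf_x : forall s, Rabs s < d -> is_derive x s (sin (th s) * sg s);
  pf_v : forall s, Rabs s < d -> is_derive v s (- w s * v s);
  pf_rsg : forall s, Rabs s < d -> r s * sg s = 1;
  pf_an : forall f, List.In f [:: th; k; w; r; sg; x; v; fun s => sin (th s);
                                fun s => cos (th s)] ->
          analytic_on (fun s => Rabs s < d) f }.

Lemma profile_shrink L d d' th k w r sg x v : d' <= d ->
  profile L d th k w r sg x v -> profile L d' th k w r sg x v.
Proof.
move=> Hd [F1 F2 F3 F4 F5 F6 F7].
have sub s : Rabs s < d' -> Rabs s < d by lra.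
split; try by move=> s /sub; auto.
by move=> f /F7; apply: analytic_sub.
Qed.

Lemma profile_exists L th0 k0 w0 rho0 v0 : 0 < L -> 0 < rho0 ->
  exists d th k w r sg x v, 0 < d /\ profile L d th k w r sg x v /\
    th 0 = th0 /\ k 0 = k0 /\ w 0 = w0 /\ r 0 = rho0 /\ x 0 = 0 /\ v 0 = v0.
Proof.
move=> HL Hr0.
have [d [y [Hd Hy]]] := quad_system (profile_monomials L)
  [:: 1; sin th0; cos th0; k0; w0; th0; rho0; / rho0; 0; v0].
have I i := proj1 (Hy i).
have A i := proj1 (proj2 (Hy i)).
have D i s (Hs : Rabs s < d) := proj2 (proj2 (Hy i)) s Hs.
have const0 s : Rabs s < d -> y 0%N s = 1.
  by move=> Hs; rewrite (zero_derive_const (D 0%N) Hs) I.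
have H0 : Rabs 0 < d by rewrite Rabs_R0.
have dth s : Rabs s < d -> is_derive (y 5%N) s (y 3%N s - y 1%N s / L).
  move=> Hs; apply: is_derive_ext_val (D 5%N s Hs).
  by rewrite /= const0 //; field; lra.
(* [(sin theta, cos theta)] and the computed pair rotate with the same
   velocity, so their distance is constant. *)
pose gap s := (y 1%N s - sin (y 5%N s)) ^ 2 + (y 2%N s - cos (y 5%N s)) ^ 2.
have dgap s : Rabs s < d -> is_derive gap s 0.
  move=> Hs; have := dth s Hs; have := D 1%N s Hs; have := D 2%N s Hs.
  rewrite /gap /= => d2 d1 d5.
  auto_derive; first by do ! split; eexists; eassumption.
  rewrite (is_derive_unique _ _ _ d1) (is_derive_unique _ _ _ d2)
    (is_derive_unique _ _ _ d5).
  by field; lra.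
have gap0 s : Rabs s < d -> y 1%N s = sin (y 5%N s) /\ y 2%N s = cos (y 5%N s).
  move=> Hs; have := zero_derive_const dgap Hs.
  rewrite /gap !I -!Rsqr_pow2 /= !Rminus_diag Rsqr_0 Rplus_0_r => E.
  have := Rplus_sqr_eq_0_l _ _ E; have := Rplus_sqr_eq_0_l _ _ (etrans (Rplus_comm _ _) E).
  by lra.
have rs s : Rabs s < d -> y 6%N s * y 7%N s = 1.
  move=> Hs.
  have H : forall s, Rabs s < d -> is_derive (fun s => y 6%N s * y 7%N s) s 0.
    move=> z Hz; have d6 := D 6%N z Hz; have d7 := D 7%N z Hz.
    apply: is_derive_ext_val (is_derive_mult _ _ _ _ _ d6 d7 Rmult_comm).
    by rewrite /plus /mult /=; ring.
  by rewrite (zero_derive_const H Hs) !I /=; field; lra.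
exists d, (y 5%N), (y 3%N), (y 4%N), (y 6%N), (y 7%N), (y 8%N), (y 9%N).
split=> //; split; last by rewrite !I.
split.
- move=> s Hs; have [E1 E2] := gap0 s Hs; rewrite -E1 -E2.
  split; first exact: dth.
  split; [apply: is_derive_ext_val (D 3%N s Hs) | apply: is_derive_ext_val (D 4%N s Hs)].
    by rewrite /=; field; lra.
  by rewrite /= const0 //; field; lra.
- move=> s Hs; have [E1 E2] := gap0 s Hs; rewrite -E2.
  by apply: is_derive_ext_val (D 6%N s Hs); rewrite /=; field; lra.
- move=> s Hs; have [E1 E2] := gap0 s Hs; rewrite -E2.
  by apply: is_derive_ext_val (D 7%N s Hs); rewrite /=; field; lra.
- move=> s Hs; have [E1 E2] := gap0 s Hs; rewrite -E1.
  by apply: is_derive_ext_val (D 8%N s Hs); rewrite /=; ring.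
- by move=> s Hs; apply: is_derive_ext_val (D 9%N s Hs); rewrite /=; ring.
- exact: rs.
- have AE f i : (forall s, Rabs s < d -> f s = y i s) -> analytic_on (fun s => Rabs s < d) f.
    move=> E s0 Hs0; have [a [e [He Ha]]] := A i s0 Hs0.
    exists a, (Rmin e (d - Rabs s0)); split; first by apply: Rmin_glb_lt; lra.
    move=> s Hs; have Hs1 := Rlt_le_trans _ _ _ Hs (Rmin_l _ _).
    rewrite E; first exact: Ha.
    rewrite -(Rminus_0_r s); apply: (@ball_sub s0); rewrite Rminus_0_r //.
    exact: Rlt_le_trans Hs (Rmin_r _ _).
  move=> f /=; do 7 (case=> [<-|]; first exact: A).
  case=> [<-|]; first by apply: (AE _ 1%N) => s /gap0 [].
  by case=> [<-|//]; apply: (AE _ 2%N) => s /gap0 [].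
Qed.

Lemma ball0_between d s z : Rabs s < d -> Rmin 0 s <= z <= Rmax 0 s -> Rabs z < d.
Proof.
move=> Hs; rewrite /Rmin /Rmax; case: Rle_dec => H Hz.
  by rewrite Rabs_pos_eq in Hs; last lra; rewrite Rabs_pos_eq; lra.
rewrite Rabs_left in Hs; last lra.
by apply: Rabs_def1; lra.
Qed.

Lemma ball0_locally d s : Rabs s < d -> locally s (fun z => Rabs z < d).
Proof.
move=> Hs; apply: (@locally_Rabs _ s (d - Rabs s)); first lra.
move=> z Hz; rewrite -(Rminus_0_r z); apply: (@ball_sub s); rewrite Rminus_0_r //.
Qed.

Lemma is_derive_RInt_ball (f : R -> R) d :
  (forall s, Rabs s < d -> continuous f s) ->
  forall s, Rabs s < d -> is_derive (fun z => RInt f 0 z) s (f s).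
Proof.
move=> Hf s Hs; apply: (is_derive_RInt f _ 0); last exact: Hf.
apply: filter_imp (ball0_locally Hs) => z Hz.
apply: (RInt_correct f 0 z); apply: ex_RInt_continuous => t Ht.
by apply: Hf; apply: ball0_between Hz Ht.
Qed.

Section Profile.
Variables (L d : R) (th k w r sg x v : R -> R).
Hypothesis HL : 0 < L.
Hypothesis Hd : 0 < d.
Hypothesis P : profile L d th k w r sg x v.

Let d_th s (Hs : Rabs s < d) : is_derive th s (k s - sin (th s) / L) :=
  proj1 (pf_flow P Hs).

Lemma profile_k1 s : Rabs s < d -> k1 L th s = k s.
Proof. by move=> Hs; rewrite /k1 (is_derive_unique _ _ _ (d_th Hs)); ring. Qed.

Lemma profile_meanH s : Rabs s < d -> meanH L th s = (k s + k2 L th s) / 2.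
Proof.
move=> Hs; rewrite /meanH /k2 (is_derive_unique _ _ _ (d_th Hs)); field; lra.
Qed.

Lemma profile_dmeanH s : Rabs s < d -> is_derive (meanH L th) s (- w s * k s).
Proof.
move=> Hs.
apply: (is_derive_ext_loc (fun z => (k z + k2 L th z) / 2)).
  by apply: filter_imp (ball0_locally Hs) => z Hz; rewrite profile_meanH.
have [D1 [D2 _]] := pf_flow P Hs.
have D3 := is_derive_sin_comp L D1.
have := is_derive_scal_l _ _ _ (/ 2) (is_derive_plus _ _ _ _ _ D2 D3).
by apply: is_derive_ext_val; rewrite /scal /plus /= /mult /=; field; lra.
Qed.

Lemma profile_w s : Rabs s < d -> k s <> 0 -> Defs.w L th s = w s.
Proof.
move=> Hs Hk; rewrite /Defs.w (is_derive_unique _ _ _ (profile_dmeanH Hs)) profile_k1 //.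
by field.
Qed.

Lemma profile_theta_solution :
  (forall s, Rabs s < d -> k s <> 0) ->
  theta_solution L th (th 0) (k 0 - sin (th 0) / L)
    (2 * (- w 0 * k 0) - 2 * cos (th 0) / L * (k 0 - sin (th 0) / L)) d.
Proof.
move=> Hk.
have H0 : Rabs 0 < d by rewrite Rabs_R0.
have Ha : analytic_on (fun s => Rabs s < d) th by apply: (pf_an P); left.
have Eth s (Hs : Rabs s < d) := is_derive_unique _ _ _ (d_th Hs).
split=> //; split=> //; split; first exact: Eth.
split.
  have [_ [_ [D _]]] := theta_solution_derivatives L Ha H0.
  have := is_derive_unique _ _ _ D.
  by rewrite (is_derive_unique _ _ _ (profile_dmeanH H0)) Eth // => E; lra.
move=> s Hs; rewrite /theta_equation profile_k1 // profile_w //; last exact: Hk.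
split; first exact: Hk.
have -> : Derive (Defs.w L th) s = Derive w s.
  apply: Derive_ext_loc; apply: filter_imp (ball0_locally Hs) => z Hz.
  by apply: profile_w => //; apply: Hk.
have [_ [_ D]] := pf_flow P Hs; rewrite (is_derive_unique _ _ _ D).
by field; lra.
Qed.

Lemma profile_continuous f : List.In f [:: th; k; w; r; sg; x; v;
    fun s => sin (th s); fun s => cos (th s)] ->
  forall s, Rabs s < d -> continuous f s.
Proof.
move=> Hf s Hs; have [D _] := analytic_derive (pf_an P Hf).
exact: ex_derive_continuous (D s Hs).
Qed.

(** The derivative of [rho * sg] vanishes. *)
Lemma profile_rho s : Rabs s < d -> rho L th (r 0) s = r s.
Proof.
move=> Hs.
pose I z := RInt (fun tau => cos (th tau)) 0 z.
have dI z : Rabs z < d -> is_derive I z (cos (th z)).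
  apply: (is_derive_RInt_ball (f := fun tau => cos (th tau))) => y Hy.
  by apply: profile_continuous Hy; do 8 right; left.
have H z : Rabs z < d -> is_derive (fun y => rho L th (r 0) y * sg y) z 0.
  move=> Hz; have dz := dI z Hz; have ds := pf_sg P Hz.
  apply: (is_derive_ext (fun y => r 0 * exp (/ L * I y) * sg y)) => //.
  auto_derive; first by do ! split; eexists; eassumption.
  rewrite (is_derive_unique _ _ _ dz) (is_derive_unique _ _ _ ds).
  by field; lra.
have H0 : Rabs 0 < d by rewrite Rabs_R0.
have := zero_derive_const H Hs.
have Er0 : rho L th (r 0) 0 = r 0 by rewrite /rho RInt_point /zero /= Rmult_0_r exp_0; ring.
rewrite Er0 (pf_rsg P H0) => E.
have E' := pf_rsg P Hs.
have Hsg : sg s <> 0 by move=> Z; move: E'; rewrite Z; lra.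
by apply: (Rmult_eq_reg_r (sg s)) => //; rewrite E E'.
Qed.

Lemma profile_r_neq0 s : Rabs s < d -> r s <> 0.
Proof. by move=> /(pf_rsg P) E Z; move: E; rewrite Z; lra. Qed.

(** The derivative of [u * v] vanishes. *)
Lemma profile_u u0 s : (forall s, Rabs s < d -> k s <> 0) -> u0 * v 0 = 1 ->
  Rabs s < d -> u L th u0 s * v s = 1.
Proof.
move=> Hk Hv Hs.
pose I z := RInt w 0 z.
have dI z : Rabs z < d -> is_derive I z (w z).
  apply: (is_derive_RInt_ball (f := w)) => y Hy.
  by apply: profile_continuous Hy; do 2 right; left.
have Eu z : Rabs z < d -> u L th u0 z = u0 * exp (I z).
  move=> Hz; rewrite /u; congr (_ * exp _).
  rewrite (RInt_ext _ (fun y => opp (w y))); last first.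
    move=> y Hy; have Hy' : Rabs y < d by apply: ball0_between Hz _; lra.
    rewrite (is_derive_unique _ _ _ (profile_dmeanH Hy')) profile_k1 //.
    by rewrite /opp /=; field; exact: Hk.
  rewrite RInt_opp ?/opp /= ?Ropp_involutive //.
  apply: ex_RInt_continuous => t Ht; apply: profile_continuous; first by do 2 right; left.
  exact: ball0_between Hz Ht.
rewrite Eu //.
have H z : Rabs z < d -> is_derive (fun y => u0 * exp (I y) * v y) z 0.
  move=> Hz; have dz := dI z Hz; have ds := pf_v P Hz.
  auto_derive; first by do ! split; eexists; eassumption.
  by rewrite (is_derive_unique _ _ _ dz) (is_derive_unique _ _ _ ds); ring.
rewrite (zero_derive_const H Hs) /I RInt_point /zero /= exp_0.
by rewrite Rmult_1_r.
Qed.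

End Profile.

(** * Vectors of R^{2,2} *)

Lemma vD m n (x y : 'M[R]_(m, n)) i j : (x + y)%mc i j = x i j + y i j.
Proof. by rewrite mxE. Qed.

Lemma vN m n (x : 'M[R]_(m, n)) i j : (- x)%mc i j = - x i j.
Proof. by rewrite mxE. Qed.

Lemma vZ m n a (x : 'M[R]_(m, n)) i j : (a *: x)%mc i j = a * x i j.
Proof. by rewrite mxE. Qed.

Lemma v0 m n i j : (0 : 'M[R]_(m, n))%mc i j = 0.
Proof. by rewrite mxE. Qed.

Definition vE := (vD, vN, vZ, v0).

Lemma vecP n (x y : 'cV[R]_n) : (forall i, x i ord0 = y i ord0) -> x = y.
Proof. by move=> E; apply/colP => i; rewrite -!E. Qed.

Definition i4 (k : nat) : 'I_4 := inord k.

Lemma forall4 (P : 'I_4 -> Prop) : P (i4 0) -> P (i4 1) -> P (i4 2) -> P (i4 3) ->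
  forall i, P i.
Proof.
move=> H0 H1 H2 H3 i; have -> : i = i4 i by rewrite /i4 inord_val.
by case: i => [[|[|[|[|i]]]] Hi].
Qed.

Lemma ipE x y : ip x y = - (x (i4 0) ord0 * y (i4 0) ord0) - x (i4 1) ord0 * y (i4 1) ord0
  + x (i4 2) ord0 * y (i4 2) ord0 + x (i4 3) ord0 * y (i4 3) ord0.
Proof.
rewrite /ip !big_ord_recl big_ord0 /=.
have E (k : 'I_4) j : val k = j -> k = i4 j.
  by move=> <-; rewrite /i4 inord_val.
rewrite (E (lift ord0 (lift ord0 (lift ord0 ord0))) 3%N) //.
rewrite (E (lift ord0 (lift ord0 ord0)) 2%N) // (E (lift ord0 ord0) 1%N) // (E ord0 0%N) //.
rewrite -!RplusE -!RmultE -!RoppE -!R0E -!R1E; ring.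
Qed.

Lemma ipC x y : ip x y = ip y x.
Proof. rewrite !ipE; ring. Qed.

Lemma ipDl x y z : ip (x + y)%mc z = ip x z + ip y z.
Proof. rewrite !ipE !vE; ring. Qed.

Lemma ipNl x z : ip (- x)%mc z = - ip x z.
Proof. rewrite !ipE !vE; ring. Qed.

Lemma ipZl a x z : ip (a *: x)%mc z = a * ip x z.
Proof. rewrite !ipE !vE; ring. Qed.

Lemma ip0l z : ip 0%mc z = 0.
Proof. rewrite !ipE !vE; ring. Qed.

Lemma ipDr x y z : ip z (x + y)%mc = ip z x + ip z y.
Proof. rewrite !ipE !vE; ring. Qed.

Lemma ipNr x z : ip z (- x)%mc = - ip z x.
Proof. rewrite !ipE !vE; ring. Qed.

Lemma ipZr a x z : ip z (a *: x)%mc = a * ip z x.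
Proof. rewrite !ipE !vE; ring. Qed.

Lemma ip0r z : ip z 0%mc = 0.
Proof. rewrite !ipE !vE; ring. Qed.

Definition ip_lin := (ipDl, ipNl, ipZl, ip0l, ipDr, ipNr, ipZr, ip0r).

Definition vec4 (a b c d : R) : 'cV[R]_4 := \col_i nth 0 [:: a; b; c; d] i.

Lemma vec4E a b c d : (vec4 a b c d (i4 0) ord0 = a) * (vec4 a b c d (i4 1) ord0 = b) *
  (vec4 a b c d (i4 2) ord0 = c) * (vec4 a b c d (i4 3) ord0 = d).
Proof. by rewrite !mxE /i4 !inordK. Qed.

Definition is_vderive n (f : R -> 'cV[R]_n) (s : R) (v : 'cV[R]_n) : Prop :=
  forall i, is_derive (fun x => f x i ord0) s (v i ord0).

Lemma vderive_ext_val n (f : R -> 'cV[R]_n) s v v' : v = v' ->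
  is_vderive f s v -> is_vderive f s v'.
Proof. by move=> ->. Qed.

Lemma vderive_ext_loc n (f g : R -> 'cV[R]_n) s v :
  locally s (fun x => f x = g x) -> is_vderive f s v -> is_vderive g s v.
Proof.
move=> E D i; apply: is_derive_ext_loc (D i); apply: filter_imp E => x -> //.
Qed.

Lemma vderive_const n (c : 'cV[R]_n) s : is_vderive (fun _ => c) s 0%mc.
Proof. by move=> i; rewrite v0; apply: is_derive_const. Qed.

Lemma vderive_add n (f g : R -> 'cV[R]_n) s v w : is_vderive f s v ->
  is_vderive g s w -> is_vderive (fun x => f x + g x)%mc s (v + w)%mc.
Proof.
move=> D D' i; apply: (is_derive_ext (fun x => f x i ord0 + g x i ord0)).
  by move=> x; rewrite vD.
by rewrite vD; apply: is_derive_plus.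
Qed.

Lemma vderive_scale n (c : R -> R) (f : R -> 'cV[R]_n) s dc v : is_derive c s dc ->
  is_vderive f s v -> is_vderive (fun x => c x *: f x)%mc s (dc *: f s + c s *: v)%mc.
Proof.
move=> D D' i; apply: (is_derive_ext (fun x => c x * f x i ord0)).
  by move=> x; rewrite vZ.
rewrite !vE; exact: (is_derive_mult _ _ _ _ _ D (D' i) Rmult_comm).
Qed.

Lemma vderive_scalec n (c : R) (f : R -> 'cV[R]_n) s v :
  is_vderive f s v -> is_vderive (fun x => c *: f x)%mc s (c *: v)%mc.
Proof.
move=> D i; apply: (is_derive_ext (fun x => c * f x i ord0)).
  by move=> x; rewrite vZ.
by rewrite !vE; apply: is_derive_scal.
Qed.

Lemma is_derive_ip (f g : R -> 'cV[R]_4) s v w : is_vderive f s v -> is_vderive g s w ->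
  is_derive (fun x => ip (f x) (g x)) s (ip v (g s) + ip (f s) w).
Proof.
move=> D D'.
have M i := is_derive_mult _ _ _ _ _ (D i) (D' i) Rmult_comm.
apply: (is_derive_ext (fun x => - (f x (i4 0) ord0 * g x (i4 0) ord0)
  - f x (i4 1) ord0 * g x (i4 1) ord0
  + f x (i4 2) ord0 * g x (i4 2) ord0 + f x (i4 3) ord0 * g x (i4 3) ord0)).
  by move=> x; rewrite ipE.
apply: is_derive_ext_val (is_derive_plus _ _ _ _ _ (is_derive_plus _ _ _ _ _
  (is_derive_minus _ _ _ _ _ (is_derive_opp _ _ _ (M (i4 0))) (M (i4 1)))
  (M (i4 2))) (M (i4 3))).
by rewrite /minus /opp /plus /mult /= !ipE; ring.
Qed.

Lemma vderive_vec4 (a b c d : R -> R) s a' b' c' d' :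
  is_derive a s a' -> is_derive b s b' -> is_derive c s c' -> is_derive d s d' ->
  is_vderive (fun x => vec4 (a x) (b x) (c x) (d x)) s (vec4 a' b' c' d').
Proof.
move=> Da Db Dc Dd.
by apply: forall4; rewrite vec4E; [apply: is_derive_ext Da | apply: is_derive_ext Db
  | apply: is_derive_ext Dc | apply: is_derive_ext Dd] => x; rewrite vec4E.
Qed.

Definition i2s : 'I_2 := ord0.
Definition i2t : 'I_2 := @Ordinal 2 1 isT.

Lemma forall2 (P : 'I_2 -> Prop) : P i2s -> P i2t -> forall a, P a.
Proof.
move=> H0 H1 [[|[|a]] Ha] //.
  by rewrite (_ : Ordinal Ha = i2s) //; apply: val_inj.
by rewrite (_ : Ordinal Ha = i2t) //; apply: val_inj.
Qed.

Lemma sum2 (V : zmodType) (F : 'I_2 -> V) : (\sum_(a < 2) F a = F i2s + F i2t)%mc.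
Proof.
rewrite !big_ord_recl big_ord0 GRing.addr0; congr (_ + F _)%mc; exact: val_inj.
Qed.

Lemma pd_s f s t : pd i2s f s t = Derive (fun x => f x t) s.
Proof. by []. Qed.

Lemma pd_t f s t : pd i2t f s t = Derive (fun y => f s y) t.
Proof. by []. Qed.

Lemma vpd_s n (V : R -> R -> 'cV[R]_n) s t v :
  is_vderive (fun x => V x t) s v -> vpd i2s V s t = v.
Proof. by move=> D; apply/colP => i; rewrite mxE pd_s; apply: is_derive_unique. Qed.

Lemma vpd_t n (V : R -> R -> 'cV[R]_n) s t v :
  is_vderive (fun y => V s y) t v -> vpd i2t V s t = v.
Proof. by move=> D; apply/colP => i; rewrite mxE pd_t; apply: is_derive_unique. Qed.

(** * Moving frames *)

(** The frame [(X, X_s, X_t, xi)] of an immersion with metric [ds^2 - rho^2 dt^2]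
    and principal curvatures [k1], [k2], where [q = rho' / rho]: its
    Gauss-Weingarten equations and its Gram matrix. *)
Record adapted_frame (L : R) (U : R -> R -> Prop) (k1 k2 q rho : R -> R)
    (X Y T xi : R -> R -> 'cV[R]_4) : Prop := {
  fr_Xs : forall s t, U s t -> is_vderive (fun z => X z t) s (Y s t);
  fr_Xt : forall s t, U s t -> is_vderive (X s) t (T s t);
  fr_Ys : forall s t, U s t -> is_vderive (fun z => Y z t) s
    (k1 s *: xi s t + (/ L ^ 2)%R *: X s t)%mc;
  fr_Yt : forall s t, U s t -> is_vderive (Y s) t (q s *: T s t)%mc;
  fr_Ts : forall s t, U s t -> is_vderive (fun z => T z t) s (q s *: T s t)%mc;
  fr_Tt : forall s t, U s t -> is_vderive (T s) t
    ((rho s ^ 2)%R *: (q s *: Y s t + (- k2 s)%R *: xi s t + (- / L ^ 2)%R *: X s t))%mc;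
  fr_xis : forall s t, U s t -> is_vderive (fun z => xi z t) s ((- k1 s)%R *: Y s t)%mc;
  fr_xit : forall s t, U s t -> is_vderive (xi s) t ((- k2 s)%R *: T s t)%mc;
  fr_XX : forall s t, U s t -> ip (X s t) (X s t) = - L ^ 2;
  fr_YX : forall s t, U s t -> ip (Y s t) (X s t) = 0;
  fr_TX : forall s t, U s t -> ip (T s t) (X s t) = 0;
  fr_xiX : forall s t, U s t -> ip (xi s t) (X s t) = 0;
  fr_YY : forall s t, U s t -> ip (Y s t) (Y s t) = 1;
  fr_TY : forall s t, U s t -> ip (T s t) (Y s t) = 0;
  fr_xiY : forall s t, U s t -> ip (xi s t) (Y s t) = 0;
  fr_TT : forall s t, U s t -> ip (T s t) (T s t) = - rho s ^ 2;
  fr_xiT : forall s t, U s t -> ip (xi s t) (T s t) = 0;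
  fr_xixi : forall s t, U s t -> ip (xi s t) (xi s t) = 1 }.

(** * The parabolic rotational surface *)

Section Surface.
Variables (L d : R) (th k w r sg x v : R -> R).
Hypothesis HL : 0 < L.
Hypothesis P : profile L d th k w r sg x v.

(** With [e0] the first unit vector, [n = (0, 1, 1, 0)], [m = (0, -1/2, 1/2, 0)] and
    [f] the last unit vector, [surfX] is
    [rho t e0 + null_coord n + L rho m + rho x f]; its component along [n] is the
    one for which [<X, X> = - L ^ 2]. *)
Definition null_coord (s t : R) : R :=
  - (L * sg s / 2 + r s * x s ^ 2 / (2 * L)) + r s * t ^ 2 / (2 * L).

Definition surfX (s t : R) : 'cV[R]_4 :=
  vec4 (r s * t) (null_coord s t - L * r s / 2) (null_coord s t + L * r s / 2) (r s * x s).

(** [surfC] and [surfE] are [(X_s, xi)] rotated back by the angle [theta]: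
    [cos theta X_s - sin theta xi = X / L + n / rho] and
    [sin theta X_s + cos theta xi = f - (x / L) n]. Up to a multiple of [X_s], the
    derivatives of both in [s] are multiples of the constant vector [n]. *)
Definition surfC (s t : R) : 'cV[R]_4 :=
  vec4 (r s * t / L) ((null_coord s t - L * r s / 2) / L + sg s)
    ((null_coord s t + L * r s / 2) / L + sg s) (r s * x s / L).

Definition surfE (s : R) : 'cV[R]_4 := vec4 0 (- x s / L) (- x s / L) 1.

Definition surfY (s t : R) : 'cV[R]_4 :=
  (cos (th s) *: surfC s t + sin (th s) *: surfE s)%mc.

Definition surfT (s t : R) : 'cV[R]_4 := vec4 (r s) (r s * t / L) (r s * t / L) 0.

Definition surfN (s t : R) : 'cV[R]_4 :=
  ((- sin (th s))%R *: surfC s t + cos (th s) *: surfE s)%mc.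

Let pyth s : sin (th s) * sin (th s) = 1 - cos (th s) * cos (th s).
Proof. have := sin2_cos2 (th s); rewrite /Rsqr; lra. Qed.

Let d_th s (Hs : Rabs s < d) := proj1 (pf_flow P Hs).
Let rs s (Hs : Rabs s < d) : r s * sg s = 1 := pf_rsg P Hs.

Lemma surf_gram s t : Rabs s < d ->
  [/\ ip (surfX s t) (surfX s t) = - L ^ 2, ip (surfC s t) (surfX s t) = 0,
      ip (surfE s) (surfX s t) = 0 & ip (surfT s t) (surfX s t) = 0] /\
  [/\ ip (surfC s t) (surfC s t) = 1, ip (surfE s) (surfC s t) = 0,
      ip (surfE s) (surfE s) = 1, ip (surfT s t) (surfC s t) = 0 &
      ip (surfT s t) (surfE s) = 0] /\
  ip (surfT s t) (surfT s t) = - r s ^ 2.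
Proof.
move=> Hs; have E := rs Hs.
have Hr : r s <> 0 by move=> Z; move: E; rewrite Z; lra.
have Esg : sg s = / r s by apply: (Rmult_eq_reg_l (r s)) => //; rewrite E Rinv_r.
by do 2 (split; first (split; rewrite ipE /surfC /surfE /surfX /surfT !vec4E
  /null_coord ?Esg; field; lra)); rewrite ipE /surfC /surfE /surfX /surfT !vec4E; field; lra.
Qed.

Definition nullv : 'cV[R]_4 := vec4 0 1 1 0.

Lemma vec4D (a b c d0 a' b' c' d' : R) :
  (vec4 a b c d0 + vec4 a' b' c' d')%mc = vec4 (a + a') (b + b') (c + c') (d0 + d').
Proof. by apply: vecP; apply: forall4; rewrite !vE !vec4E. Qed.

Lemma vec4Z (e a b c d0 : R) : (e *: vec4 a b c d0)%mc = vec4 (e * a) (e * b) (e * c) (e * d0).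
Proof. by apply: vecP; apply: forall4; rewrite !vE !vec4E. Qed.

Lemma surf_Xs s t : Rabs s < d -> is_vderive (fun z => surfX z t) s (surfY s t).
Proof.
move=> Hs; have E := rs Hs; have Py := pyth s.
have dr := pf_r P Hs; have dsg := pf_sg P Hs; have dx := pf_x P Hs.
have Er := is_derive_unique _ _ _ dr; have Esg := is_derive_unique _ _ _ dsg.
have Ex := is_derive_unique _ _ _ dx.
have Hr : r s <> 0 by move=> Z; move: E; rewrite Z; lra.
have E' : sg s = / r s by apply: (Rmult_eq_reg_l (r s)) => //; rewrite E Rinv_r.
rewrite /surfY /surfC /surfE !vec4Z !vec4D /surfX /null_coord.
apply: vderive_vec4; (auto_derive; first by do ? split; try (eexists; eassumption));
  rewrite ?Er ?Esg ?Ex ?E'; field; lra.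
Qed.

Lemma surf_Es s : Rabs s < d ->
  is_vderive surfE s ((- (sin (th s) * sg s / L))%R *: nullv)%mc.
Proof.
move=> Hs; have dx := pf_x P Hs; have Ex := is_derive_unique _ _ _ dx.
rewrite /surfE /nullv vec4Z.
apply: vderive_vec4; (auto_derive; first by do ? split; try (eexists; eassumption));
  rewrite ?Ex; field; lra.
Qed.

Lemma surfC_E s t : surfC s t = ((/ L)%R *: surfX s t + sg s *: nullv)%mc.
Proof. by rewrite /surfC /surfX /nullv !vec4Z vec4D; congr vec4; field; lra. Qed.

Lemma surf_Cs s t : Rabs s < d -> is_vderive (fun z => surfC z t) s
  ((/ L)%R *: surfY s t + (- (cos (th s) / L) * sg s)%R *: nullv)%mc.
Proof.
move=> Hs.
apply: (@vderive_ext_loc _ (fun z => (/ L)%R *: surfX z t + sg z *: nullv)%mc).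
  by apply: filter_forall => z; rewrite surfC_E.
apply: vderive_add; first by apply: vderive_scalec; apply: surf_Xs.
apply: vderive_ext_val (vderive_scale (pf_sg P Hs) (vderive_const nullv s)).
by apply: vecP => i; rewrite !vE; ring.
Qed.

Lemma surf_Xt s t : is_vderive (surfX s) t (surfT s t).
Proof.
rewrite /surfX /surfT /null_coord.
by apply: vderive_vec4; auto_derive => //; field; lra.
Qed.

Lemma surf_Tt s t : is_vderive (surfT s) t ((r s / L)%R *: nullv)%mc.
Proof.
rewrite /surfT /nullv vec4Z.
by apply: vderive_vec4; auto_derive => //; field; lra.
Qed.

Lemma surf_Ct s t : is_vderive (surfC s) t ((/ L)%R *: surfT s t)%mc.
Proof.
apply: (@vderive_ext_loc _ (fun z => (/ L)%R *: surfX s z + sg s *: nullv)%mc).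
  by apply: filter_forall => z; rewrite surfC_E.
apply: vderive_ext_val (vderive_add (vderive_scalec (/ L) (surf_Xt s t)) (vderive_const _ _)).
by apply: vecP => i; rewrite !vE; ring.
Qed.

Lemma surf_Ts s t : Rabs s < d ->
  is_vderive (fun z => surfT z t) s ((cos (th s) / L)%R *: surfT s t)%mc.
Proof.
move=> Hs; have dr := pf_r P Hs; have Er := is_derive_unique _ _ _ dr.
rewrite /surfT vec4Z.
apply: vderive_vec4; (auto_derive; first by do ? split; try (eexists; eassumption));
  rewrite ?Er; field; lra.
Qed.

Lemma surf_frame : adapted_frame L (fun s _ => Rabs s < d) k (k2 L th)
  (fun s => cos (th s) / L) r surfX surfY surfT surfN.
Proof.
have G s t (Hs : Rabs s < d) := surf_gram t Hs.
have dcos s : Rabs s < d ->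
    is_derive (fun z => cos (th z)) s (- sin (th s) * (k s - sin (th s) / L)).
  move=> Hs; have D := is_derive_cos_comp 1 (d_th Hs).
  apply: (is_derive_ext (fun z => cos (th z) / 1)); first by move=> z; rewrite /Rdiv Rinv_1 Rmult_1_r.
  by apply: is_derive_ext_val D; field; lra.
have dsin s : Rabs s < d ->
    is_derive (fun z => sin (th z)) s (cos (th s) * (k s - sin (th s) / L)).
  move=> Hs; have D := is_derive_sin_comp 1 (d_th Hs).
  apply: (is_derive_ext (fun z => sin (th z) / 1)); first by move=> z; rewrite /Rdiv Rinv_1 Rmult_1_r.
  by apply: is_derive_ext_val D; field; lra.
have dsin' s : Rabs s < d ->
    is_derive (fun z => - sin (th z)) s (- (cos (th s) * (k s - sin (th s) / L))).
  by move=> Hs; apply: is_derive_opp; apply: dsin.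
have EX s t i : L * (surfC s t i ord0 - sg s * nullv i ord0) = surfX s t i ord0.
  by rewrite surfC_E !vE; field; lra.
split=> s t Hs.
- exact: surf_Xs.
- exact: surf_Xt.
- have := vderive_add (vderive_scale (dcos s Hs) (surf_Cs t Hs))
            (vderive_scale (dsin s Hs) (surf_Es Hs)).
  apply: vderive_ext_val; apply: vecP => i.
  rewrite /surfY /surfN !vE -EX; have Py := pyth s; field [Py]; lra.
- apply: vderive_ext_val (vderive_add (vderive_scalec (cos (th s)) (surf_Ct s t))
            (vderive_const _ _)).
  by apply: vecP => i; rewrite !vE; field; lra.
- exact: surf_Ts.
- apply: vderive_ext_val (surf_Tt s t); apply: vecP => i; have E := rs Hs.
  have Py := pyth s.
  rewrite /surfY /surfN /k2 !vE -EX.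
  transitivity (r s * (r s * sg s) / L * nullv i ord0); first by rewrite E; field; lra.
  field [Py]; lra.
- have := vderive_add (vderive_scale (dsin' s Hs) (surf_Cs t Hs))
            (vderive_scale (dcos s Hs) (surf_Es Hs)).
  apply: vderive_ext_val; apply: vecP => i.
  rewrite /surfY /surfN !vE; have Py := pyth s; field [Py]; lra.
- apply: vderive_ext_val (vderive_add (vderive_scalec (- sin (th s)) (surf_Ct s t))
            (vderive_const _ _)).
  by apply: vecP => i; rewrite /k2 !vE; field; lra.
all: have [[G1 G2 G3 G4] [[G5 G6 G7 G8 G9] G10]] := G s t Hs; have Py := pyth s.
- exact: G1.
- by rewrite /surfY !ip_lin G2 G3; ring.
- exact: G4.
- by rewrite /surfN !ip_lin G2 G3; ring.
- by rewrite /surfY !ip_lin (ipC (surfC s t) (surfE s)) G5 G6 G7; ring [Py].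
- by rewrite /surfY !ip_lin G8 G9; ring.
- by rewrite /surfY /surfN !ip_lin (ipC (surfC s t) (surfE s)) G5 G6 G7; ring [Py].
- exact: G10.
- by rewrite /surfN !ip_lin !(ipC _ (surfT s t)) G8 G9; ring.
- by rewrite /surfN !ip_lin (ipC (surfC s t) (surfE s)) G5 G6 G7; ring [Py].
Qed.

End Surface.

(** * Tension field *)

Definition dmx2 (a b : R) : 'M[R]_2 := diag_mx (\row_i (if i == ord0 then a else b)).

Lemma dmx2E a b : (dmx2 a b i2s i2s = a) * (dmx2 a b i2s i2t = 0) *
  (dmx2 a b i2t i2s = 0) * (dmx2 a b i2t i2t = b).
Proof. by rewrite !mxE. Qed.

Lemma mat2P (M N : 'M[R]_2) : M i2s i2s = N i2s i2s -> M i2s i2t = N i2s i2t ->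
  M i2t i2s = N i2t i2s -> M i2t i2t = N i2t i2t -> M = N.
Proof. by move=> *; apply/matrixP; apply: forall2; apply: forall2. Qed.

Lemma mulmx2E m p (M : 'M[R]_(m, 2)) (N : 'M[R]_(2, p)) i j :
  (M *m N)%mc i j = M i i2s * N i2s j + M i i2t * N i2t j.
Proof. by rewrite mxE sum2. Qed.

Lemma dmx2_inv a b : a <> 0 -> b <> 0 ->
  dmx2 a b \in unitmx /\ invmx (dmx2 a b) = dmx2 (/ a) (/ b).
Proof.
move=> Ha Hb.
have E : (dmx2 a b *m dmx2 (/ a) (/ b))%mc = 1%:M%mc.
  have E1 i j : (1%:M : 'M[R]_2)%mc i j = if i == j then 1 else 0.
    by rewrite mxE; case: eqP.
  by apply: mat2P; rewrite mulmx2E !dmx2E E1 /=; field.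
have [U _] := mulmx1_unit E; split=> //.
by rewrite -[RHS](mulKmx U) E mulmx1.
Qed.

Lemma christoffel_diag g (A B : R -> R) dA dB s t :
  locally s (fun z => g z t = dmx2 (A z) (B z)) ->
  locally t (fun z => g s z = dmx2 (A s) (B s)) ->
  is_derive A s dA -> is_derive B s dB -> A s <> 0 -> B s <> 0 ->
  [/\ christoffel g i2s i2s i2s s t = dA / (2 * A s),
      christoffel g i2t i2s i2s s t = 0,
      christoffel g i2s i2t i2t s t = - dB / (2 * A s) &
      christoffel g i2t i2t i2t s t = 0].
Proof.
move=> Hs Ht DA DB A0 B0.
have Eg : g s t = dmx2 (A s) (B s) by exact: locally_singleton Hs.
have Ps a b : pd i2s (fun x y => g x y a b) s t = Derive (fun x => dmx2 (A x) (B x) a b) s.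
  by rewrite pd_s; apply: Derive_ext_loc; apply: filter_imp Hs => z ->.
have Pt a b : pd i2t (fun x y => g x y a b) s t = 0.
  rewrite pd_t -(Derive_const (dmx2 (A s) (B s) a b) t).
  by apply: Derive_ext_loc; apply: filter_imp Ht => z ->.
have Dss : Derive (fun x => dmx2 (A x) (B x) i2s i2s) s = dA.
  by rewrite -(is_derive_unique _ _ _ DA); apply: Derive_ext => x; rewrite dmx2E.
have Dtt : Derive (fun x => dmx2 (A x) (B x) i2t i2t) s = dB.
  by rewrite -(is_derive_unique _ _ _ DB); apply: Derive_ext => x; rewrite dmx2E.
have Dst : Derive (fun x => dmx2 (A x) (B x) i2s i2t) s = 0.
  by rewrite -(Derive_const 0 s); apply: Derive_ext => x; rewrite dmx2E.
have Dts : Derive (fun x => dmx2 (A x) (B x) i2t i2s) s = 0.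
  by rewrite -(Derive_const 0 s); apply: Derive_ext => x; rewrite dmx2E.
have [_ EI] := dmx2_inv A0 B0.
by split; rewrite /christoffel sum2 Eg EI !dmx2E !Ps !Pt ?Dss ?Dtt ?Dst ?Dts
  -!RplusE -!RmultE -?RoppE; field.
Qed.

Lemma tprojD L p v w : tproj L p (v + w)%mc = (tproj L p v + tproj L p w)%mc.
Proof. by apply: vecP => i; rewrite /tproj !vE ipDl; rewrite /Rdiv; ring. Qed.

Lemma tprojZ L p a v : tproj L p (a *: v)%mc = (a *: tproj L p v)%mc.
Proof. by apply: vecP => i; rewrite /tproj !vE ipZl; rewrite /Rdiv; ring. Qed.

Lemma tproj_tan L p v : ip v p = 0 -> tproj L p v = v.
Proof. by move=> E; apply: vecP => i; rewrite /tproj !vE E; rewrite /Rdiv; ring. Qed.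

Lemma tproj_self L p : L <> 0 -> ip p p = - L ^ 2 -> tproj L p p = 0%mc.
Proof. by move=> HL E; apply: vecP => i; rewrite /tproj !vE E; field. Qed.

Definition open_rows (U : R -> R -> Prop) : Prop := forall s t, U s t ->
  locally s (fun z => U z t) /\ locally t (fun z => U s z).

Section Tension.
Variables (L : R) (U : R -> R -> Prop) (k1 k2 q rho mu dmu : R -> R).
Variables (X Y T xi : R -> R -> 'cV[R]_4) (g : R -> R -> 'M[R]_2).
Hypothesis HL : L <> 0.
Hypothesis HU : open_rows U.
Hypothesis F : adapted_frame L U k1 k2 q rho X Y T xi.
Hypothesis Hg : forall s t, U s t -> g s t = dmx2 (mu s) (- (mu s * rho s ^ 2)).
Hypothesis Hmu : forall s t, U s t -> is_derive mu s (dmu s) /\ mu s <> 0.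
Hypothesis Hrho : forall s t, U s t -> is_derive rho s (q s * rho s) /\ rho s <> 0.

Lemma frame_vpd s t : U s t -> vpd i2s X s t = Y s t /\ vpd i2t X s t = T s t.
Proof.
by move=> Ust; split; [apply: vpd_s (fr_Xs F Ust) | apply: vpd_t (fr_Xt F Ust)].
Qed.

Lemma frame_christoffel s t : U s t ->
  [/\ christoffel g i2s i2s i2s s t = dmu s / (2 * mu s),
      christoffel g i2t i2s i2s s t = 0,
      christoffel g i2s i2t i2t s t = rho s ^ 2 * (dmu s / (2 * mu s) + q s) &
      christoffel g i2t i2t i2t s t = 0].
Proof.
move=> Ust; have [Ls Lt] := HU Ust.
have [Dmu mu0] := Hmu Ust; have [Drho rho0] := Hrho Ust.
have rho2 : rho s ^ 2 <> 0 by apply: pow_nonzero.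
pose B z := - (mu z * rho z ^ 2).
have DB : is_derive B s (- (dmu s * rho s ^ 2 + mu s * (2 * q s * rho s ^ 2))).
  rewrite /B; auto_derive; first by do ? split; eexists; eassumption.
  rewrite (is_derive_unique _ _ _ Dmu) (is_derive_unique _ _ _ Drho); ring.
have LA : locally s (fun z => g z t = dmx2 (mu z) (B z)).
  by apply: filter_imp Ls => z Uz; rewrite Hg.
have LB : locally t (fun z => g s z = dmx2 (mu s) (B s)).
  by apply: filter_imp Lt => z Uz; rewrite Hg.
have B0 : B s <> 0 by rewrite /B; move: rho2; move: (rho s ^ 2) => z Hz; nra.
have [-> -> -> ->] := christoffel_diag LA LB Dmu DB mu0 B0.
by split=> //; field.
Qed.

Lemma frame_hess s t : U s t ->
  hess L g X i2s i2s s t = (k1 s *: xi s t + (- (dmu s / (2 * mu s)))%R *: Y s t)%mc /\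
  hess L g X i2t i2t s t =
    ((- (rho s ^ 2 * k2 s))%R *: xi s t
     + (- (rho s ^ 2 * (dmu s / (2 * mu s))))%R *: Y s t)%mc.
Proof.
move=> Ust; have [Ls Lt] := HU Ust.
have [E1 E2 E3 E4] := frame_christoffel Ust; have [EY ET] := frame_vpd Ust.
have Yt : ip (Y s t) (X s t) = 0 by apply: fr_YX F _ _ Ust.
have Nt : ip (xi s t) (X s t) = 0 by apply: fr_xiX F _ _ Ust.
have XX : ip (X s t) (X s t) = - L ^ 2 by apply: fr_XX F _ _ Ust.
have Dss : vpd i2s (vpd i2s X) s t = (k1 s *: xi s t + (/ L ^ 2)%R *: X s t)%mc.
  apply: vpd_s; apply: vderive_ext_loc (fr_Ys F Ust).
  by apply: filter_imp Ls => z Uz; have [-> _] := frame_vpd Uz.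
have Dtt : vpd i2t (vpd i2t X) s t = ((rho s ^ 2)%R *: (q s *: Y s t +
    (- k2 s)%R *: xi s t + (- / L ^ 2)%R *: X s t))%mc.
  apply: vpd_t; apply: vderive_ext_loc (fr_Tt F Ust).
  by apply: filter_imp Lt => z Uz; have [_ ->] := frame_vpd Uz.
rewrite /hess /nabla_coord !sum2 Dss Dtt E1 E2 E3 E4 EY ET.
rewrite !(tprojD, tprojZ) (tproj_tan L Yt) (tproj_tan L Nt) (tproj_self HL XX).
by split; apply: vecP => i; rewrite !vE; ring.
Qed.

(** In dimension two the derivatives of the conformal factor [mu] cancel. *)
Lemma frame_tension s t : U s t ->
  tension L g X s t = (((k1 s + k2 s) / mu s)%R *: xi s t)%mc.
Proof.
move=> Ust; have [H1 H2] := frame_hess Ust.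
have [_ mu0] := Hmu Ust; have [_ rho0] := Hrho Ust.
have B0 : - (mu s * rho s ^ 2) <> 0.
  by have := pow_nonzero _ 2 rho0; move: (rho s ^ 2) => z Hz; nra.
have [_ EI] := dmx2_inv mu0 B0.
rewrite /tension !sum2 Hg // EI !dmx2E H1 H2.
by apply: vecP => i; rewrite !vE; field.
Qed.

End Tension.

(** * Curvature of AdS_3(L) *)

Lemma is_derive_div_const (f : R -> R) (s l c : R) :
  is_derive f s l -> is_derive (fun x => f x / c) s (l / c).
Proof.
move=> D; have := is_derive_scal_l _ _ _ (/ c) D.
by rewrite /scal /= /mult /=.
Qed.

Lemma vderive_tproj L (c f : R -> 'cV[R]_4) s c' f' :
  is_vderive c s c' -> is_vderive f s f' ->
  is_vderive (fun h => tproj L (c h) (f h)) s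
    (f' + (((ip f' (c s) + ip (f s) c') / L ^ 2)%R *: c s
           + (ip (f s) (c s) / L ^ 2)%R *: c'))%mc.
Proof.
move=> Dc Df; apply: vderive_add => //.
apply: vderive_scale => //; apply: is_derive_div_const; exact: is_derive_ip.
Qed.

Lemma vderive_line (p v : 'cV[R]_4) (h : R) :
  is_vderive (fun x : R => p + x *: v)%mc h v.
Proof.
apply: vderive_ext_val (vderive_add (vderive_const p h)
  (vderive_scale (is_derive_id h) (vderive_const v h))).
by apply: vecP => i; rewrite !vE /one /=; ring.
Qed.

Lemma ddirE F v p w : is_vderive (fun h : R => F (p + h *: v)%mc) 0 w -> ddir F v p = w.
Proof. by move=> D; apply: vecP => i; rewrite mxE; apply: is_derive_unique. Qed.

Lemma line0 (p v : 'cV[R]_4) : (p + 0%R *: v)%mc = p.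
Proof. by apply: vecP => i; rewrite !vE; ring. Qed.

Lemma ddir_tproj L z v p : ddir (fun q => tproj L q z) v p =
  ((ip z v / L ^ 2)%R *: p + (ip z p / L ^ 2)%R *: v)%mc.
Proof.
apply: ddirE; apply: vderive_ext_val (vderive_tproj L (vderive_line p v 0) (vderive_const z 0)).
by rewrite line0; apply: vecP => i; rewrite !vE ip0l; rewrite /Rdiv; ring.
Qed.

Section Curvature.
Variables (L : R) (p : 'cV[R]_4).
Hypothesis HL : L <> 0.
Hypothesis Hp : ip p p = - L ^ 2.

(** Position vectors are normal to AdS_3(L): of the terms obtained by
    differentiating [tproj L q], only those survive in which the position vector
    itself is differentiated. *)
Lemma nablaN_nablaN x y z : ip x p = 0 -> ip y p = 0 -> ip z p = 0 ->
  nablaN L (fun q => tproj L q x)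
    (nablaN L (fun q => tproj L q y) (fun q => tproj L q z)) p =
  ((ip z x / L ^ 2)%R *: y)%mc.
Proof.
move=> Hx Hy Hz.
rewrite {1}/nablaN (tproj_tan L Hx).
have L2 : L ^ 2 <> 0 by apply: pow_nonzero.
have Dc := vderive_line p x 0.
have DY := vderive_tproj L Dc (vderive_const y 0).
have Df : is_vderive (fun h : R =>
    (ip z (tproj L (p + h *: x) y) / L ^ 2)%R *: (p + h *: x)
    + (ip z (p + h *: x) / L ^ 2)%R *: tproj L (p + h *: x) y)%mc 0
    ((ip z y / L ^ 2)%R *: x + (ip z x / L ^ 2)%R *: y)%mc.
  have Dz := vderive_const z 0.
  apply: vderive_ext_val (vderive_add
    (vderive_scale (is_derive_div_const (L ^ 2) (is_derive_ip Dz DY)) Dc)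
    (vderive_scale (is_derive_div_const (L ^ 2) (is_derive_ip Dz Dc)) DY)).
  rewrite !line0 (tproj_tan L Hy); apply: vecP => i.
  rewrite !vE !ip_lin Hz Hy /Rdiv; ring.
have -> : ddir (nablaN L (fun q => tproj L q y) (fun q => tproj L q z)) x p =
    ((ip z x / L ^ 2)%R *: y)%mc.
  apply: ddirE.
  apply: (@vderive_ext_loc _ (fun h : R => tproj L (p + h *: x)%mc
    ((ip z (tproj L (p + h *: x) y) / L ^ 2)%R *: (p + h *: x)
    + (ip z (p + h *: x) / L ^ 2)%R *: tproj L (p + h *: x) y)%mc)).
    by apply: filter_forall => h; rewrite /nablaN ddir_tproj.
  apply: vderive_ext_val (vderive_tproj L Dc Df).
  rewrite !line0 (tproj_tan L Hy); apply: vecP => i.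
  rewrite !vE !ip_lin Hp Hz Hy Hx (ipC p x) Hx; field; exact: HL.
by rewrite tprojZ (tproj_tan L Hy).
Qed.

(** The sign is that of constant sectional curvature [-1 / L ^ 2]. *)
Lemma curvN_eq x y z : ip x p = 0 -> ip y p = 0 -> ip z p = 0 ->
  curvN L p x y z = ((ip z x / L ^ 2)%R *: y - (ip z y / L ^ 2)%R *: x)%mc.
Proof.
move=> Hx Hy Hz; rewrite /curvN /curvN_field !nablaN_nablaN //.
have -> : nablaN L (bracket (fun q => tproj L q x) (fun q => tproj L q y))
    (fun q => tproj L q z) p = 0%mc.
  rewrite /nablaN ddir_tproj /bracket !ddir_tproj (tproj_tan L Hx) (tproj_tan L Hy) Hx Hy.
  apply: vecP => i; rewrite /tproj !vE !ip_lin (ipC x y) Hp Hz; field; exact: HL.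
by apply: vecP => i; rewrite !vE; ring.
Qed.

End Curvature.

(** * Bitension field *)

(** In matrix form the hypothesis exhibits a left inverse, which is also a right
    inverse. *)
Lemma frame_completeness (A B : R) (e : 'I_2 -> 'cV[R]_2) (eps : 'I_2 -> R) :
  A <> 0 -> B <> 0 -> (forall i, eps i = 1 \/ eps i = - 1) ->
  (forall i j, ((e i)^T *m dmx2 A B *m e j)%mc ord0 ord0 = if i == j then eps i else 0) ->
  forall a b, eps i2s * e i2s a ord0 * e i2s b ord0 + eps i2t * e i2t a ord0 * e i2t b ord0
    = dmx2 (/ A) (/ B) a b.
Proof.
move=> HA HB Heps He.
pose M : 'M[R]_2 := (\matrix_(a, i) e i a ord0)%mc.
have ME a i : M a i = e i a ord0 by rewrite mxE.
have eps2 i : eps i * eps i = 1 by case: (Heps i) => ->; ring.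
have E : (dmx2 (eps i2s) (eps i2t) *m (M^T *m dmx2 A B) *m M)%mc = 1%:M%mc.
  have H i j : (M^T *m dmx2 A B *m M)%mc i j = if i == j then eps i else 0.
    by rewrite -He !mulmx2E !mxE.
  rewrite -mulmxA.
  have E1 i j : (1%:M : 'M[R]_2)%mc i j = if i == j then 1 else 0.
    by rewrite mxE; case: eqP.
  by apply: mat2P; rewrite mulmx2E !H !dmx2E E1 /= ?eps2; ring_simplify; rewrite ?eps2 //.
have E' := mulmx1C E.
have [_ EI] := dmx2_inv HA HB.
have [U _] := dmx2_inv HA HB.
have E2 : (M *m dmx2 (eps i2s) (eps i2t) *m M^T)%mc = dmx2 (/ A) (/ B).
  rewrite -EI -[LHS](mulmxK U) -(mulmxA M) -(mulmxA M) -(mulmxA (dmx2 _ _)) E'.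
  by rewrite mul1mx.
move=> a b; rewrite -E2 mulmx2E !mulmx2E !dmx2E !ME !mxE; ring.
Qed.

(** In [nabla_E nabla_E V - nabla_(nabla_E E) V] the derivatives of the
    components of [E] cancel. *)
Lemma laplacian_term L g X V W D (E : R -> R -> 'cV[R]_2) s t :
  (forall b, locally s (fun z => nabla_coord L X b V z t = W b z t) /\
             locally t (fun z => nabla_coord L X b V s z = W b s z)) ->
  (forall b, is_vderive (fun z => W b z t) s (D i2s b) /\
             is_vderive (W b s) t (D i2t b)) ->
  (forall b, ip (W b s t) (X s t) = 0) ->
  (forall c, ex_derive (fun z => E z t c ord0) s /\ ex_derive (fun z => E s z c ord0) t) ->
  (nabla_phi L X E (nabla_phi L X E V) s t - nabla_phi L X (nablaM g E E) V s t)%mc =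
  (\sum_(a < 2) \sum_(b < 2) (E s t a ord0 * E s t b ord0)%R *:
     (tproj L (X s t) (D a b) - \sum_(c < 2) christoffel g c a b s t *: W c s t))%mc.
Proof.
move=> HW HD Htan HE.
have Wst b : nabla_coord L X b V s t = W b s t.
  by have [H _] := HW b; exact: locally_singleton H.
have dE_s c := Derive_correct _ _ (proj1 (HE c)).
have dE_t c := Derive_correct _ _ (proj2 (HE c)).
have vs : vpd i2s (nabla_phi L X E V) s t = (\sum_(b < 2)
    (pd i2s (fun x y => E x y b ord0) s t *: W b s t + E s t b ord0 *: D i2s b))%mc.
  apply: vpd_s.
  apply: (@vderive_ext_loc _ (fun z => E z t i2s ord0 *: W i2s z t + E z t i2t ord0 *: W i2t z t)%mc).
    have [H1 _] := HW i2s; have [H2 _] := HW i2t.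
    by apply: filter_imp (filter_and _ _ H1 H2) => z [E1 E2]; rewrite /nabla_phi sum2 E1 E2.
  rewrite sum2.
  have [D1 _] := HD i2s; have [D2 _] := HD i2t.
  exact: vderive_add (vderive_scale (dE_s i2s) D1) (vderive_scale (dE_s i2t) D2).
have vt : vpd i2t (nabla_phi L X E V) s t = (\sum_(b < 2)
    (pd i2t (fun x y => E x y b ord0) s t *: W b s t + E s t b ord0 *: D i2t b))%mc.
  apply: vpd_t.
  apply: (@vderive_ext_loc _ (fun z => E s z i2s ord0 *: W i2s s z + E s z i2t ord0 *: W i2t s z)%mc).
    have [_ H1] := HW i2s; have [_ H2] := HW i2t.
    by apply: filter_imp (filter_and _ _ H1 H2) => z [E1 E2]; rewrite /nabla_phi sum2 E1 E2.
  rewrite sum2.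
  have [_ D1] := HD i2s; have [_ D2] := HD i2t.
  exact: vderive_add (vderive_scale (dE_t i2s) D1) (vderive_scale (dE_t i2t) D2).
have T b := tproj_tan L (Htan b).
rewrite {1 3}/nabla_phi !sum2 /nabla_coord vs vt !sum2 !(tprojD, tprojZ) !T -!/(nabla_coord L X _ V s t) !Wst.
apply: vecP => i; rewrite !vE !mxE !sum2 -!RplusE -!RmultE; ring.
Qed.

Definition sel (A : Type) (b : 'I_2) (x y : A) : A := if b == i2s then x else y.

Lemma selE (A : Type) (x y : A) : (sel i2s x y = x) * (sel i2t x y = y).
Proof. by []. Qed.

Section Bitension.
Variables (L : R) (U : R -> R -> Prop) (k1 k2 q rho mu dmu h dh ddh dk1 dk2 : R -> R).
Variables (X Y T xi : R -> R -> 'cV[R]_4) (g : R -> R -> 'M[R]_2).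
Hypothesis HL : L <> 0.
Hypothesis HU : open_rows U.
Hypothesis F : adapted_frame L U k1 k2 q rho X Y T xi.
Hypothesis Hg : forall s t, U s t -> g s t = dmx2 (mu s) (- (mu s * rho s ^ 2)).
Hypothesis Hmu : forall s t, U s t -> is_derive mu s (dmu s) /\ mu s <> 0.
Hypothesis Hrho : forall s t, U s t -> is_derive rho s (q s * rho s) /\ rho s <> 0.
Hypothesis Hh : forall s t, U s t ->
  [/\ (k1 s + k2 s) / mu s = h s, is_derive h s (dh s), is_derive dh s (ddh s),
      is_derive k1 s (dk1 s) & is_derive k2 s (dk2 s)].

Let W (b : 'I_2) (s t : R) : 'cV[R]_4 :=
  sel b (dh s *: xi s t + (- (h s * k1 s))%R *: Y s t)%mc
        ((- (h s * k2 s))%R *: T s t)%mc.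

Let D (a b : 'I_2) (s t : R) : 'cV[R]_4 :=
  sel b
    (sel a ((ddh s - h s * k1 s ^ 2)%R *: xi s t
            + (- (2 * dh s * k1 s + h s * dk1 s))%R *: Y s t
            + (- (h s * k1 s / L ^ 2))%R *: X s t)%mc
           ((- (dh s * k2 s + h s * k1 s * q s))%R *: T s t)%mc)
    (sel a ((- (dh s * k2 s + h s * dk2 s + h s * k2 s * q s))%R *: T s t)%mc
           ((- (h s * k2 s * rho s ^ 2))%R *:
              (q s *: Y s t + (- k2 s)%R *: xi s t + (- / L ^ 2)%R *: X s t))%mc).

Let tension_eq s t : U s t -> tension L g X s t = (h s *: xi s t)%mc.
Proof.
move=> Ust; rewrite (frame_tension HL HU F Hg Hmu Hrho Ust).
by have [-> _ _ _ _] := Hh Ust.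
Qed.

Let tan_Y s t (Ust : U s t) : ip (Y s t) (X s t) = 0 := fr_YX F Ust.
Let tan_T s t (Ust : U s t) : ip (T s t) (X s t) = 0 := fr_TX F Ust.
Let tan_xi s t (Ust : U s t) : ip (xi s t) (X s t) = 0 := fr_xiX F Ust.

Let tan_W b s t : U s t -> ip (W b s t) (X s t) = 0.
Proof.
move=> Ust; move: b; apply: forall2; rewrite /W selE !ip_lin
  ?tan_Y ?tan_T ?tan_xi //; ring.
Qed.

Let nabla_tension b s t : U s t -> nabla_coord L X b (tension L g X) s t = W b s t.
Proof.
move=> Ust; have [Ls Lt] := HU Ust; have [_ Dh _ _ _] := Hh Ust.
suff E : vpd b (tension L g X) s t = W b s t.
  by rewrite /nabla_coord E; apply: tproj_tan; apply: tan_W.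
move: b; apply: forall2.
  apply: vpd_s; apply: (@vderive_ext_loc _ (fun z => h z *: xi z t)%mc).
    by apply: filter_imp Ls => z Uz; rewrite tension_eq.
  apply: vderive_ext_val (vderive_scale Dh (fr_xis F Ust)).
  by apply: vecP => i; rewrite /W selE !vE; ring.
apply: vpd_t; apply: (@vderive_ext_loc _ (fun z => h s *: xi s z)%mc).
  by apply: filter_imp Lt => z Uz; rewrite tension_eq.
apply: vderive_ext_val (vderive_scalec (h s) (fr_xit F Ust)).
by apply: vecP => i; rewrite /W selE !vE; ring.
Qed.

Let W_derive b s t : U s t ->
  is_vderive (fun z => W b z t) s (D i2s b s t) /\ is_vderive (W b s) t (D i2t b s t).
Proof.
move=> Ust; have [_ Dh Ddh Dk1 Dk2] := Hh Ust.
have Dhk (k dk : R -> R) : is_derive k s (dk s) ->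
    is_derive (fun z => - (h z * k z)) s (- (dh s * k s + h s * dk s)).
  by move=> Dk; apply: is_derive_opp; apply: is_derive_mult Dh Dk Rmult_comm.
move: b; apply: forall2; rewrite /W /D !selE; split.
- apply: vderive_ext_val (vderive_add (vderive_scale Ddh (fr_xis F Ust))
    (vderive_scale (Dhk _ _ Dk1) (fr_Ys F Ust))).
  by apply: vecP => i; rewrite !vE; rewrite /Rdiv; ring.
- apply: vderive_ext_val (vderive_add (vderive_scalec (dh s) (fr_xit F Ust))
    (vderive_scalec (- (h s * k1 s)) (fr_Yt F Ust))).
  by apply: vecP => i; rewrite !vE; ring.
- apply: vderive_ext_val (vderive_scale (Dhk _ _ Dk2) (fr_Ts F Ust)).
  by apply: vecP => i; rewrite !vE; ring.
- apply: vderive_ext_val (vderive_scalec (- (h s * k2 s)) (fr_Tt F Ust)).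
  by apply: vecP => i; rewrite !vE; ring.
Qed.

Hypothesis normal_eq : forall s t, U s t ->
  ddh s + q s * dh s - (k1 s ^ 2 + k2 s ^ 2) * h s - 2 / L ^ 2 * h s = 0.
Hypothesis tangent_eq : forall s t, U s t ->
  2 * dh s * k1 s + h s * dk1 s + h s * q s * (k1 s - k2 s) = 0.

(** The normal and the tangential component of the bitension field are the
    left-hand sides of the two hypotheses above, multiplied by [1 / mu] and by
    [- 1 / mu]. *)
Lemma bitension_zero (V : R -> R -> Prop) e eps : open2 V ->
  (forall s t, V s t -> U s t) -> pseudo_orthonormal_frame g V e eps ->
  forall s t, V s t -> bitension L g X e eps s t = 0%mc.
Proof.
move=> HV VU [Hsm [Heps Hort]] s t Vst.
have Ust := VU s t Vst; have [Ls Lt] := HU Ust.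
have [mu_d mu0] := Hmu Ust; have [_ rho0] := Hrho Ust.
have rho2 : rho s ^ 2 <> 0 by apply: pow_nonzero.
have B0 : - (mu s * rho s ^ 2) <> 0 by move: rho2; move: (rho s ^ 2) => z Hz; nra.
have gst := Hg Ust.
have CP := frame_completeness mu0 B0 Heps (e := fun i => e i s t) _.
have {}CP := CP (fun i j => eq_trans (f_equal (fun m => ((e i s t)^T *m m *m e j s t)%mc ord0 ord0)
  (esym gst)) (Hort s t Vst i j)).
have XX := fr_XX F Ust.
have [G1 G2 G3 G4] := frame_christoffel HU Hg Hmu Hrho Ust.
have lap i : (nabla_phi L X (e i) (nabla_phi L X (e i) (tension L g X)) s t
   - nabla_phi L X (nablaM g (e i) (e i)) (tension L g X) s t)%mc =
  (\sum_(a < 2) \sum_(b < 2) (e i s t a ord0 * e i s t b ord0)%R *: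
     (tproj L (X s t) (D a b s t) - \sum_(c < 2) christoffel g c a b s t *: W c s t))%mc.
  apply: (@laplacian_term L g X _ W (fun a b => D a b s t)).
  - move=> b; split; [apply: filter_imp Ls | apply: filter_imp Lt] => z Uz;
      exact: nabla_tension.
  - by move=> b; apply: W_derive.
  - by move=> b; apply: tan_W.
  - move=> c; have /= [_ [D1 [D2 _]]] := Hsm i c s t Vst 1%N.
    by split.
have [EY ET] := frame_vpd F Ust.
have dphiE i : dphi X (e i) s t = (e i s t i2s ord0 *: Y s t + e i s t i2t ord0 *: T s t)%mc.
  by rewrite /dphi sum2 EY ET.
have curv i : curvN L (X s t) (dphi X (e i) s t) (tension L g X s t) (dphi X (e i) s t) =
   ((((e i s t i2s ord0) ^ 2 - rho s ^ 2 * (e i s t i2t ord0) ^ 2) / L ^ 2 * h s)%R *: xi s t)%mc.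
  have Td : ip (dphi X (e i) s t) (X s t) = 0.
    by rewrite dphiE !ip_lin tan_Y // tan_T //; ring.
  have Tt : ip (tension L g X s t) (X s t) = 0.
    by rewrite tension_eq // !ip_lin tan_xi //; ring.
  rewrite curvN_eq //; rewrite dphiE tension_eq // !ip_lin (ipC (Y s t) (T s t))
    (ipC _ (xi s t)) (ipC _ (xi s t)).
  rewrite (fr_YY F Ust) (fr_TT F Ust) (fr_TY F Ust) (fr_xiY F Ust) (fr_xiT F Ust).
  by apply: vecP => j; rewrite !vE; field.
(* [Z] is kept abstract so that coordinates are taken of it as a whole. *)
have [Z EZ] : exists Z : 'I_2 -> 'I_2 -> 'cV[R]_4, forall a b, Z a b =
    (tproj L (X s t) (D a b s t) - \sum_(c < 2) christoffel g c a b s t *: W c s t)%mc.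
  by eexists.
have Zss : Z i2s i2s = ((ddh s - h s * k1 s ^ 2 - dmu s / (2 * mu s) * dh s)%R *: xi s t
    + (- (2 * dh s * k1 s + h s * dk1 s) + dmu s / (2 * mu s) * h s * k1 s)%R *: Y s t)%mc.
  rewrite EZ sum2 G1 G2 /D /W !selE !(tprojD, tprojZ).
  rewrite (tproj_tan L (tan_xi Ust)) (tproj_tan L (tan_Y Ust)) (tproj_self HL XX).
  by apply: vecP => j; rewrite !vE; ring.
have Ztt : Z i2t i2t = ((rho s ^ 2 * (h s * k2 s ^ 2 - (dmu s / (2 * mu s) + q s) * dh s))%R *: xi s t
    + (rho s ^ 2 * (- h s * k2 s * q s + (dmu s / (2 * mu s) + q s) * h s * k1 s))%R *: Y s t)%mc.
  rewrite EZ sum2 G3 G4 /D /W !selE !(tprojD, tprojZ).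
  rewrite (tproj_tan L (tan_xi Ust)) (tproj_tan L (tan_Y Ust)) (tproj_self HL XX).
  by apply: vecP => j; rewrite !vE; ring.
have lapZ i : (nabla_phi L X (e i) (nabla_phi L X (e i) (tension L g X)) s t
   - nabla_phi L X (nablaM g (e i) (e i)) (tension L g X) s t)%mc =
  (\sum_(a < 2) \sum_(b < 2) (e i s t a ord0 * e i s t b ord0)%R *: Z a b)%mc.
  by rewrite lap; apply: eq_bigr => a _; apply: eq_bigr => b _; rewrite EZ.
rewrite /bitension /laplacian !sum2 !lapZ !curv !sum2.
apply: vecP => j; rewrite !vE.
pose c a b := eps i2s * e i2s s t a ord0 * e i2s s t b ord0
            + eps i2t * e i2t s t a ord0 * e i2t s t b ord0.
transitivity (c i2s i2s * Z i2s i2s j ord0 + c i2s i2t * Z i2s i2t j ord0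
  + c i2t i2s * Z i2t i2s j ord0 + c i2t i2t * Z i2t i2t j ord0
  - (c i2s i2s - rho s ^ 2 * c i2t i2t) / L ^ 2 * h s * xi s t j ord0).
  by rewrite /c; rewrite /Rdiv; ring.
rewrite /c !CP !dmx2E Zss Ztt !vE.
have N := normal_eq Ust; have T' := tangent_eq Ust.
transitivity ((ddh s + q s * dh s - (k1 s ^ 2 + k2 s ^ 2) * h s - 2 / L ^ 2 * h s)
    / mu s * xi s t j ord0
  - (2 * dh s * k1 s + h s * dk1 s + h s * q s * (k1 s - k2 s)) / mu s * Y s t j ord0).
  by field.
by rewrite N T' /Rdiv; ring.
Qed.

End Bitension.

(** * Rigidity *)

Lemma sum4 (V : zmodType) (F : 'I_4 -> V) :
  (\sum_(j < 4) F j = F (i4 0) + F (i4 1) + F (i4 2) + F (i4 3))%mc.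
Proof.
have E (k : 'I_4) j : val k = j -> k = i4 j by move=> <-; rewrite /i4 inord_val.
rewrite !big_ord_recl big_ord0 GRing.addr0 -!GRing.addrA.
by rewrite -(E (lift ord0 (lift ord0 (lift ord0 ord0))) 3%N) //
  -(E (lift ord0 (lift ord0 ord0)) 2%N) // -(E (lift ord0 ord0) 1%N) // -(E ord0 0%N).
Qed.

Lemma nth4E (A : Type) (x0 a b c d : A) :
  (nth x0 [:: a; b; c; d] (i4 0) = a) * (nth x0 [:: a; b; c; d] (i4 1) = b) *
  (nth x0 [:: a; b; c; d] (i4 2) = c) * (nth x0 [:: a; b; c; d] (i4 3) = d).
Proof. by rewrite /i4 !inordK. Qed.

Lemma i4_eq j k : (j < 4)%N -> (k < 4)%N -> (i4 j == i4 k) = (j == k).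
Proof. by move=> Hj Hk; rewrite -val_eqE /= !inordK. Qed.

(** The matrix of the dual basis of an orthogonal basis [F] with squares [d]. *)
Definition ortho_coord (F : 'I_4 -> 'cV[R]_4) (d : 'I_4 -> R) : 'M[R]_4 :=
  \matrix_(j, i) (/ d j * ((if (i < 2)%N then -1 else 1) * F j i ord0))%mc.

Lemma ortho_coordE F d v j : (ortho_coord F d *m v)%mc j ord0 = / d j * ip (F j) v.
Proof.
rewrite mxE /ip big_distrr /=; apply: eq_bigr => i _.
by rewrite mxE -!RmultE !Rmult_assoc.
Qed.

Definition comb (F : 'I_4 -> 'cV[R]_4) : 'M[R]_4 := \matrix_(i, j) F j i ord0.

Lemma combE F (c : 'cV[R]_4) : (comb F *m c)%mc = (\sum_(j < 4) c j ord0 *: F j)%mc.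
Proof.
apply: vecP => i; rewrite mxE summxE; apply: eq_bigr => j _.
by rewrite !mxE GRing.mulrC.
Qed.

Lemma ortho_expand F d v : (forall j, d j <> 0) ->
  (forall j k, ip (F j) (F k) = if j == k then d j else 0) ->
  v = (\sum_(j < 4) (/ d j * ip (F j) v)%R *: F j)%mc.
Proof.
move=> Hd HF.
have E : (ortho_coord F d *m comb F)%mc = 1%:M%mc.
  apply/matrixP => j k.
  have -> : (ortho_coord F d *m comb F)%mc j k = / d j * ip (F j) (F k).
    by rewrite -ortho_coordE !mxE; apply: eq_bigr => i _; rewrite !mxE.
  by rewrite HF mxE; case: eqP => _; [rewrite Rinv_l | rewrite Rmult_0_r].
have E' := mulmx1C E.
rewrite -{1}(mul1mx v) -E' -mulmxA combE; apply: eq_bigr => j _.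
by rewrite ortho_coordE.
Qed.

Section Rigidity.
Variables (L : R) (U : R -> R -> Prop) (k1 k2 q rho : R -> R).
Hypothesis HL : L <> 0.
Hypothesis Hrho : forall s t, U s t -> is_derive rho s (q s * rho s) /\ rho s <> 0.

Lemma gram_expand (X Y T xi : 'cV[R]_4) r v : r <> 0 ->
  ip X X = - L ^ 2 -> ip Y X = 0 -> ip T X = 0 -> ip xi X = 0 -> ip Y Y = 1 ->
  ip T Y = 0 -> ip xi Y = 0 -> ip T T = - r ^ 2 -> ip xi T = 0 -> ip xi xi = 1 ->
  v = ((- / L ^ 2 * ip X v)%R *: X + ip Y v *: Y + (- / r ^ 2 * ip T v)%R *: T
       + ip xi v *: xi)%mc.
Proof.
move=> r0 XX YX TX NX YY TY NY TT NT NN.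
have L2 : L ^ 2 <> 0 by apply: pow_nonzero.
have r2 : r ^ 2 <> 0 by apply: pow_nonzero.
pose F (j : 'I_4) := nth X [:: X; Y; T; xi] j.
pose d (j : 'I_4) := nth 0 [:: - L ^ 2; 1; - r ^ 2; 1] j.
rewrite {1}(@ortho_expand F d v).
- rewrite sum4 /F /d !nth4E; apply: vecP => i; rewrite !vE; field; lra.
- by apply: forall4; rewrite /d nth4E; lra.
- by apply: forall4; apply: forall4; rewrite i4_eq // /F /d !nth4E /=;
    first [done | by rewrite ipC].
Qed.

Lemma frame_expand X Y T xi s t v : adapted_frame L U k1 k2 q rho X Y T xi -> U s t ->
  v = ((- / L ^ 2 * ip (X s t) v)%R *: X s t + ip (Y s t) v *: Y s t
       + (- / rho s ^ 2 * ip (T s t) v)%R *: T s t + ip (xi s t) v *: xi s t)%mc.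
Proof.
move=> F Ust; have [_ r0] := Hrho Ust.
by case: F => *; apply: gram_expand; auto.
Qed.

(** The linear map that sends one frame to the other at the point [(s, t)]. *)
Definition transfer (X Y T xi X' Y' T' xi' : R -> R -> 'cV[R]_4) (s t : R)
    (v : 'cV[R]_4) : 'cV[R]_4 :=
  ((- / L ^ 2 * ip (X s t) v)%R *: X' s t + ip (Y s t) v *: Y' s t
   + (- / rho s ^ 2 * ip (T s t) v)%R *: T' s t + ip (xi s t) v *: xi' s t)%mc.

Variables (X Y T xi X' Y' T' xi' : R -> R -> 'cV[R]_4).
Hypothesis F : adapted_frame L U k1 k2 q rho X Y T xi.
Hypothesis F' : adapted_frame L U k1 k2 q rho X' Y' T' xi'.

(** Both frames solve the same linear system, whose matrices are skew for the
    common Gram matrix. *)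
Lemma transfer_const s t v : U s t ->
  is_vderive (fun z => transfer X Y T xi X' Y' T' xi' z t v) s 0%mc /\
  is_vderive (fun z => transfer X Y T xi X' Y' T' xi' s z v) t 0%mc.
Proof.
move=> Ust; have [Dr r0] := Hrho Ust.
have L2 : L ^ 2 <> 0 by apply: pow_nonzero.
have Dv x := vderive_const v x.
have Dir : is_derive (fun z => - / rho z ^ 2) s (2 * q s / rho s ^ 2).
  auto_derive; first by split; [eexists; eassumption | split=> //; nra].
  by rewrite (is_derive_unique _ _ _ Dr); field.
split.
- have A1 := vderive_scale (is_derive_scal _ _ (- / L ^ 2) _ (is_derive_ip (fr_Xs F Ust) (Dv s))) (fr_Xs F' Ust).
  have A2 := vderive_scale (is_derive_ip (fr_Ys F Ust) (Dv s)) (fr_Ys F' Ust).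
  have A3 := vderive_scale (is_derive_mult _ _ _ _ _ Dir (is_derive_ip (fr_Ts F Ust) (Dv s)) Rmult_comm) (fr_Ts F' Ust).
  have A4 := vderive_scale (is_derive_ip (fr_xis F Ust) (Dv s)) (fr_xis F' Ust).
  apply: vderive_ext_val (vderive_add (vderive_add (vderive_add A1 A2) A3) A4).
  by apply: vecP => i; rewrite !vE !ip_lin /plus /mult /=; field.
- have A1 := vderive_scale (is_derive_scal _ _ (- / L ^ 2) _ (is_derive_ip (fr_Xt F Ust) (Dv t))) (fr_Xt F' Ust).
  have A2 := vderive_scale (is_derive_ip (fr_Yt F Ust) (Dv t)) (fr_Yt F' Ust).
  have A3 := vderive_scale (is_derive_scal _ _ (- / rho s ^ 2) _ (is_derive_ip (fr_Tt F Ust) (Dv t))) (fr_Tt F' Ust).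
  have A4 := vderive_scale (is_derive_ip (fr_xit F Ust) (Dv t)) (fr_xit F' Ust).
  apply: vderive_ext_val (vderive_add (vderive_add (vderive_add A1 A2) A3) A4).
  by apply: vecP => i; rewrite !vE !ip_lin /plus /mult /=; field.
Qed.

End Rigidity.

Lemma box_const d a b (V : R -> R -> 'cV[R]_4) :
  (forall s t, box d a b s t -> is_vderive (fun z => V z t) s 0%mc /\ is_vderive (V s) t 0%mc) ->
  forall s t, box d a b s t -> V s t = V 0 ((a + b) / 2).
Proof.
move=> HV s t [Hs Ht]; apply: vecP => i.
have Hd : 0 < d by apply: Rle_lt_trans (Rabs_pos s) Hs.
have H0 : Rabs 0 < d by rewrite Rabs_R0.
transitivity (V 0 t i ord0).
  apply: (@zero_derive_const (fun z => V z t i ord0) d) => // z Hz.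
  have [D _] := HV z t (conj Hz Ht); have := D i; by rewrite v0.
have shift (y : R) : (a + b) / 2 + (y - (a + b) / 2) = y by ring.
have := @zero_derive_const (fun z => V 0 ((a + b) / 2 + z) i ord0) ((b - a) / 2) _ (t - (a + b) / 2).
rewrite /= shift Rplus_0_r; apply.
  move=> z /Rabs_def2 Hz.
  have Hb : box d a b 0 ((a + b) / 2 + z) by split=> //; lra.
  have [_ D] := HV _ _ Hb; have := D i; rewrite v0 => Di.
  have D1 : is_derive (fun z => (a + b) / 2 + z) z 1 by auto_derive.
  have := is_derive_comp (fun y => V 0 y i ord0) (fun z => (a + b) / 2 + z) z _ _ Di D1.
  by rewrite /scal /= /mult /= Rmult_0_r.
by apply: Rabs_def1; lra.
Qed.

Lemma box_rows d a b : open_rows (box d a b).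
Proof.
move=> s t [Hs Ht]; split.
  by apply: filter_imp (ball0_locally Hs) => z Hz; split.
have He : 0 < Rmin (t - a) (b - t) by apply: Rmin_glb_lt; lra.
apply: (locally_Rabs He) => z /Rabs_def2 Hz.
have := Rmin_l (t - a) (b - t); have := Rmin_r (t - a) (b - t).
by split=> //; lra.
Qed.

Section Congruence.
Variables (L d a b : R) (k1 k2 q rho : R -> R).
Hypothesis HL : L <> 0.
Hypothesis Hd : 0 < d.
Hypothesis Hab : a < b.
Hypothesis Hrho : forall s t, box d a b s t ->
  is_derive rho s (q s * rho s) /\ rho s <> 0.
Variables (X Y T xi X' Y' T' xi' : R -> R -> 'cV[R]_4).
Hypothesis F : adapted_frame L (box d a b) k1 k2 q rho X Y T xi.
Hypothesis F' : adapted_frame L (box d a b) k1 k2 q rho X' Y' T' xi'.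

Lemma frames_congruent : exists Q : 'M[R]_4, linear_isometry Q /\
  forall s t, box d a b s t ->
    X' s t = (Q *m X s t)%mc /\ xi' s t = (Q *m xi s t)%mc.
Proof.
pose t0 := (a + b) / 2.
have U0 : box d a b 0 t0 by split; rewrite ?Rabs_R0 // /t0; lra.
pose G := transfer L rho X Y T xi X' Y' T' xi'.
have Gc s t v : box d a b s t -> G s t v = G 0 t0 v.
  by move=> Ust; apply: (box_const (V := fun s t => G s t v)) Ust => x y Hxy;
    apply: (transfer_const HL Hrho F F').
pose Q : 'M[R]_4 := \matrix_(i, j) G 0 t0 (delta_mx j ord0) i ord0.
have QE v : (Q *m v)%mc = G 0 t0 v.
  apply: vecP => i; rewrite mxE.
  have basis : v = (\sum_(j < 4) v j ord0 *: delta_mx j ord0)%mc.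
    by rewrite {1}(matrix_sum_delta v); apply: eq_bigr => j _; rewrite big_ord1; congr (v _ _ *: delta_mx _ _)%mc.
  have QI j : Q i j = G 0 t0 (delta_mx j ord0) i ord0 by rewrite mxE.
  rewrite [in RHS]basis !sum4 !QI -!RplusE -!RmultE.
  move: (delta_mx (i4 0) ord0) (delta_mx (i4 1) ord0) (delta_mx (i4 2) ord0)
    (delta_mx (i4 3) ord0) => e0 e1 e2 e3.
  by rewrite /G /transfer !vE !ip_lin; ring.
exists Q; split.
  move=> x y; rewrite !QE {2}(frame_expand HL Hrho y F U0) /G /transfer !ip_lin.
  rewrite !(ipC (X' 0 t0) (Y' 0 t0)) !(ipC (X' 0 t0) (T' 0 t0)) !(ipC (X' 0 t0) (xi' 0 t0))
    !(ipC (Y' 0 t0) (T' 0 t0)) !(ipC (Y' 0 t0) (xi' 0 t0)) !(ipC (T' 0 t0) (xi' 0 t0)).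
  rewrite (fr_XX F' U0) (fr_YY F' U0) (fr_TT F' U0) (fr_xixi F' U0) (fr_YX F' U0)
    (fr_TX F' U0) (fr_xiX F' U0) (fr_TY F' U0) (fr_xiY F' U0) (fr_xiT F' U0).
  rewrite !(ipC x); have [_ r0] := Hrho U0.
  by field; split.
move=> s t Ust; have [_ r0] := Hrho Ust.
split; rewrite QE -(Gc s t) // /G /transfer.
- rewrite (fr_XX F Ust) (fr_YX F Ust) (fr_TX F Ust) (fr_xiX F Ust).
  by apply: vecP => i; rewrite !vE; symmetry; field.
- rewrite !(ipC _ (xi s t)) (fr_xiX F Ust) (fr_xiY F Ust) (fr_xiT F Ust) (fr_xixi F Ust).
  by apply: vecP => i; rewrite !vE; symmetry; field.
Qed.

End Congruence.

(** The Gauss-Weingarten equations follow from the metric and the shape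
    operator, by differentiating the Gram relations and expanding in the frame. *)
Lemma determined_frame L th rho0 U X xi : L <> 0 -> open_rows U ->
  (forall s t, U s t -> is_derive (rho L th rho0) s (cos (th s) / L * rho L th rho0 s)
                        /\ rho L th rho0 s <> 0) ->
  determined_by L th rho0 U X xi ->
  adapted_frame L U (k1 L th) (k2 L th) (fun s => cos (th s) / L) (rho L th rho0)
    X (vpd i2s X) (vpd i2t X) xi.
Proof.
move=> HL HU Hr [AX Axi Hads _ Hmet Hnor Hsh _].
have L2 : L ^ 2 <> 0 by apply: pow_nonzero.
set k1 := Defs.k1 L th; set k2 := Defs.k2 L th; set q := fun s => cos (th s) / L.
set r := rho L th rho0; set Y := vpd i2s X; set T := vpd i2t X.
(* Analyticity provides the second derivatives, and equates the mixed ones. *)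
have dX s t : U s t -> is_vderive (fun z => X z t) s (Y s t) /\ is_vderive (X s) t (T s t).
  move=> Ust; split=> i; rewrite /Y /T mxE;
    have [E1 [E2 _]] := analytic2_partials (AX i) Ust; exact: Derive_correct.
have dxi s t : U s t -> is_vderive (fun z => xi z t) s (vpd i2s xi s t) /\
    is_vderive (xi s) t (vpd i2t xi s t).
  move=> Ust; split=> i; rewrite mxE;
    have [E1 [E2 _]] := analytic2_partials (Axi i) Ust; exact: Derive_correct.
have dY s t : U s t -> is_vderive (fun z => Y z t) s (vpd i2s Y s t) /\
    is_vderive (T s) t (vpd i2t T s t).
  move=> Ust; split=> i; have [_ [_ [E1 [E2 _]]]] := analytic2_partials (AX i) Ust.
    rewrite mxE pd_s; apply: Derive_correct; apply: ex_derive_ext E1 => z; by rewrite mxE.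
  rewrite mxE pd_t; apply: Derive_correct; apply: ex_derive_ext E2 => z; by rewrite mxE.
have dM s t : U s t -> is_vderive (fun z => T z t) s (vpd i2s T s t) /\
    is_vderive (Y s) t (vpd i2s T s t).
  move=> Ust; split=> i; have [_ [_ [_ [_ [m [E1 E2]]]]]] := analytic2_partials (AX i) Ust.
    rewrite mxE pd_s; apply: Derive_correct; exists m.
    by apply: is_derive_ext E1 => z; rewrite mxE.
  have -> : vpd i2s T s t i ord0 = m.
    rewrite mxE pd_s; apply: is_derive_unique.
    by apply: is_derive_ext E1 => z; rewrite mxE.
  by apply: is_derive_ext E2 => z; rewrite mxE.
have XX s t : U s t -> ip (X s t) (X s t) = - L ^ 2 by apply: Hads.
have met s t a b : U s t -> ip (vpd a X s t) (vpd b X s t) = dmx2 1 (- r s ^ 2) a b.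
  by move=> Ust; have := Hmet s t Ust => /matrixP /(_ a b); rewrite mxE.
have YY s t : U s t -> ip (Y s t) (Y s t) = 1 by move=> Ust; rewrite met ?dmx2E.
have TY s t : U s t -> ip (T s t) (Y s t) = 0 by move=> Ust; rewrite met ?dmx2E.
have TT s t : U s t -> ip (T s t) (T s t) = - r s ^ 2 by move=> Ust; rewrite met ?dmx2E.
have NN s t : U s t -> ip (xi s t) (xi s t) = 1 by case/Hnor.
have NX s t : U s t -> ip (xi s t) (X s t) = 0 by case/Hnor => _ [].
have NY s t : U s t -> ip (xi s t) (Y s t) = 0 by case/Hnor => _ [_]; apply.
have NT s t : U s t -> ip (xi s t) (T s t) = 0 by case/Hnor => _ [_]; apply.
(* The Gram relations hold on an open set, so they may be differentiated. *)
have Gs (f g : R -> R -> 'cV[R]_4) (c : R -> R) f' g' c' s t : U s t ->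
    is_vderive (fun z => f z t) s f' -> is_vderive (fun z => g z t) s g' ->
    (forall s t, U s t -> ip (f s t) (g s t) = c s) -> is_derive c s c' ->
    ip f' (g s t) + ip (f s t) g' = c'.
  move=> Ust Df Dg E Dc; have [Ls _] := HU s t Ust.
  rewrite -(is_derive_unique _ _ _ (is_derive_ip Df Dg)) -(is_derive_unique _ _ _ Dc).
  by apply: Derive_ext_loc; apply: filter_imp Ls => z Uz; apply: E.
have Gt (f g : R -> R -> 'cV[R]_4) (c : R -> R) f' g' s t : U s t ->
    is_vderive (f s) t f' -> is_vderive (g s) t g' ->
    (forall s t, U s t -> ip (f s t) (g s t) = c s) ->
    ip f' (g s t) + ip (f s t) g' = 0.
  move=> Ust Df Dg E; have [_ Lt] := HU s t Ust.
  rewrite -(is_derive_unique _ _ _ (is_derive_ip Df Dg)) -(Derive_const (c s) t).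
  by apply: Derive_ext_loc; apply: filter_imp Lt => z Uz; apply: E.
have d0 (c x : R) : is_derive (fun _ => c) x 0 := is_derive_const c x.
have YX s t : U s t -> ip (Y s t) (X s t) = 0.
  move=> Ust; have [D _] := dX s t Ust.
  by have := Gs X X _ _ _ _ s t Ust D D XX (d0 _ s); rewrite (ipC (X s t)); lra.
have TX s t : U s t -> ip (T s t) (X s t) = 0.
  move=> Ust; have [_ D] := dX s t Ust.
  by have := Gt X X (fun _ => _) _ _ s t Ust D D XX; rewrite (ipC (X s t)); lra.
have expand s t v : U s t -> v = ((- / L ^ 2 * ip (X s t) v)%R *: X s t + ip (Y s t) v *: Y s t
    + (- / r s ^ 2 * ip (T s t) v)%R *: T s t + ip (xi s t) v *: xi s t)%mc.
  by move=> Ust; have [_ r0] := Hr s t Ust; apply: gram_expand => //; auto.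
(* The shape operator only gives the part of the derivatives of [xi] that is
   tangent to AdS_3(L); the component along [X] vanishes because [xi] stays
   orthogonal to [X]. *)
have Nder s t a v : U s t -> vpd a xi s t = v -> ip v (X s t) = 0 ->
    v = (- \sum_(b < 2) (diag_mx (\row_c (if c == ord0 then k1 s else k2 s))) b a *: vpd b X s t)%mc.
  by move=> Ust Ev Hv; rewrite -(Hsh s t Ust a) /nabla_coord Ev tproj_tan.
have Nders s t : U s t -> is_vderive (fun z => xi z t) s ((- k1 s)%R *: Y s t)%mc.
  move=> Ust; have [D _] := dxi s t Ust; have [DX _] := dX s t Ust.
  have H : ip (vpd i2s xi s t) (X s t) = 0.
    by have := Gs xi X _ _ _ _ s t Ust D DX NX (d0 _ s); rewrite NY //; lra.
  apply: vderive_ext_val D; rewrite (Nder s t i2s _ Ust erefl H) sum2 !dmx2E -/Y -/T.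
  by apply: vecP => i; rewrite !vE; ring.
have Ndert s t : U s t -> is_vderive (xi s) t ((- k2 s)%R *: T s t)%mc.
  move=> Ust; have [_ D] := dxi s t Ust; have [_ DX] := dX s t Ust.
  have H : ip (vpd i2t xi s t) (X s t) = 0.
    by have := Gt xi X (fun _ => _) _ _ s t Ust D DX NX; rewrite NT //; lra.
  apply: vderive_ext_val D; rewrite (Nder s t i2t _ Ust erefl H) sum2 !dmx2E -/Y -/T.
  by apply: vecP => i; rewrite !vE; ring.
have dr2 s t : U s t -> is_derive (fun z => - r z ^ 2) s (- (2 * q s * r s ^ 2)).
  move=> Ust; have [Dr _] := Hr s t Ust.
  auto_derive; first by eexists; exact: Dr.
  by rewrite (is_derive_unique _ _ _ Dr) /q -/r; ring.
have ipY s t : U s t -> [/\ ip (X s t) (vpd i2s Y s t) = - 1, ip (Y s t) (vpd i2s Y s t) = 0,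
    ip (T s t) (vpd i2s Y s t) = 0 & ip (xi s t) (vpd i2s Y s t) = k1 s].
  move=> Ust; have [DX _] := dX s t Ust; have [DY _] := dY s t Ust.
  have [DT DM] := dM s t Ust; have DN := Nders s t Ust.
  have EX := Gs Y X _ _ _ _ s t Ust DY DX YX (d0 _ s).
  have EY := Gs Y Y _ _ _ _ s t Ust DY DY YY (d0 _ s).
  have ET := Gs T Y _ _ _ _ s t Ust DT DY TY (d0 _ s).
  have EN := Gs xi Y _ _ _ _ s t Ust DN DY NY (d0 _ s).
  have EM := Gt Y Y (fun _ => _) _ _ s t Ust DM DM YY.
  move: EX EY ET EN EM; rewrite !ip_lin !(ipC _ (X s t)) !(ipC _ (Y s t)) YY //.
  by split; lra.
have ipM s t : U s t -> [/\ ip (X s t) (vpd i2s T s t) = 0, ip (Y s t) (vpd i2s T s t) = 0,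
    ip (T s t) (vpd i2s T s t) = - q s * r s ^ 2 & ip (xi s t) (vpd i2s T s t) = 0].
  move=> Ust; have [DX _] := dX s t Ust.
  have [DT DM] := dM s t Ust; have DN := Nders s t Ust.
  have EX := Gs T X _ _ _ _ s t Ust DT DX TX (d0 _ s).
  have ET := Gs T T _ _ _ _ s t Ust DT DT TT (dr2 s t Ust).
  have EN := Gs xi T _ _ _ _ s t Ust DN DT NT (d0 _ s).
  have EM := Gt Y Y (fun _ => _) _ _ s t Ust DM DM YY.
  move: EX ET EN EM; rewrite !ip_lin !(ipC _ (X s t)) !(ipC _ (T s t)) !(ipC _ (Y s t)).
  rewrite (ipC (Y s t) (T s t)) TY //.
  by split; lra.
have ipT s t : U s t -> [/\ ip (X s t) (vpd i2t T s t) = r s ^ 2,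
    ip (Y s t) (vpd i2t T s t) = q s * r s ^ 2,
    ip (T s t) (vpd i2t T s t) = 0 & ip (xi s t) (vpd i2t T s t) = - k2 s * r s ^ 2].
  move=> Ust; have [_ DX] := dX s t Ust; have [_ DT] := dY s t Ust.
  have [_ DM] := dM s t Ust; have DN := Ndert s t Ust.
  have [_ _ EM _] := ipM s t Ust.
  have EX := Gt T X (fun _ => _) _ _ s t Ust DT DX TX.
  have EY := Gt T Y (fun _ => _) _ _ s t Ust DT DM TY.
  have ET := Gt T T _ _ _ s t Ust DT DT TT.
  have EN := Gt xi T (fun _ => _) _ _ s t Ust DN DT NT.
  move: EX EY ET EN EM; rewrite !ip_lin !(ipC (vpd i2t T s t)) TT //.
  by split; lra.
split=> s t Ust; try by [exact: XX | exact: YX | exact: TX | exact: NX | exact: YY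
  | exact: TY | exact: NY | exact: TT | exact: NT | exact: NN | exact: Nders | exact: Ndert].
- by case: (dX s t Ust).
- by case: (dX s t Ust).
- have [D _] := dY s t Ust; have [E1 E2 E3 E4] := ipY s t Ust.
  apply: vderive_ext_val D; rewrite [LHS](expand s t) // E1 E2 E3 E4.
  by apply: vecP => i; rewrite !vE; ring.
- have [_ D] := dM s t Ust; have [E1 E2 E3 E4] := ipM s t Ust; have [_ r0] := Hr s t Ust.
  apply: vderive_ext_val D; rewrite [LHS](expand s t) // E1 E2 E3 E4.
  by apply: vecP => i; rewrite !vE -/(q s) -/r; field; split.
- have [D _] := dM s t Ust; have [E1 E2 E3 E4] := ipM s t Ust; have [_ r0] := Hr s t Ust.
  apply: vderive_ext_val D; rewrite [LHS](expand s t) // E1 E2 E3 E4.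
  by apply: vecP => i; rewrite !vE -/(q s) -/r; field; split.
- have [_ D] := dY s t Ust; have [E1 E2 E3 E4] := ipT s t Ust.
  apply: vderive_ext_val D; rewrite [LHS](expand s t) // E1 E2 E3 E4.
  by apply: vecP => i; rewrite !vE -/(q s) -/r -/(k2 s); ring.
Qed.

(** * Properties of the surface *)

Lemma analytic_opp U f : analytic_on U f -> analytic_on U (fun x => - f x).
Proof.
move=> Hf; apply: (@analytic_ext U (fun x => -1 * f x)); first by move=> x; ring.
by apply: analytic_mult => //; apply: analytic_const.
Qed.

Lemma analytic_pow U f n : analytic_on U f -> analytic_on U (fun x => f x ^ n).
Proof.
move=> Hf; elim: n => [|n IH] /=; first exact: analytic_const.
exact: analytic_mult.
Qed.

Ltac analytic := unfold Rdiv, Rminus in *;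
  repeat first [ assumption | apply: analytic_const | apply: analytic_id
    | apply: analytic_plus | apply: analytic_mult | apply: analytic_opp
    | apply: analytic_pow ].

Lemma open2_box d a b : open2 (box d a b).
Proof.
move=> s t [Hs Ht].
have He : 0 < Rmin (d - Rabs s) (Rmin (t - a) (b - t)).
  by apply: Rmin_glb_lt; [lra | apply: Rmin_glb_lt; lra].
exists (mkposreal _ He) => x y /= Hx Hy.
have Hx' := Rlt_le_trans _ _ _ Hx (Rmin_l _ _).
have := Rlt_le_trans _ _ _ Hy (Rmin_r _ _) => /[dup] H1 H2.
have := Rlt_le_trans _ _ _ H1 (Rmin_l _ _); have := Rlt_le_trans _ _ _ H2 (Rmin_r _ _).
move=> /Rabs_def2 K1 /Rabs_def2 K2; split; last lra.
by rewrite -(Rminus_0_r x); apply: (@ball_sub s); rewrite Rminus_0_r.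
Qed.

Lemma smooth2_ext U f g : open2 U -> (forall s t, U s t -> f s t = g s t) ->
  smooth2_on U f -> smooth2_on U g.
Proof.
move=> HU E Hf s t Ust n; apply: ex_diff_n_ext_loc (Hf s t Ust n).
by have [e He] := HU s t Ust; exists e => x y Hx Hy; apply: E; apply: He.
Qed.

Lemma sepsum_smooth2_box d a b l :
  sep_analytic (fun s => Rabs s < d) (fun t => a < t < b) l ->
  smooth2_on (box d a b) (sepsum l).
Proof.
apply: sepsum_smooth2.
  by move=> s; apply: ball0_locally.
move=> t Ht; have He : 0 < Rmin (t - a) (b - t) by apply: Rmin_glb_lt; lra.
apply: (locally_Rabs He) => z /Rabs_def2 Hz.
have := Rmin_l (t - a) (b - t); have := Rmin_r (t - a) (b - t).
by lra.
Qed.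

Section Surface.
Variables (L d a b : R) (th k w r sg x v : R -> R).
Hypothesis HL : 0 < L.
Hypothesis Hd : 0 < d.
Hypothesis P : profile L d th k w r sg x v.

Let U := box d a b.
Let X := surfX L r sg x.
Let Y := surfY L th r sg x.
Let T := surfT L r.
Let N := surfN L th r sg x.

Let ana_r : analytic_on (fun s => Rabs s < d) r.
Proof. by apply: (pf_an P); do 3 right; left. Qed.
Let ana_sg : analytic_on (fun s => Rabs s < d) sg.
Proof. by apply: (pf_an P); do 4 right; left. Qed.
Let ana_x : analytic_on (fun s => Rabs s < d) x.
Proof. by apply: (pf_an P); do 5 right; left. Qed.
Let ana_sin : analytic_on (fun s => Rabs s < d) (fun s => sin (th s)).
Proof. by apply: (pf_an P); do 7 right; left. Qed.
Let ana_cos : analytic_on (fun s => Rabs s < d) (fun s => cos (th s)).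
Proof. by apply: (pf_an P); do 8 right; left. Qed.

Let alpha s := - (L * sg s / 2 + r s * x s ^ 2 / (2 * L)).

Lemma surf_sepsum (i : 'I_4) : exists lX lN,
  [/\ sep_analytic (fun s => Rabs s < d) (fun t => a < t < b) lX,
      sep_analytic (fun s => Rabs s < d) (fun t => a < t < b) lN,
      forall s t, sepsum lX s t = X s t i ord0 &
      forall s t, sepsum lN s t = N s t i ord0].
Proof.
move: i; apply: forall4.
- exists [:: (r, fun t => t)], [:: (fun s => - sin (th s) * (r s / L), fun t => t)].
  split; try by rewrite /=; split; [analytic | split=> //; analytic].
    by move=> s t; rewrite /X /surfX vec4E /sepsum /=; ring.
  by move=> s t; rewrite /N /surfN /surfC /surfE !vE !vec4E /sepsum /=; field; lra.
- exists [:: (fun s => alpha s - L * r s / 2, fun _ => 1); (fun s => r s / (2 * L), fun t => t ^ 2)],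
    [:: (fun s => - sin (th s) * ((alpha s - L * r s / 2) / L + sg s) + cos (th s) * (- x s / L), fun _ => 1);
        (fun s => - sin (th s) * (r s / (2 * L) / L), fun t => t ^ 2)].
  rewrite /alpha; split; try by rewrite /=; split; [analytic | split; [analytic | split; [analytic | split=> //; analytic]]].
    by move=> s t; rewrite /X /surfX /null_coord vec4E /sepsum /=; field; lra.
  by move=> s t; rewrite /N /surfN /surfC /surfE /null_coord !vE !vec4E /sepsum /=; field; lra.
- exists [:: (fun s => alpha s + L * r s / 2, fun _ => 1); (fun s => r s / (2 * L), fun t => t ^ 2)],
    [:: (fun s => - sin (th s) * ((alpha s + L * r s / 2) / L + sg s) + cos (th s) * (- x s / L), fun _ => 1);
        (fun s => - sin (th s) * (r s / (2 * L) / L), fun t => t ^ 2)].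
  rewrite /alpha; split; try by rewrite /=; split; [analytic | split; [analytic | split; [analytic | split=> //; analytic]]].
    by move=> s t; rewrite /X /surfX /null_coord vec4E /sepsum /=; field; lra.
  by move=> s t; rewrite /N /surfN /surfC /surfE /null_coord !vE !vec4E /sepsum /=; field; lra.
- exists [:: (fun s => r s * x s, fun _ => 1)],
    [:: (fun s => - sin (th s) * (r s * x s / L) + cos (th s), fun _ => 1)].
  split; try by rewrite /=; split; [analytic | split=> //; analytic].
    by move=> s t; rewrite /X /surfX vec4E /sepsum /=; ring.
  by move=> s t; rewrite /N /surfN /surfC /surfE !vE !vec4E /sepsum /=; field; lra.
Qed.

Lemma frame_sub (U' V' : R -> R -> Prop) k1 k2 q rho X' Y' T' xi' :
  (forall s t, V' s t -> U' s t) -> adapted_frame L U' k1 k2 q rho X' Y' T' xi' ->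
  adapted_frame L V' k1 k2 q rho X' Y' T' xi'.
Proof. by move=> VU [*]; split=> s t /VU; auto. Qed.

Let F : adapted_frame L U k (k2 L th) (fun s => cos (th s) / L) r X Y T N.
Proof. by apply: frame_sub (surf_frame HL P) => s t []. Qed.

(** The induced metric factors through the Jacobian. *)
Lemma immersion_of_metric (V : R -> R -> Prop) (Z : R -> R -> 'cV[R]_4) :
  (forall s t, V s t -> induced_metric Z s t \in unitmx) -> immersion V Z.
Proof.
move=> HV s t /HV Hu; apply/eqP; rewrite eqn_leq rank_leq_col /=.
pose M : 'M[R]_(2, 4) :=
  \matrix_(c, i) ((if (i < 2)%N then -1 else 1) * vpd c Z s t i ord0)%mc.
have E : (invmx (induced_metric Z s t) *m M *m jacobian Z s t)%mc = 1%:M%mc.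
  rewrite -mulmxA; have -> : (M *m jacobian Z s t)%mc = induced_metric Z s t.
    by apply/matrixP => c e; rewrite !mxE /ip; apply: eq_bigr => i _; rewrite !mxE.
  exact: mulVmx.
by rewrite -{1}(mxrank1 R 2) -E; apply: mxrankM_maxr.
Qed.

Let Hr s t : U s t -> is_derive r s (cos (th s) / L * r s) /\ r s <> 0.
Proof. by move=> [Hs _]; split; [exact (pf_r P Hs) | exact (profile_r_neq0 P Hs)]. Qed.

Lemma surf_determined : determined_by L th (r 0) U X N.
Proof.
have HL0 : L <> 0 by lra.
have Eind s t : U s t -> induced_metric X s t = dmx2 1 (- r s ^ 2).
  move=> Ust; have [EY ET] := frame_vpd F Ust.
  apply: mat2P; rewrite mxE !dmx2E ?EY ?ET.
  - exact (fr_YY F Ust).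
  - by rewrite ipC; exact (fr_TY F Ust).
  - exact (fr_TY F Ust).
  - exact (fr_TT F Ust).
have Erho s : Rabs s < d -> rho L th (r 0) s = r s by move=> Hs; exact (profile_rho HL Hd P Hs).
split.
- move=> i; have [lX [lN [A1 A2 E1 E2]]] := surf_sepsum i.
  by apply: analytic2_ext E1 _; apply: sepsum_analytic2.
- move=> i; have [lX [lN [A1 A2 E1 E2]]] := surf_sepsum i.
  by apply: analytic2_ext E2 _; apply: sepsum_analytic2.
- by move=> s t Ust; exact (fr_XX F Ust).
- apply: immersion_of_metric => s t Ust; rewrite Eind //.
  have [_ r0] := Hr Ust; have := pow_nonzero _ 2 r0 => r2.
  by have [] := @dmx2_inv 1 (- r s ^ 2) _ _; [lra | lra |].
- by move=> s t Ust; rewrite Eind // /profile_metric Erho //; case: Ust.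
- move=> s t Ust; have [EY ET] := frame_vpd F Ust.
  split; first exact (fr_xixi F Ust).
  split; first exact (fr_xiX F Ust).
  by apply: forall2; rewrite ?EY ?ET; [exact (fr_xiY F Ust) | exact (fr_xiT F Ust)].
- move=> s t Ust; have [EY ET] := frame_vpd F Ust.
  have Ek : k1 L th s = k s by case: Ust => Hs _; apply: (profile_k1 P).
  apply: forall2; rewrite sum2 EY ET !dmx2E /nabla_coord.
    rewrite (vpd_s (fr_xis F Ust)) tprojZ (tproj_tan L (fr_YX F Ust)) Ek.
    by apply: vecP => i; rewrite !vE; ring.
  rewrite (vpd_t (fr_xit F Ust)) tprojZ (tproj_tan L (fr_TX F Ust)).
  by apply: vecP => i; rewrite !vE; ring.
- move=> s t Ust.
  have Hg s' t' : U s' t' -> profile_metric (rho L th (r 0)) s' t' =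
      dmx2 1 (- (1 * r s' ^ 2)).
    by move=> [Hs _]; rewrite /profile_metric Erho // Rmult_1_l.
  have Hone s' t' : U s' t' -> is_derive (fun _ => 1) s' 0 /\ 1 <> 0 :> R.
    by move=> _; split; [apply: is_derive_const | lra].
  rewrite /mean_curvature_vector (frame_tension HL0 (@box_rows d a b) F Hg Hone Hr Ust).
  have [Hs _] := Ust; rewrite (profile_meanH HL P Hs).
  by apply: vecP => i; rewrite !vE; field.
Qed.

End Surface.

(** In the basis [e0, n, m, f] of [surfX]: [m |-> e0 / L], [e0 |-> n / L],
    [n, f |-> 0]. *)
Definition rot_gen (L : R) : 'M[R]_4 := \matrix_(i, j)
  (nth 0 (nth [::] [:: [:: 0; - / L; / L; 0]; [:: / L; 0; 0; 0]; [:: / L; 0; 0; 0];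
                       [:: 0; 0; 0; 0]] i) j)%R.

Lemma mul4E m p (A : 'M[R]_(m, 4)) (B : 'M[R]_(4, p)) i j :
  (A *m B)%mc i j = A i (i4 0) * B (i4 0) j + A i (i4 1) * B (i4 1) j
    + A i (i4 2) * B (i4 2) j + A i (i4 3) * B (i4 3) j.
Proof. by rewrite mxE sum4 -!RplusE. Qed.

Lemma rot_genE L (v : 'cV[R]_4) : (rot_gen L *m v)%mc =
  vec4 ((v (i4 2) ord0 - v (i4 1) ord0) / L) (v (i4 0) ord0 / L) (v (i4 0) ord0 / L) 0.
Proof.
have E i j : rot_gen L i j = nth 0 (nth [::] [:: [:: 0; - / L; / L; 0]; [:: / L; 0; 0; 0];
    [:: / L; 0; 0; 0]; [:: 0; 0; 0; 0]] i) j by rewrite mxE.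
by apply: vecP; apply: forall4; rewrite mul4E !E !nth4E vec4E; rewrite /Rdiv; ring.
Qed.

Lemma mx_vec_eq0 (A : 'M[R]_4) : (forall v : 'cV[R]_4, (A *m v)%mc = 0%mc) -> A = 0%mc.
Proof.
move=> H; apply/matrixP => i j; have := H (delta_mx j ord0).
by rewrite -colE => /colP /(_ i); rewrite !mxE.
Qed.

(** Upper bound: a factorization through a plane; lower bound: a submatrix of rank two. *)
Lemma rot_gen_rank L : L <> 0 -> \rank (rot_gen L) = 2%N.
Proof.
move=> HL; apply/eqP; rewrite eqn_leq; apply/andP; split.
  pose C : 'M[R]_(4, 2) := \matrix_(i, a)
    (nth 0 (nth [::] [:: [:: 1; 0]; [:: 0; 1]; [:: 0; 1]; [:: 0; 0]] i) a)%R.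
  pose D : 'M[R]_(2, 4) := \matrix_(a, j)
    (nth 0 (nth [::] [:: [:: 0; - / L; / L; 0]; [:: / L; 0; 0; 0]] a) j)%R.
  suff -> : rot_gen L = (C *m D)%mc by exact: mulmx_max_rank.
  apply/matrixP; apply: forall4; apply: forall4; rewrite mulmx2E !mxE !nth4E /=;
    rewrite ?nth4E /=; ring.
pose Pl : 'M[R]_(2, 4) := \matrix_(a, i) (nth 0 (nth [::] [:: [:: 1; 0; 0; 0]; [:: 0; 1; 0; 0]] a) i)%R.
pose Q : 'M[R]_(4, 2) := \matrix_(i, a)
  (nth 0 (nth [::] [:: [:: 0; L]; [:: 0; 0]; [:: L; 0]; [:: 0; 0]] i) a)%R.
have E : (Pl *m rot_gen L *m Q)%mc = 1%:M%mc.
  have E1 i j : (1%:M : 'M[R]_2)%mc i j = if i == j then 1 else 0.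
    by rewrite mxE; case: eqP.
  by apply: mat2P; rewrite E1 mul4E !mul4E !mxE !nth4E /=; rewrite ?nth4E /=; field.
rewrite -{1}(mxrank1 R 2) -E -mulmxA.
apply: leq_trans (mxrankM_maxr _ _) _; exact: mxrankM_maxl.
Qed.

Lemma rot_gen_nilpotent L : L <> 0 ->
  (rot_gen L *m rot_gen L *m rot_gen L)%mc = 0%mc /\ (rot_gen L *m rot_gen L)%mc <> 0%mc.
Proof.
move=> HL; split.
  apply: mx_vec_eq0 => u; rewrite -!mulmxA !rot_genE !vec4E.
  by apply: vecP; apply: forall4; rewrite vec4E v0; field.
move=> E; have : (rot_gen L *m rot_gen L *m vec4 0 0 1 0)%mc (i4 1) ord0 = 0.
  by rewrite E mul0mx v0.
rewrite -mulmxA !rot_genE !vec4E /Rdiv => Z.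
have := Rinv_neq_0_compat _ HL; move: (/ L) Z => l; nra.
Qed.

Lemma rot_gen_skew L : skew_adjoint (rot_gen L).
Proof. by move=> x y; rewrite !rot_genE !ipE !vec4E; rewrite /Rdiv; ring. Qed.

Section Biharmonic.
Variables (L d : R) (a b : R) (th k w r sg x v : R -> R).
Hypothesis HL : 0 < L.
Hypothesis Hd : 0 < d.
Hypothesis Hab : a < 0 < b.
Hypothesis P : profile L d th k w r sg x v.
Hypothesis Hk : forall s, Rabs s < d -> k s <> 0.
Hypothesis HH : forall s, Rabs s < d -> meanH L th s <> 0.
Hypothesis Hv : forall s, Rabs s < d -> v s <> 0.

Let U := box d a b.
Let X := surfX L r sg x.
Let Y := surfY L th r sg x.
Let T := surfT L r.
Let N := surfN L th r sg x.

Let F : adapted_frame L U k (k2 L th) (fun s => cos (th s) / L) r X Y T N.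
Proof. by apply: frame_sub (surf_frame HL P) => s t []. Qed.

Let Hr s t : U s t -> is_derive r s (cos (th s) / L * r s) /\ r s <> 0.
Proof. by move=> [Hs _]; split; [exact (pf_r P Hs) | exact (profile_r_neq0 P Hs)]. Qed.

Lemma surf_parabolic : parabolic_rotational U X.
Proof.
have HL0 : L <> 0 by lra.
exists (rot_gen L); split; first exact: rot_gen_skew.
split; first exact: rot_gen_rank.
have [E1 E2] := rot_gen_nilpotent HL0; do 2 (split=> //).
move=> s t Ust; have [_ ->] := frame_vpd F Ust.
rewrite rot_genE /X /surfX /T /surfT !vec4E.
by congr vec4; field.
Qed.

Lemma surf_timelike : timelike U X.
Proof.
move=> s t Ust; have [_ r0] := Hr Ust.
have -> : induced_metric X s t = dmx2 1 (- r s ^ 2).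
  have [Hs _] := Ust.
  have D := surf_determined a b HL Hd P.
  by rewrite (det_metric D Ust) /profile_metric (profile_rho HL Hd P Hs).
have r1 : / r s <> 0 by apply: Rinv_neq_0_compat.
exists (dmx2 1 (/ r s)); split; first by have [] := dmx2_inv R1_neq_R0 r1.
change (diag_mx _) with (dmx2 1 (- 1)).
have tr p q i j : (dmx2 p q)^T%mc i j = dmx2 p q j i by rewrite mxE.
by apply: mat2P; rewrite !mulmx2E !tr !dmx2E; field.
Qed.

Variable lambda : R -> R.
Hypothesis Hlam : forall s, Rabs s < d -> / lambda s ^ 2 = meanH L th s * v s.

Let mu s := (k s + k2 L th s) / 2 * v s.
Let g := conformal_metric lambda (rho L th (r 0)).

Let mu_meanH s : Rabs s < d -> mu s = meanH L th s * v s.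
Proof. by move=> Hs; rewrite (profile_meanH HL P Hs). Qed.

Let mu_neq0 s : Rabs s < d -> mu s <> 0.
Proof.
by move=> Hs; rewrite mu_meanH //; apply: Rmult_integral_contrapositive_currified;
  [exact: HH | exact: Hv].
Qed.

Let g_dmx2 s t : U s t -> g s t = dmx2 (mu s) (- (mu s * r s ^ 2)).
Proof.
move=> [Hs _]; rewrite mu_meanH // -Hlam // /g /conformal_metric /profile_metric.
rewrite (profile_rho HL Hd P Hs) -/(dmx2 _ _).
by apply: mat2P; rewrite !vE !dmx2E; ring.
Qed.

Let dk s := - 2 * w s * k s - cos (th s) / L * (k s - sin (th s) / L).
Let dk2 s := cos (th s) / L * (k s - sin (th s) / L).
Let dw s := k s ^ 2 + sin (th s) ^ 2 / L ^ 2 + 2 / L ^ 2 - w s ^ 2 - cos (th s) / L * w s.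

Let D_k s (Hs : Rabs s < d) : is_derive k s (dk s) := proj1 (proj2 (pf_flow P Hs)).
Let D_w s (Hs : Rabs s < d) : is_derive w s (dw s) := proj2 (proj2 (pf_flow P Hs)).
Let D_k2 s (Hs : Rabs s < d) : is_derive (k2 L th) s (dk2 s).
Proof. exact: is_derive_sin_comp (proj1 (pf_flow P Hs)). Qed.

(** This is [2 u], written with [v = 1 / u]; the derivatives come from
    [u' = w u]. *)
Let h s := 2 / v s.
Let dh s := w s * h s.
Let ddh s := dw s * h s + w s * dh s.

Let D_h s : Rabs s < d -> is_derive h s (dh s).
Proof.
move=> Hs; have Dv := pf_v P Hs; have v0 := Hv Hs.
rewrite /h /dh; auto_derive; first by split; [eexists; exact: Dv | ].
by rewrite (is_derive_unique _ _ _ Dv) /h; field.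
Qed.

Let D_mu s : Rabs s < d ->
  is_derive mu s ((dk s + dk2 s) / 2 * v s + (k s + k2 L th s) / 2 * (- w s * v s)).
Proof.
move=> Hs; apply: is_derive_mult (pf_v P Hs) Rmult_comm.
by apply: is_derive_div_const; apply: is_derive_plus; [exact: D_k | exact: D_k2].
Qed.

Let smooth_entry (f : R -> R) : analytic_on (fun s => Rabs s < d) f ->
  smooth2_on U (fun s _ => f s).
Proof.
move=> Hf; have A : sep_analytic (fun s => Rabs s < d) (fun t => a < t < b) [:: (f, fun _ => 1)].
  by split=> //; split=> //; apply: analytic_const.
apply: smooth2_ext (sepsum_smooth2_box A); first exact: open2_box.
by move=> s t _; rewrite /sepsum /=; ring.
Qed.

Let g_smooth c e : smooth2_on U (fun s t => g s t c e).
Proof.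
have Ak : analytic_on (fun s => Rabs s < d) k by apply: (pf_an P); right; left.
have Ar : analytic_on (fun s => Rabs s < d) r by apply: (pf_an P); do 3 right; left.
have Av : analytic_on (fun s => Rabs s < d) v by apply: (pf_an P); do 6 right; left.
have As : analytic_on (fun s => Rabs s < d) (fun s => sin (th s)).
  by apply: (pf_an P); do 7 right; left.
have Amu : analytic_on (fun s => Rabs s < d) mu by rewrite /mu /k2; analytic.
have E f : analytic_on (fun s => Rabs s < d) f ->
    (forall s, dmx2 (mu s) (- (mu s * r s ^ 2)) c e = f s) -> smooth2_on U (fun s t => g s t c e).
  move=> Hf Ef; apply: smooth2_ext (smooth_entry Hf); first exact: open2_box.
  by move=> s t Ust; rewrite g_dmx2.
move: c e E; apply: forall2; apply: forall2 => E.
- by apply: (E mu) => // s; rewrite dmx2E.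
- by apply: (E (fun _ => 0)) => [|s]; [exact: analytic_const | rewrite dmx2E].
- by apply: (E (fun _ => 0)) => [|s]; [exact: analytic_const | rewrite dmx2E].
- by apply: (E (fun s => - (mu s * r s ^ 2))) => [|s]; [analytic | rewrite dmx2E].
Qed.

Let Hmu s t : U s t -> is_derive mu s
  ((dk s + dk2 s) / 2 * v s + (k s + k2 L th s) / 2 * (- w s * v s)) /\ mu s <> 0.
Proof. by move=> [Hs _]; split; [exact: D_mu | exact: mu_neq0]. Qed.

Let mu_h s : Rabs s < d -> (k s + k2 L th s) / mu s = h s.
Proof.
move=> Hs; have v0 := Hv Hs; have := mu_neq0 Hs; rewrite /mu /h => m0.
have k0 : k s + k2 L th s <> 0 by move=> Z; apply: m0; rewrite Z; field.
by field; split.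
Qed.

Lemma surf_proper_biharmonic : proper_biharmonic L g X U.
Proof.
have HL0 : L <> 0 by lra.
split.
  split.
    split; first exact: g_smooth.
    move=> s t Ust; have [_ m0] := Hmu Ust; have [_ r0] := Hr Ust.
    have B0 : - (mu s * r s ^ 2) <> 0.
      by have := pow_nonzero _ 2 r0; move: (r s ^ 2) => z Hz; nra.
    rewrite g_dmx2 //; split; last by have [] := dmx2_inv m0 B0.
    by rewrite /dmx2 tr_diag_mx.
  split.
    move=> i; have [lX [lN [A1 _ E1 _]]] := surf_sepsum a b HL P i.
    apply: smooth2_ext (sepsum_smooth2_box A1); first exact: open2_box.
    by move=> s t _; apply: E1.
  split; first by move=> s t Ust; exact (fr_XX F Ust).
  move=> V e eps HV VU He s t Vst.
  have Hh s' t' : U s' t' -> [/\ (k s' + k2 L th s') / mu s' = h s', is_derive h s' (dh s'),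
      is_derive dh s' (ddh s'), is_derive k s' (dk s') & is_derive (k2 L th) s' (dk2 s')].
    move=> [Hs _]; split; [exact: mu_h | exact: D_h | | exact: D_k | exact: D_k2].
    exact: is_derive_mult (D_w Hs) (D_h Hs) Rmult_comm.
  apply: (bitension_zero HL0 (@box_rows d a b) F g_dmx2 Hmu Hr Hh _ _ HV VU He Vst).
    by move=> s' t' _; rewrite /ddh /dh /dw /k2; field.
  by move=> s' t' _; rewrite /dh /dk /k2; field.
move=> Hharm.
have U0 : U 0 0 by split=> //; rewrite Rabs_R0.
have H0 : Rabs 0 < d by rewrite Rabs_R0.
have := Hharm 0 0 U0; rewrite (frame_tension HL0 (@box_rows d a b) F g_dmx2 Hmu Hr U0) mu_h //.
move=> E; have : ip (h 0 *: N 0 0)%mc (N 0 0) = 0 by rewrite E ip0l.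
rewrite ipZl (fr_xixi F U0) Rmult_1_r /h.
by apply: Rmult_integral_contrapositive_currified; [lra | apply/Rinv_neq_0_compat/Hv].
Qed.

End Biharmonic.

Lemma continuous_neq0 (f : R * R * R -> R) p : continuous f p -> f p <> 0 ->
  locally p (fun x => f x <> 0).
Proof. by move=> Cf Hp; apply: (Cf (fun y => y <> 0)); apply: (open_neq 0). Qed.

Lemma admissible_open L : open (admissible L).
Proof.
have C1 (p : R * R * R) : continuous (fun x : R * R * R => x.1.1) p.
  by apply: (continuous_comp (fun x : R * R * R => x.1) (fun y : R * R => y.1));
    exact: continuous_fst.
have C2 (p : R * R * R) : continuous (fun x : R * R * R => x.1.2) p.
  by apply: (continuous_comp (fun x : R * R * R => x.1) (fun y : R * R => y.2));
    [exact: continuous_fst | exact: continuous_snd].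
have C3 (p : R * R * R) : continuous (fun x : R * R * R => x.2) p.
  exact: continuous_snd.
have Csin (p : R * R * R) : continuous (fun x : R * R * R => sin x.1.1) p.
  by apply: (continuous_comp (fun x : R * R * R => x.1.1) sin); [exact: C1 | exact: continuous_sin].
have Ccos (p : R * R * R) : continuous (fun x : R * R * R => cos x.1.1) p.
  by apply: (continuous_comp (fun x : R * R * R => x.1.1) cos); [exact: C1 | exact: continuous_cos].
have Cmul (f g : R * R * R -> R) p : continuous f p -> continuous g p -> continuous (fun x => f x * g x) p.
  by move=> Cf Cg; apply: (continuous_mult (K := R_AbsRing)).
have Cadd (f g : R * R * R -> R) p : continuous f p -> continuous g p -> continuous (fun x => f x + g x) p.
  by move=> Cf Cg; apply: (continuous_plus (V := R_NormedModule)).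
have Cc (c : R) (p : R * R * R) : continuous (fun _ => c) p by apply: continuous_const.
move=> [[th0 a0] b0] [H1 [H2 [H3 H4]]].
have A1 : locally (th0, a0, b0) (fun x => k10 L x.1.1 x.1.2 <> 0).
  by apply: continuous_neq0 => //; rewrite /k10 /Rdiv; auto.
have A2 : locally (th0, a0, b0) (fun x => H0 L x.1.1 x.1.2 <> 0).
  by apply: continuous_neq0 => //; rewrite /H0 /Rdiv; auto.
have A3 : locally (th0, a0, b0) (fun x => H0' L x.1.1 x.1.2 x.2 <> 0).
  by apply: continuous_neq0 => //; rewrite /H0' /Rdiv; auto 6.
have A4 : locally (th0, a0, b0) (fun x => H0 L x.1.1 x.1.2 + k10 L x.1.1 x.1.2 <> 0).
  apply: continuous_neq0; first by rewrite /k10 /H0 /Rdiv; auto 6.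
  by move: H4; rewrite /=; lra.
apply: filter_imp (filter_and _ _ (filter_and _ _ A1 A2) (filter_and _ _ A3 A4)).
by move=> [[x1 x2] x3] /= [[? ?] [? ?]]; do 3 split=> //; lra.
Qed.

Lemma pos_near (f : R -> R) d : 0 < d -> continuous f 0 -> 0 < f 0 ->
  exists d', 0 < d' <= d /\ forall s, Rabs s < d' -> 0 < f s.
Proof.
move=> Hd Cf H0.
have [e He] : locally 0 (fun s => 0 < f s) by apply: (Cf (fun y => 0 < y)); apply: (open_gt 0).
exists (Rmin e d); split.
  by split; [apply: Rmin_glb_lt => //; apply: cond_pos | exact: Rmin_r].
move=> s Hs; apply: He; change (Rabs (s - 0) < e); rewrite Rminus_0_r.
exact: Rlt_le_trans Hs (Rmin_l _ _).
Qed.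

Theorem theorem5p8 (L : R) (hL : 0 < L) :
  (forall th0 a0 b0 rho0 u0 : R,
     0 < rho0 -> admissible L (th0, a0, b0) -> u0 / H0 L th0 a0 > 0 ->
     exists (delta : R) (theta : R -> R),
       0 < delta /\
       theta_solution L theta th0 a0 b0 delta /\
       (forall (delta' : R) (theta' : R -> R), 0 < delta' ->
          theta_solution L theta' th0 a0 b0 delta' ->
          forall s, Rabs s < delta -> Rabs s < delta' -> theta' s = theta s) /\
       exists lambda : R -> R,
         (forall s, Rabs s < delta ->
            meanH L theta s <> 0 /\ 0 < lambda s /\
            lambda s ^ 2 = u L theta u0 s / meanH L theta s) /\
         (exists (a b : R) (X xi : R -> R -> 'cV[R]_4),
            a < b /\
            determined_by L theta rho0 (box delta a b) X xi /\
            (forall X' xi' : R -> R -> 'cV[R]_4,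
               determined_by L theta rho0 (box delta a b) X' xi' ->
               exists Q : 'M[R]_4, linear_isometry Q /\
                 forall s t, box delta a b s t ->
                   X' s t = (Q *m X s t)%mc /\ xi' s t = (Q *m xi s t)%mc) /\
            timelike (box delta a b) X /\
            parabolic_rotational (box delta a b) X /\
            proper_biharmonic L (conformal_metric lambda (rho L theta rho0)) X
              (box delta a b)) /\
         nonconstant_on (fun s => Rabs s < delta) (meanH L theta) /\
         nonconstant_on (fun s => Rabs s < delta) lambda) /\
  open (admissible L).
Proof.
split; last exact: admissible_open.
move=> th0 a0 b0 rho0 u0 Hrho [K0 [HH0 [HH1 HHk]]] Hu0.
have HL0 : L <> 0 by lra.
have u00 : u0 <> 0 by move=> Z; move: Hu0; rewrite Z /Rdiv Rmult_0_l; lra.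
set k0 := k10 L th0 a0 in K0 HHk *.
have [d0 [th [k [w [r [sg [x [v [Hd0 [P0 [Eth [Ek [Ew [Er [_ Ev]]]]]]]]]]]]]]] :=
  profile_exists th0 k0 (- H0' L th0 a0 b0 / k0) (/ u0) hL Hrho.
pose m s := (k s + k2 L th s) / 2.
have R0 : Rabs 0 < d0 by rewrite Rabs_R0.
have Ck : continuous k 0 by apply: (profile_continuous P0 _ R0); right; left.
have Cs : continuous (fun s => sin (th s)) 0.
  by apply: (profile_continuous P0 _ R0); do 7 right; left.
have Cscal (f : R -> R) c : continuous f 0 -> continuous (fun s => f s * c) 0.
  by move=> Cf; apply: (continuous_mult (K := R_AbsRing)) => //; apply: continuous_const.
have Cm : continuous m 0.
  rewrite /m /k2 /Rdiv; apply: (Cscal (fun s => k s + sin (th s) * / L)).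
  by apply: (continuous_plus (V := R_NormedModule)) => //; apply: Cscal.
have Em : m 0 = H0 L th0 a0 by rewrite /m /k2 Ek Eth /k0 /k10 /H0; field.
have Ek0 : k 0 * k 0 > 0 by rewrite Ek; nra.
have Em0 : m 0 * m 0 > 0 by rewrite Em; nra.
(* The interval is shrunk until [k1] and [H] keep their sign. *)
have [d1 [[Hd1 Hd1'] Pk]] := pos_near Hd0 (Cscal k (k 0) Ck) Ek0.
have [d [[Hd Hd'] Pm]] := pos_near Hd1 (Cscal m (m 0) Cm) Em0.
have P : profile L d th k w r sg x v by apply: profile_shrink P0; lra.
have Hk s : Rabs s < d -> k s <> 0.
  by move=> Hs Z; have := Pk s; rewrite Z Rmult_0_l => H; have := H (Rlt_le_trans _ _ _ Hs Hd'); lra.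
have HmH s : Rabs s < d -> meanH L th s = m s by apply: (profile_meanH hL P).
have HH s : Rabs s < d -> meanH L th s <> 0.
  by move=> Hs Z; have := Pm s Hs; rewrite -HmH // Z Rmult_0_l; lra.
have Z0 : Rabs 0 < d by rewrite Rabs_R0.
have Huv s : Rabs s < d -> u L th u0 s * v s = 1.
  by apply: (profile_u hL P Hk); rewrite Ev; field.
have Hv s : Rabs s < d -> v s <> 0.
  by move=> /Huv E Z; move: E; rewrite Z Rmult_0_r; lra.
have Eu s : Rabs s < d -> u L th u0 s = / v s.
  move=> Hs; apply: (Rmult_eq_reg_r (v s)); last exact: Hv.
  by rewrite Huv // Rinv_l //; apply: Hv.
have Hsol : theta_solution L th th0 a0 b0 d.
  have := profile_theta_solution hL Hd P Hk; rewrite Eth Ek Ew.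
  have -> : k0 - sin th0 / L = a0 by rewrite /k0 /k10; ring.
  have -> // : 2 * (- (- H0' L th0 a0 b0 / k0) * k0) - 2 * cos th0 / L * a0 = b0.
  by rewrite /H0'; field.
have Hpos s : Rabs s < d -> 0 < u L th u0 s / meanH L th s.
  move=> Hs; have M := Pm s Hs; rewrite -HmH // Em in M.
  have E : 0 < exp (- RInt (fun tau => Derive (meanH L th) tau / k1 L th tau) 0 s).
    exact: exp_pos.
  have h0 := HH s Hs.
  have -> : u L th u0 s / meanH L th s = (u0 / H0 L th0 a0) * (meanH L th s * H0 L th0 a0) *
     exp (- RInt (fun tau => Derive (meanH L th) tau / k1 L th tau) 0 s) / (meanH L th s) ^ 2.
    by rewrite /u; field.
  apply: Rdiv_lt_0_compat; last by have := pow2_gt_0 _ h0.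
  by apply: Rmult_lt_0_compat => //; apply: Rmult_lt_0_compat.
pose lambda s := sqrt (u L th u0 s / meanH L th s).
have Hlam s : Rabs s < d -> lambda s ^ 2 = u L th u0 s / meanH L th s.
  by move=> Hs; rewrite /lambda pow2_sqrt //; apply/Rlt_le/Hpos.
have Hlam' s : Rabs s < d -> / lambda s ^ 2 = meanH L th s * v s.
  by move=> Hs; rewrite Hlam // Eu //; have := HH s Hs; have := Hv s Hs => ? ?; field.
have Hab : -1 < 0 < 1 by lra.
have Hdet := surf_determined (-1) 1 hL Hd P; rewrite Er in Hdet.
exists d, th; split=> //; split=> //; split.
  by move=> d' th' Hd'' Hsol' s Hs Hs'; apply: (theta_solution_unique hL Hd Hd'' Hsol Hsol').
exists lambda; split.
  move=> s Hs; split; first exact: HH.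
  by split; [apply/sqrt_lt_R0/Hpos | exact: Hlam].
split.
  exists (-1), 1, (surfX L r sg x), (surfN L th r sg x); split; first lra.
  split=> //; split.
    move=> X' xi' Hdet'.
    have Hrr s t : box d (-1) 1 s t -> is_derive (rho L th rho0) s
        (cos (th s) / L * rho L th rho0 s) /\ rho L th rho0 s <> 0.
      move=> [Hs _]; have Erho z : Rabs z < d -> rho L th rho0 z = r z.
        by move=> Hz; rewrite -Er; apply: (profile_rho hL Hd P).
      rewrite Erho //; split; last exact (profile_r_neq0 P Hs).
      apply: is_derive_ext_loc (pf_r P Hs).
      by apply: filter_imp (ball0_locally Hs) => z Hz; rewrite Erho.
    have B : -1 < 1 by lra.
    exact: (frames_congruent HL0 Hd B Hrr (determined_frame HL0 (@box_rows _ _ _) Hrr Hdet)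
      (determined_frame HL0 (@box_rows _ _ _) Hrr Hdet')).
  split; first by apply: surf_timelike hL Hd P.
  split; first exact: (surf_parabolic (-1) 1 hL P).
  have := surf_proper_biharmonic hL Hd Hab P HH Hv Hlam'; by rewrite Er.
have DH s : Rabs s < d -> is_derive (meanH L th) s (- w s * k s) by apply: (profile_dmeanH hL P).
have w0 : w 0 <> 0.
  rewrite Ew => Z; apply: HH1; rewrite (_ : H0' _ _ _ _ = - (- H0' L th0 a0 b0 / k0) * k0).
    by rewrite Z; ring.
  by field.
split; move=> [c Hc].
  (* [H' = - w k1] does not vanish at 0. *)
  have E : - w 0 * k 0 = 0.
    rewrite -(is_derive_unique _ _ _ (DH 0 Z0)).
    rewrite (Derive_ext_loc _ (fun _ => c)) ?Derive_const //.
    by apply: filter_imp (ball0_locally Z0) => s; apply: Hc.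
  by have [] := Rmult_integral _ _ E; [lra | exact: Hk].
(* If [u = c ^ 2 * H] then [w u = u' = - c ^ 2 * w k1], so [H = - k1]. *)
have Euc s : Rabs s < d -> u L th u0 s = c ^ 2 * meanH L th s.
  by move=> Hs; rewrite -(Hc s Hs) Hlam //; field; apply: HH.
have Du : is_derive (u L th u0) 0 (w 0 * u L th u0 0).
  apply: (is_derive_ext_loc (fun s => / v s)).
    by apply: filter_imp (ball0_locally Z0) => s Hs; rewrite Eu.
  have Dv := pf_v P Z0; have v0 := Hv 0 Z0.
  auto_derive; first by split; [eexists; exact: Dv | split].
  by rewrite (is_derive_unique _ _ _ Dv) Eu //; field.
have E : w 0 * u L th u0 0 = c ^ 2 * (- w 0 * k 0).
  rewrite -(is_derive_unique _ _ _ Du) -(is_derive_unique _ _ _ (DH 0 Z0)) -Derive_scal.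
  by apply: Derive_ext_loc; apply: filter_imp (ball0_locally Z0) => s; apply: Euc.
apply: HHk; rewrite -Em -HmH // -Ek.
have c0 : c ^ 2 <> 0.
  by move=> Z; have := Hpos 0 Z0; rewrite Euc // Z Rmult_0_l /Rdiv Rmult_0_l; lra.
rewrite Euc // in E.
have {}E : w 0 * c ^ 2 * (meanH L th 0 + k 0) = 0 by lra.
have [] := Rmult_integral _ _ E; last lra.
by move=> /Rmult_integral [].
Qed.
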